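(* Let $n\ge2$, $f\in C_c^\infty(\mathbb{R}^n)$, $F=Pf$, and define $$g(x)=\pi^{1-n}\int_{\mathbb{R}^{n-1}}F(z',\,x_n-2z'\cdot x'+|z'|^2)\,\frac{dz'}{(1+4|z'|^2)^{(n-1)/2}},\qquad x=(x',x_n)\in\mathbb{R}^n.$$ If $n$ is odd, then $f=B_1^{-1}\psi$ with $$\psi(x)=(-\Delta)^{(n-1)/2}g(x).$$ If $n$ is even, then $f=B_1^{-1}\psi$ with $$\psi(x)=c_n\int_{\mathbb{R}^n}\frac{(-\Delta)^{n/2-1}g(x)-(-\Delta)^{n/2-1}g(x-y)}{|y|^{n+1}}\,dy,\qquad c_n=\frac{\Gamma((n+1)/2)}{\pi^{(n+1)/2}},$$ where $\int_{\mathbb{R}^n}=\lim_{\varepsilon\to0}\int_{|y|>\varepsilon}$ uniformly in $x\in\mathbb{R}^n$.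
   Context: Points of $\mathbb{R}^n$ are written $x=(x',x_n)$, $x'\in\mathbb{R}^{n-1}$. The parabolic Radon transform is $$(Pf)(x)=\int_{\mathbb{R}^{n-1}}f(x'-y',\,x_n-|y'|^2)\,dy',\qquad x\in\mathbb{R}^n.$$ $\Delta=\partial^2/\partial x_1^2+\dots+\partial^2/\partial x_n^2$ is the Laplace operator. The map $B_1^{-1}$ is defined by $(B_1^{-1}\psi)(x)=\psi(x',x_n+|x'|^2)$. *)

(* Defs.v *)
From HB Require Import structures.
From mathcomp Require Import all_boot all_order all_algebra.
From mathcomp Require Import all_classical all_reals all_analysis.

Set Implicit Arguments.
Unset Strict Implicit.
Unset Printing Implicit Defensive.

Import Order.TTheory GRing.Theory Num.Theory.
Import numFieldTopology.Exports numFieldNormedType.Exports.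

Local Open Scope classical_set_scope.
Local Open Scope ring_scope.

(** * Row vectors as points of R^n *)

(* R^(m+1) = R^m * R: a point x is [xjoin (xinit x) (xlast x)], that is
   (x', x_n) with x' = [xinit x] and x_n = [xlast x]. *)
Definition xinit (R : Type) (m : nat) (x : 'rV[R]_m.+1) : 'rV[R]_m :=
  \row_(i < m) x 0 (lift ord_max i).

Definition xlast (R : Type) (m : nat) (x : 'rV[R]_m.+1) : R := x 0 ord_max.

Definition xjoin (R : Type) (m : nat) (y : 'rV[R]_m) (t : R) : 'rV[R]_m.+1 :=
  \row_(i < m.+1) (if unlift ord_max i is Some j then y 0 j else t).

Lemma xinit_join (R : Type) (m : nat) (y : 'rV[R]_m) (t : R) :
  xinit (xjoin y t) = y.
Proof. by apply/rowP => i; rewrite !mxE liftK. Qed.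

Lemma xlast_join (R : Type) (m : nat) (y : 'rV[R]_m) (t : R) :
  xlast (xjoin y t) = t.
Proof. by rewrite /xlast mxE unlift_none. Qed.

Lemma xjoinK (R : Type) (m : nat) (x : 'rV[R]_m.+1) :
  xjoin (xinit x) (xlast x) = x.
Proof.
by apply/rowP => i; rewrite mxE; case: unliftP => [j ->|->//]; rewrite mxE.
Qed.

(* The norm `|x| of the library on matrices is the sup norm, hence the
   Euclidean one here. *)
Definition dotp (R : realType) (m : nat) (x y : 'rV[R]_m) : R :=
  \sum_(i < m) x 0 i * y 0 i.

Definition enorm (R : realType) (m : nat) (x : 'rV[R]_m) : R :=
  Num.sqrt (dotp x x).

(** * Lebesgue measure on R^n *)

Definition measure_rV_display : measure_display -> measure_display.
Proof. exact. Qed.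

Section measurable_rV.
Context {d : measure_display} {T : measurableType d}.
Variable n : nat.

Let coors : 'I_n -> 'rV[T]_n -> T := fun i x => x 0 i.

Let rV_set0 : g_sigma_preimage coors set0.
Proof. exact: sigma_algebra0. Qed.

Let rV_setC A : g_sigma_preimage coors A -> g_sigma_preimage coors (~` A).
Proof. exact: sigma_algebraC. Qed.

Let rV_bigcup (F : _^nat) : (forall i, g_sigma_preimage coors (F i)) ->
  g_sigma_preimage coors (\bigcup_i (F i)).
Proof. exact: sigma_algebra_bigcup. Qed.

HB.instance Definition _ := @isMeasurable.Build (measure_rV_display d)
  'rV[T]_n (g_sigma_preimage coors) rV_set0 rV_setC rV_bigcup.

End measurable_rV.

Lemma measurable_coord d (T : measurableType d) (n : nat) (i : 'I_n) :
  measurable_fun [set: 'rV[T]_n] (fun x => x 0 i).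
Proof.
move=> _ Y mY; rewrite setTI; apply: sub_sigma_algebra => /=.
rewrite -bigcup_seq/=; exists i => /=; first by rewrite mem_index_enum.
by exists Y => //; rewrite setTI.
Qed.

Lemma measurable_fun_rVP d1 d2 (T1 : measurableType d1) (T2 : measurableType d2)
    (n : nat) (f : T1 -> 'rV[T2]_n) :
  measurable_fun [set: T1] f <->
  forall i, measurable_fun [set: T1] (fun t => f t 0 i).
Proof.
split=> [mf i|mf].
  exact: (measurableT_comp (measurable_coord (T := T2) i) mf).
apply: (@measurability _ _ _ _ setT f
  (\big[setU/set0]_(i < n)
     preimage_set_system setT (fun x : 'rV[T2]_n => x 0 i) measurable)) => //.
move=> _ [C + <-]; rewrite -bigcup_seq/= => -[i _ [B mB <-]].
by rewrite [X in _ `&` (f @^-1` X)]setTI; exact: mf.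
Qed.

Lemma measurable_xjoin d (T : measurableType d) (m : nat) :
  measurable_fun [set: 'rV[T]_m * T] (fun p => xjoin p.1 p.2).
Proof.
apply/measurable_fun_rVP => i; rewrite /xjoin.
under eq_fun do rewrite mxE.
case: unliftP => [j _|_]; last exact: measurable_snd.
exact: (measurableT_comp (measurable_coord (T := T) j) measurable_fst).
Qed.

Section lebesgue_rVS.
Local Open Scope ereal_scope.
Context {R : realType}.
Variables (m : nat) (mu : {sigma_finite_measure set 'rV[R]_m -> \bar R}).

Let join (p : 'rV[R]_m * measurableTypeR R) : 'rV[R]_m.+1 := xjoin p.1 p.2.

Let measurable_join : measurable_fun setT join.
Proof. exact: measurable_xjoin. Qed.

Definition lebesgue_rVS : set 'rV[R]_m.+1 -> \bar R :=
  pushforward (mu \x @lebesgue_measure R) join.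

Let lebesgue_rVS0 : lebesgue_rVS set0 = 0.
Proof. by rewrite /lebesgue_rVS /pushforward preimage_set0 measure0. Qed.

Let lebesgue_rVS_ge0 A : 0 <= lebesgue_rVS A.
Proof. exact: measure_ge0. Qed.

Let lebesgue_rVS_sigma_additive : semi_sigma_additive lebesgue_rVS.
Proof.
exact: (@measure_semi_sigma_additive _ _ _
  (pushforward (mu \x @lebesgue_measure R) join)).
Qed.

HB.instance Definition _ := isMeasure.Build _ _ _ lebesgue_rVS
  lebesgue_rVS0 lebesgue_rVS_ge0 lebesgue_rVS_sigma_additive.

Let lebesgue_rVS_sigma_finite : sigma_finite setT lebesgue_rVS.
Proof.
have /sigma_finiteP[F [TF ndF Foo]] := sigma_finiteT mu.
have /sigma_finiteP[G [TG ndG Goo]] := sigma_finiteT (@lebesgue_measure R).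
pose H k := [set x : 'rV[R]_m.+1 | F k (xinit x) /\ G k (xlast x)].
have mH k : measurable (H k).
  rewrite (_ : H k = (setT `&` @xinit R m @^-1` F k) `&`
                     (setT `&` @xlast R m @^-1` G k)); last first.
    by rewrite !setTI.
  apply: measurableI; last exact: (measurable_coord _ _ (proj1 (Goo k))).
  have mxinit : measurable_fun setT (@xinit R m).
    apply/measurable_fun_rVP => i.
    under eq_fun do rewrite mxE.
    exact: measurable_coord.
  exact: (mxinit _ _ (proj1 (Foo k))).
exists H => [|k].
  apply/seteqP; split=> // x _.
  have [i _ Fi] : (\bigcup_i F i) (xinit x) by rewrite -TF.
  have [j _ Gj] : (\bigcup_i G i) (xlast x) by rewrite -TG.
  exists (maxn i j) => //; split.
  - by move: Fi; exact/subsetPset/ndF/leq_maxl.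
  - by move: Gj; exact/subsetPset/ndG/leq_maxr.
have [mF Fk] := Foo k; have [mG Gk] := Goo k; split=> //.
rewrite /lebesgue_rVS /pushforward (_ : join @^-1` _ = F k `*` G k); last first.
  by apply/seteqP; split=> -[y t] /=; rewrite /H /= xinit_join xlast_join.
by rewrite product_measure1E// lte_mul_pinfty// ge0_fin_numE.
Qed.

HB.instance Definition _ := Measure_isSigmaFinite.Build _ _ _ lebesgue_rVS
  lebesgue_rVS_sigma_finite.

End lebesgue_rVS.

(* In dimension 0 the measure is the unit mass at the only point; in dimension
   m+1 it is the product of the measures on R^m and on R, on the sigma-algebra
   generated by the coordinates, that is the Borel sets. *)
Fixpoint lebesgue_rV (R : realType) (n : nat) :
    {sigma_finite_measure set 'rV[R]_n -> \bar R} :=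
  if n is m.+1 then lebesgue_rVS (lebesgue_rV R m) else \d_(0 : 'rV[R]_0).

(** * Calculus on R^n *)

Definition pderive (R : realType) (n : nat) (i : 'I_n) (f : 'rV[R]_n -> R) :
    'rV[R]_n -> R :=
  'D_(delta_mx 0 i) f.

Definition pderives (R : realType) (n : nat) (s : seq 'I_n)
    (f : 'rV[R]_n -> R) : 'rV[R]_n -> R :=
  foldr (@pderive R n) f s.

(* Partial derivatives of all orders exist and are continuous. *)
Definition smooth (R : realType) (n : nat) (f : 'rV[R]_n -> R) : Prop :=
  forall s : seq 'I_n, continuous (pderives s f) /\
    forall (i : 'I_n) (x : 'rV[R]_n), derivable (pderives s f) x (delta_mx 0 i).

Definition compactly_supported (R : realType) (n : nat) (f : 'rV[R]_n -> R) :
    Prop :=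
  compact (closure [set x | f x != 0]).

Definition laplacian (R : realType) (n : nat) (f : 'rV[R]_n -> R) :
    'rV[R]_n -> R :=
  fun x => \sum_(i < n) pderive i (pderive i f) x.

(* The power (-Delta)^k of the operator -Delta. *)
Definition neg_laplacian_pow (R : realType) (n k : nat) (f : 'rV[R]_n -> R) :
    'rV[R]_n -> R :=
  iter k (fun (h : 'rV[R]_n -> R) (x : 'rV[R]_n) => - laplacian h x) f.

Definition Gamma (R : realType) (s : R) : R :=
  \int[@lebesgue_measure R]_(t in `]0, +oo[) (t `^ (s - 1) * expR (- t)).

(** * The parabolic Radon transform *)

Definition parabolic_radon (R : realType) (m : nat) (f : 'rV[R]_m.+1 -> R) :
    'rV[R]_m.+1 -> R :=
  fun x => \int[lebesgue_rV R m]_y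
    f (xjoin (xinit x - y) (xlast x - enorm y ^+ 2)).

Definition B1inv (R : realType) (m : nat) (psi : 'rV[R]_m.+1 -> R) :
    'rV[R]_m.+1 -> R :=
  fun x => psi (xjoin (xinit x) (xlast x + enorm (xinit x) ^+ 2)).

(* Main.v *)
(* Put psi x = f (x', x_n - |x'|^2), so that f = B_1^-1 psi, and n = m + 1.
   Substituting in P, g is an average of integrals of psi over hyperplanes,
   g(x) = pi^-m \int (1+4|z|^2)^(-m/2) \int psi (x - (v, 2 z.v)) dv dz.
   The weight (1+4|z|^2)^(-m/2) is a Gamma integral of Gaussians in z; integrating
   in z first, only the component of z along v matters, and the remaining
   one-dimensional integrals give g = const * (psi convolved with |y|^-1).

   Let P_s be the heat semigroup and p_s its kernel. Since |y|^-1 is a constant times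
   \int_0^oo s^(m/2-1) p_s(y) ds, g is the Riesz potential
   Gamma(m/2)^-1 \int_0^oo s^(m/2-1) P_s psi ds. Applying -Delta and integrating by
   parts in s (d/ds P_s = P_s Delta, P_s psi = O(s^(-n/2)) at infinity) lowers the
   exponent by one. For n odd, m/2 is an integer and P_0 psi = psi ends the descent.
   For n even it stops at h = pi^(-1/2) \int_0^oo s^(-1/2) P_s psi ds. In that case
   c_n |y|^(-n-1) = (2 sqrt pi)^-1 \int_0^oo t^(-3/2) p_t(y) dt, so that the integral
   of the statement, symmetrized in y, is
   (2 sqrt pi)^-1 \int_0^oo t^(-3/2) (h - P_t h) dt, which equals psi by one integration
   by parts and B(1/2,1/2) = pi. The second differences of h are at most
   K min(1, |y|^2), which gives the uniform convergence of the truncated integrals. *)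

Require Import Defs.
From HB Require Import structures.
From mathcomp Require Import all_boot all_order all_algebra.
From mathcomp Require Import all_classical all_reals all_analysis measurable_realfun.
From mathcomp Require Import ring lra.

Set Implicit Arguments.
Unset Strict Implicit.
Unset Printing Implicit Defensive.

Import Order.TTheory GRing.Theory Num.Theory.
Import numFieldTopology.Exports numFieldNormedType.Exports.

Local Open Scope classical_set_scope.
Local Open Scope ring_scope.

(** * Integrals of real functions *)

(** Neither Fourier transforms nor polar coordinates occur. Gaussians factor over the coordinates,
    so their mass, their convolutions and their images under linear forms are computed by induction
    on the dimension, along the recursive definition of [lebesgue_rV]. Even the integrability of
    |y|^-1 against a Gaussian, and that of min(1, |y|^2) |y|^(-n-1), is read off the time integrals
    of heat kernels that represent these kernels. Exchanges of integrals with a singular kernel are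
    first made for nonnegative functions; the finite value found there supplies the integrability
    that the signed case requires. The critical dimension is n = 2, where P_s psi decays only like
    1/s. The decay of P_s Delta psi is therefore also estimated with the derivative on the kernel,
    which gains a factor 1/s. Since [smooth] speaks of partial derivatives only, the shear is
    treated by a chain rule along two directions, and increments are estimated one coordinate at a
    time. *)

Section generic_integral.
Context d (T : measurableType d) (R : realType) (mu : {measure set T -> \bar R}).
Implicit Types (D : set T) (f g : T -> R).

Lemma integrable_le D f g : measurable D -> measurable_fun D f ->
  (forall x, D x -> `|f x| <= g x) ->
  mu.-integrable D (EFin \o g) -> mu.-integrable D (EFin \o f).
Proof.
move=> mD mf fg; apply: le_integrable => //; first exact/measurable_EFinP.
by move=> x Dx; rewrite /= lee_fin (le_trans (fg _ Dx))// ler_norm.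
Qed.

Lemma integrable_ge0 D f : measurable D -> measurable_fun D f ->
  (forall x, D x -> 0 <= f x) -> (\int[mu]_(x in D) (f x)%:E < +oo)%E ->
  mu.-integrable D (EFin \o f).
Proof.
move=> mD mf f0 foo; apply/integrableP; split; first exact/measurable_EFinP.
rewrite (eq_integral (fun x => (f x)%:E))// => x /[!inE] Dx /=.
by rewrite ger0_norm// f0.
Qed.

Lemma integrable_scale D f k : measurable D -> mu.-integrable D (EFin \o f) ->
  mu.-integrable D (EFin \o (fun x => k * f x)).
Proof.
move=> mD fi; rewrite (_ : EFin \o _ = (fun x => k%:E * (EFin \o f) x)%E).
  exact: integrableZl.
by apply/funext => x /=; rewrite EFinM.
Qed.

Lemma integrable_add D f g : measurable D -> mu.-integrable D (EFin \o f) ->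
  mu.-integrable D (EFin \o g) ->
  mu.-integrable D (EFin \o (fun x => f x + g x)).
Proof.
move=> mD fi gi; rewrite (_ : EFin \o _ = (EFin \o f) \+ (EFin \o g))%E.
  exact: integrableD.
by apply/funext => x /=; rewrite EFinD.
Qed.

Lemma integrable_sub D f g : measurable D -> mu.-integrable D (EFin \o f) ->
  mu.-integrable D (EFin \o g) ->
  mu.-integrable D (EFin \o (fun x => f x - g x)).
Proof.
move=> mD fi gi; rewrite (_ : EFin \o _ = (EFin \o f) \- (EFin \o g))%E.
  exact: integrableB.
by apply/funext => x /=; rewrite EFinB.
Qed.

(** [Rintegral] is the [fine] part of the extended integral and returns 0 on an infinite one;
    integrability is what makes the two agree. *)
Lemma integral_EFin_Rintegral D f : measurable D -> mu.-integrable D (EFin \o f) ->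
  (\int[mu]_(x in D) (f x)%:E)%E = (\int[mu]_(x in D) f x)%:E.
Proof. by move=> mD fi; rewrite /Rintegral fineK//; exact: integrable_fin_num. Qed.

Lemma Rintegral_EFin D f (l : R) :
  (\int[mu]_(x in D) (f x)%:E = l%:E)%E -> \int[mu]_(x in D) f x = l.
Proof. by rewrite /Rintegral => ->. Qed.

Lemma eq_ge0_integral D (f g : T -> \bar R) :
  (forall x, D x -> f x = g x) ->
  (\int[mu]_(x in D) f x = \int[mu]_(x in D) g x)%E.
Proof. by move=> fg; apply: eq_integral => x /[!inE] /fg. Qed.

Lemma eq_RintegralD D f g : (forall x, D x -> f x = g x) ->
  \int[mu]_(x in D) f x = \int[mu]_(x in D) g x.
Proof. by move=> fg; apply: eq_Rintegral => x /[!inE] /fg. Qed.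

Lemma le_abs_Rintegral D f g : measurable D -> measurable_fun D f ->
  (forall x, D x -> `|f x| <= g x) -> mu.-integrable D (EFin \o g) ->
  `|\int[mu]_(x in D) f x| <= \int[mu]_(x in D) g x.
Proof.
move=> mD mf fg gi; have fi := integrable_le mD mf fg gi.
apply: (le_trans (le_normr_Rintegral _ _)) => //; apply: le_Rintegral => //.
by apply: integrable_norm.
Qed.

End generic_integral.

(** * Tonelli and Fubini on a rectangle *)

Section fubini_on.
Context d1 d2 (T1 : measurableType d1) (T2 : measurableType d2) (R : realType).
Variables (m1 : {sigma_finite_measure set T1 -> \bar R}).
Variables (m2 : {sigma_finite_measure set T2 -> \bar R}).
Variables (D1 : set T1) (D2 : set T2).
Hypotheses (mD1 : measurable D1) (mD2 : measurable D2).

Lemma measurable_setX_restrict (f : T1 -> T2 -> \bar R) :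
  measurable_fun setT (fun p : T1 * T2 => f p.1 p.2) ->
  measurable_fun setT ((fun p : T1 * T2 => f p.1 p.2) \_ (D1 `*` D2)).
Proof.
move=> mf; apply/measurable_restrict => //; first exact: measurableX.
by rewrite setTI; exact: measurable_funTS.
Qed.

(** Extending the integrand by zero outside the rectangle turns both iterated integrals into
    integrals over the whole spaces. *)
Lemma tonelli_on (f : T1 -> T2 -> \bar R) :
  measurable_fun setT (fun p : T1 * T2 => f p.1 p.2) ->
  (forall x y, D1 x -> D2 y -> 0 <= f x y)%E ->
  (\int[m1]_(x in D1) \int[m2]_(y in D2) f x y =
   \int[m2]_(y in D2) \int[m1]_(x in D1) f x y)%E.
Proof.
move=> mf f0.
pose F := (fun p : T1 * T2 => f p.1 p.2) \_ (D1 `*` D2).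
have F0 p : (0 <= F p)%E.
  rewrite /F patchE; case: ifPn => // /[!inE] -[]; exact: f0.
have FE x y : D1 x -> D2 y -> F (x, y) = f x y.
  by move=> Dx Dy; rewrite /F patchE mem_set.
have F01 x y : ~ D1 x -> F (x, y) = 0%E.
  by move=> Dx; rewrite /F patchE memNset//= => -[].
have F02 x y : ~ D2 y -> F (x, y) = 0%E.
  by move=> Dx; rewrite /F patchE memNset//= => -[].
have := @fubini_tonelli _ _ _ _ _ m1 m2 _ (measurable_setX_restrict mf) F0.
rewrite -/F => FT; etransitivity; [|etransitivity; [exact: FT|]].
  rewrite integral_mkcond; apply: eq_integral => x _; rewrite patchE.
  have [Dx|Dx] := pselect (D1 x); [rewrite (mem_set Dx)|rewrite (memNset Dx)]; last by rewrite integral0_eq// => y _; exact: F01.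
  rewrite integral_mkcond; apply: eq_integral => y _; rewrite patchE.
  have [Dy|Dy] := pselect (D2 y); [rewrite (mem_set Dy)|rewrite (memNset Dy)]; last by rewrite F02.
  by rewrite FE.
rewrite [RHS]integral_mkcond; apply: eq_integral => y _; rewrite patchE.
have [Dy|Dy] := pselect (D2 y); [rewrite (mem_set Dy)|rewrite (memNset Dy)]; last by rewrite integral0_eq// => x _; exact: F02.
rewrite [RHS]integral_mkcond; apply: eq_integral => x _; rewrite patchE.
have [Dx|Dx] := pselect (D1 x); [rewrite (mem_set Dx)|rewrite (memNset Dx)]; last by rewrite F01.
by rewrite FE.
Qed.

Lemma measurable_fun_integral_on (f : T1 -> T2 -> \bar R) :
  measurable_fun setT (fun p : T1 * T2 => f p.1 p.2) ->
  (forall x y, D2 y -> 0 <= f x y)%E ->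
  measurable_fun setT (fun x => \int[m2]_(y in D2) f x y)%E.
Proof.
move=> mf f0.
have := @measurable_fun_fubini_tonelli_F _ _ T1 T2 R m2
  ((fun p : T1 * T2 => f p.1 p.2) \_ (setT `*` D2)).
rewrite /fubini_F => H.
apply: (eq_measurable_fun _ _ (H _ _)).
- move=> x _; rewrite [RHS]integral_mkcond; apply: eq_integral => y _.
  rewrite !patchE; have [Dy|Dy] := pselect (D2 y).
    by rewrite (mem_set Dy) mem_set.
  by rewrite (memNset Dy) memNset//= => -[].
- apply/measurable_restrict => //; first exact: measurableX.
  by rewrite setTI; exact: measurable_funTS.
- by move=> p; rewrite patchE; case: ifPn => // /[!inE] -[_]; exact: f0.
Qed.

Section signed.
Variable f : T1 -> T2 -> R.
Hypothesis mf : measurable_fun setT (fun p : T1 * T2 => f p.1 p.2).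
Hypothesis foo :
  (\int[m1]_(x in D1) \int[m2]_(y in D2) `|f x y|%:E < +oo)%E.

Let F := (fun p : T1 * T2 => f p.1 p.2) \_ (D1 `*` D2).

Let FE x y : D1 x -> D2 y -> F (x, y) = f x y.
Proof. by move=> Dx Dy; rewrite /F patchE mem_set. Qed.
Let F01 x y : ~ D1 x -> F (x, y) = 0.
Proof. by move=> Dx; rewrite /F patchE memNset//= => -[]. Qed.
Let F02 x y : ~ D2 y -> F (x, y) = 0.
Proof. by move=> Dx; rewrite /F patchE memNset//= => -[]. Qed.

Let mF : measurable_fun setT F.
Proof.
apply/measurable_restrict => //; first exact: measurableX.
by rewrite setTI; exact: measurable_funTS.
Qed.

Lemma fubini_on_integrable : (m1 \x m2)%E.-integrable setT (EFin \o F).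
Proof.
apply/integrable12ltyP; first exact/measurable_EFinP.
apply: le_lt_trans foo; rewrite le_eqVlt; apply/orP; left; apply/eqP.
rewrite [RHS]integral_mkcond; apply: eq_integral => x _; rewrite patchE.
have [Dx|Dx] := pselect (D1 x); [rewrite (mem_set Dx)|rewrite (memNset Dx)]; last first.
  by rewrite integral0_eq// => y _; rewrite /= F01// normr0.
rewrite [RHS]integral_mkcond; apply: eq_integral => y _; rewrite patchE.
have [Dy|Dy] := pselect (D2 y); [rewrite (mem_set Dy)|rewrite (memNset Dy)]; last by rewrite /= F02// normr0.
by rewrite /= FE.
Qed.

Lemma fubini_on_F x :
  (\int[m2]_y (F (x, y))%:E = if x \in D1 then \int[m2]_(y in D2) (f x y)%:E else 0)%E.
Proof.
have [Dx|Dx] := pselect (D1 x); [rewrite (mem_set Dx)|rewrite (memNset Dx)]; last by rewrite integral0_eq// => y _; rewrite F01.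
rewrite [RHS]integral_mkcond; apply: eq_integral => y _; rewrite patchE.
have [Dy|Dy] := pselect (D2 y); [rewrite (mem_set Dy)|rewrite (memNset Dy)]; last by rewrite F02.
by rewrite FE.
Qed.

Lemma fubini_on_G y :
  (\int[m1]_x (F (x, y))%:E = if y \in D2 then \int[m1]_(x in D1) (f x y)%:E else 0)%E.
Proof.
have [Dy|Dy] := pselect (D2 y); [rewrite (mem_set Dy)|rewrite (memNset Dy)]; last first.
  by rewrite integral0_eq// => x _; rewrite F02.
rewrite [RHS]integral_mkcond; apply: eq_integral => x _; rewrite patchE.
have [Dx|Dx] := pselect (D1 x); [rewrite (mem_set Dx)|rewrite (memNset Dx)]; last by rewrite F01.
by rewrite FE.
Qed.

(** The slices may fail to be integrable on a null set of [x], where [fine] can return a meaningless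
    value. The inner real integral is therefore compared with the extended one only almost
    everywhere. *)
Lemma fubini_on_prod1 : \int[m1]_(x in D1) \int[m2]_(y in D2) f x y =
  \int[(m1 \x m2)%E]_(p in setT) F p.
Proof.
have Fi := fubini_on_integrable.
have aeF : {ae m1, forall x, setT x -> (\int[m2]_y (F (x, y))%:E =
    ((fun x => \int[m2]_(y in D2) f x y) \_ D1 x)%:E)%E}.
  apply: filterS (ae_integrable1 Fi) => x xi _; rewrite patchE.
  have := integrable_fin_num _ xi; rewrite fubini_on_F.
  by case: ifPn => // _ fin; rewrite /Rintegral fineK// fin.
rewrite Rintegral_mkcond /Rintegral -[in RHS]integral12_prod_meas1//; congr fine.
apply/esym; apply: ae_eq_integral => //.
  exact: (measurable_fubini_F Fi).
rewrite (_ : (fun _ => _) = EFin \o ((fun x => fine (fubini_F m2 (EFin \o F) x)))).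
  apply/measurable_EFinP; apply: measurableT_comp => //.
  exact: (measurable_fubini_F Fi).
by apply/funext => x /=; rewrite /fubini_F fubini_on_F patchE; case: ifPn.
Qed.

Lemma fubini_on_prod2 : \int[m2]_(y in D2) \int[m1]_(x in D1) f x y =
  \int[(m1 \x m2)%E]_(p in setT) F p.
Proof.
have Fi := fubini_on_integrable.
have aeF : {ae m2, forall y, setT y -> (\int[m1]_x (F (x, y))%:E =
    ((fun y => \int[m1]_(x in D1) f x y) \_ D2 y)%:E)%E}.
  apply: filterS (ae_integrable2 Fi) => y yi _; rewrite patchE.
  have := integrable_fin_num _ yi; rewrite fubini_on_G.
  by case: ifPn => // _ fin; rewrite /Rintegral fineK// fin.
rewrite Rintegral_mkcond /Rintegral -[in RHS]integral21_prod_meas1//; congr fine.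
apply/esym; apply: ae_eq_integral => //.
  exact: (measurable_fubini_G Fi).
rewrite (_ : (fun _ => _) = EFin \o ((fun x => fine (fubini_G m1 (EFin \o F) x)))).
  apply/measurable_EFinP; apply: measurableT_comp => //.
  exact: (measurable_fubini_G Fi).
by apply/funext => x /=; rewrite /fubini_G fubini_on_G patchE; case: ifPn.
Qed.

Lemma fubini_on : \int[m1]_(x in D1) \int[m2]_(y in D2) f x y =
  \int[m2]_(y in D2) \int[m1]_(x in D1) f x y.
Proof. by rewrite fubini_on_prod1 fubini_on_prod2. Qed.

End signed.

End fubini_on.

(** * The half-line *)

Definition pos {R : realType} : set R := `]0, +oo[%classic.

Section half_line.
Context {R : realType}.
Notation mu := (@lebesgue_measure R).
Implicit Types (f g G v : R -> R) (a b c s t l : R).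

Lemma measurable_pos : measurable (pos : set (measurableTypeR R)).
Proof. exact: measurable_itv. Qed.

Lemma posP s : pos s <-> 0 < s.
Proof. by rewrite /pos /= in_itv/= andbT. Qed.

(** Compact segments that exhaust the half-line, so that the fundamental theorem of calculus applies
    on each. Their endpoints are exchanged by s -> 1/s, which serves in [ge0_integral_pos_inv]. *)
Let seg (k : nat) : set R := `[k.+1%:R^-1, k.+1%:R]%classic.

Let bigcup_seg : \bigcup_k seg k = pos.
Proof.
apply/seteqP; split => [s [k _]|s /posP s0].
  rewrite /seg /= in_itv/= => /andP[+ _] => /(lt_le_trans _) h; apply/posP/h.
  by rewrite invr_gt0.
exists (Num.truncn (s + s^-1)) => //; rewrite /seg /= in_itv/=.
have s10 : 0 < s^-1 by rewrite invr_gt0.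
have := truncnS_gt (s + s^-1); set k := (_.+1)%:R => sk; apply/andP; split.
  rewrite -[leRHS]invrK lef_pV2 ?posrE//; first lra.
rewrite ltW//; lra.
Qed.

Let seg_pos k : seg k `<=` pos.
Proof. by rewrite -bigcup_seg; exact: bigcup_sup. Qed.

Let nondecreasing_seg : {homo seg : n m / (n <= m)%N >-> (n <= m)%O}.
Proof.
move=> n m nm; apply/subsetPset => s; rewrite /seg /= !in_itv/= => /andP[a b].
apply/andP; split; [apply: le_trans a|apply: (le_trans b)].
  by rewrite lef_pV2 ?posrE// ler_nat.
by rewrite ler_nat.
Qed.

Let mseg k : measurable (seg k).
Proof. exact: measurable_itv. Qed.

Lemma measurable_fun_pos f : {in pos, continuous f} ->
  measurable_fun pos f.
Proof. by move=> cf; apply: open_continuous_measurable_fun => //; exact: interval_open. Qed.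

Let cvg_seg_ge0 g : {in pos, continuous g} ->
  (forall s, 0 < s -> 0 <= g s) ->
  (\int[mu]_(s in seg k) (g s)%:E @[k --> \oo] --> \int[mu]_(s in pos) (g s)%:E)%E.
Proof.
move=> cg g0; rewrite -bigcup_seg; apply: ge0_nondecreasing_set_cvg_integral.
- exact: nondecreasing_seg.
- by move=> k; exact: mseg.
- move=> k; apply/measurable_EFinP.
  by apply: (measurable_funS _ (@seg_pos k)); [exact: measurable_pos|exact: measurable_fun_pos].
- by move=> k s /seg_pos/posP s0; rewrite lee_fin g0.
Qed.

Let cvg_seg g : {in pos, continuous g} ->
  mu.-integrable pos (EFin \o g) ->
  (\int[mu]_(s in seg k) (g s)%:E @[k --> \oo] --> \int[mu]_(s in pos) (g s)%:E)%E.
Proof.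
move=> cg gi.
have mg := measurable_fun_pos cg.
have [] := @dominated_convergence _ _ _ mu pos measurable_pos
  (fun k s => ((g \_ (seg k)) s)%:E) (fun s => (g s)%:E) (fun s => `|(g s)%:E|%E).
- move=> k; apply/measurable_EFinP; apply/measurable_restrict; [exact: mseg|exact: measurable_pos|].
  by apply: (measurable_funS _ (@subIsetl _ _ _)); [exact: measurable_pos|].
- exact/measurable_EFinP.
- apply/aeW => s; rewrite -bigcup_seg => -[k0 _ k0s].
  apply: cvg_near_cst; exists k0 => // k /= k0k.
  rewrite patchE mem_set//.
  by move: (nondecreasing_seg k0k) => /subsetPset; exact.
- exact: integrable_abse.
- apply/aeW => s k _; rewrite patchE lee_fin.
  by case: ifPn => // _; rewrite normr0.
move=> _ _; apply: cvg_trans; apply: near_eq_cvg; apply: nearW => k /=.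
rewrite -[in RHS](setIidr (@seg_pos k)) [in RHS]integral_mkcondr.
by apply: eq_integral => s _; rewrite !patchE; case: ifPn.
Qed.

Let seg_FTC G g l0 l1 :
  (forall s, 0 < s -> is_derive s 1 G (g s)) ->
  {in pos, continuous g} ->
  G s @[s --> 0^'+] --> l0 -> G s @[s --> +oo] --> l1 ->
  (\int[mu]_(s in seg k) (g s)%:E @[k --> \oo] --> (l1 - l0)%:E)%E.
Proof.
move=> dG cg G0 G1.
have cG s : 0 < s -> {for s, continuous G}.
  move=> s0; apply: differentiable_continuous; apply/derivable1_diffP.
  by have := dG _ s0; case.
(* [seg 0] is the single point 1, hence the restriction to positive [k]. *)
have E k : (0 < k)%N ->
    (\int[mu]_(s in seg k) (g s)%:E = (G k.+1%:R - G k.+1%:R^-1)%:E)%E.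
  move=> k0.
  have kk : k.+1%:R^-1 < k.+1%:R :> R.
    apply: (@lt_trans _ _ 1); first by rewrite invf_lt1 ?ltr1n// ltr0n.
    by rewrite ltr1n.
  have k0' : 0 < k.+1%:R^-1 :> R by rewrite invr_gt0 ltr0n.
  rewrite /seg (@continuous_FTC2 R g G)//.
  - apply: continuous_in_subspaceT => s; rewrite inE/= in_itv/= => /andP[ks _].
    by apply: cg; rewrite inE; apply/posP; exact: lt_le_trans ks.
  - split.
    + move=> s; rewrite in_itv/= => /andP[ks _].
      by have := dG _ (lt_trans k0' ks); case.
    + by apply: cvg_at_right_filter; exact: cG.
    + by apply: cvg_at_left_filter; apply: cG; exact: lt_trans kk.
  - move=> s; rewrite in_itv/= => /andP[ks _].
    rewrite derive1E.
    by have := dG _ (lt_trans k0' ks) => -[_ ->].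
have C : (G k.+1%:R - G k.+1%:R^-1) @[k --> \oo] --> l1 - l0.
  apply: cvgB.
    move/cvg_pinftyP : G1; apply.
    by apply/cvgryPge => A; near=> k; rewrite (@le_trans _ _ k%:R)// ?ler_nat//; near: k; exact: nbhs_infty_ger.
  move/cvg_at_rightP : G0; apply; split; last exact: cvg_harmonic.
  by move=> k; rewrite invr_gt0 ltr0n.
apply: (@cvg_trans _ ((G k.+1%:R - G k.+1%:R^-1)%:E @[k --> \oo])).
  by apply: near_eq_cvg; exists 1%N => // k /= k1; rewrite E.
by apply: cvg_EFin => //; exact: nearW.
Unshelve. all: by end_near. Qed.

(** Monotone convergence along [seg] takes the place of integrability, so this version also proves
    that the integral is finite. *)
Lemma integral_pos_ge0_FTC G g l0 l1 :
  (forall s, 0 < s -> is_derive s 1 G (g s)) ->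
  {in pos, continuous g} ->
  (forall s, 0 < s -> 0 <= g s) ->
  G s @[s --> 0^'+] --> l0 -> G s @[s --> +oo] --> l1 ->
  (\int[mu]_(s in pos) (g s)%:E = (l1 - l0)%:E)%E.
Proof.
move=> dG cg g0 G0 G1.
have h1 := seg_FTC dG cg G0 G1; have h2 := cvg_seg_ge0 cg g0.
exact: (cvg_unique _ h2 h1).
Qed.

Lemma integral_pos_FTC G g l0 l1 :
  (forall s, 0 < s -> is_derive s 1 G (g s)) ->
  {in pos, continuous g} ->
  mu.-integrable pos (EFin \o g) ->
  G s @[s --> 0^'+] --> l0 -> G s @[s --> +oo] --> l1 ->
  \int[mu]_(s in pos) g s = l1 - l0.
Proof.
move=> dG cg gi G0 G1; apply: Rintegral_EFin.
have h1 := seg_FTC dG cg G0 G1; have h2 := cvg_seg cg gi.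
exact: (cvg_unique _ h2 h1).
Qed.

Let affine c b : R -> measurableTypeR R := fun x => c * x + b.

Let measurable_affine c b : measurable_fun setT (affine c b).
Proof. by apply: measurable_funD => //; exact: measurable_funM. Qed.

Let mu_affine c b : {measure set (measurableTypeR R) -> \bar R} :=
  measure_function_pushforward__canonical__measure_function_Measure mu
    (measurable_affine c b).

(** By uniqueness of Lebesgue measure it is enough to look at half-open intervals; an increasing
    affine map pulls them back to half-open intervals whose length is divided by [c]. *)
Let lebesgue_measure_affine c b (c0 : 0 < c) (A : set R) : measurable A ->
  (mscale (NngNum (ltW c0)) (mu_affine c b) A = mu A)%E.
Proof.
move=> mA; apply/esym; apply: lebesgue_measure_unique => //.
move=> _ [[x y]] _ <-; change (mu `]x, y]%classic = (c%:E * mu (affine c b @^-1` `]x, y]%classic))%E).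
rewrite (_ : affine c b @^-1` _ = `](x - b) / c, (y - b) / c]%classic); last first.
  apply/seteqP; split => z; rewrite /= !in_itv/= ltr_pdivrMr// ler_pdivlMr//;
    by rewrite ltrBlDr lerBrDr mulrC.
rewrite !lebesgue_measure_itv/= !lte_fin ltr_pM2r ?invr_gt0// ltrD2r.
case: ifPn => _; last by rewrite mule0.
by rewrite -!EFinD -EFinM; congr EFin; field; rewrite gt_eqF.
Qed.

Lemma ge0_integral_affine (f : R -> \bar R) c b : 0 < c ->
  measurable_fun setT f -> (forall x, 0 <= f x)%E ->
  (c%:E * \int[mu]_x f (c * x + b)%R = \int[mu]_x f x)%E.
Proof.
move=> c0 mf f0.
transitivity (c%:E * \int[mu_affine c b]_x f x)%E.
  by rewrite ge0_integral_pushforward//; exact: measurable_affine.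
transitivity (\int[mscale (NngNum (ltW c0)) (mu_affine c b)]_x f x)%E.
  by rewrite ge0_integral_mscale.
apply: eq_measure_integral => A mA _; exact: lebesgue_measure_affine.
Qed.

Lemma ge0_integral_shift (f : R -> \bar R) (b : R) :
  measurable_fun setT f -> (forall x, 0 <= f x)%E ->
  (\int[mu]_x f (x + b)%R = \int[mu]_x f x)%E.
Proof.
move=> mf f0; rewrite -(@ge0_integral_affine f 1 b)// mul1e.
by apply: eq_integral => x _; rewrite mul1r.
Qed.

Lemma ge0_integral_opp (f : R -> \bar R) :
  measurable_fun setT f -> (forall x, 0 <= f x)%E ->
  (\int[mu]_x f (- x)%R = \int[mu]_x f x)%E.
Proof.
move=> mf f0.
have mN : measurable_fun setT (-%R : R -> measurableTypeR R) by exact: oppr_measurable.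
transitivity (\int[measure_function_pushforward__canonical__measure_function_Measure
  mu mN]_x f x)%E; first by rewrite ge0_integral_pushforward.
by apply: eq_measure_integral => A mA _; exact: lebesgue_measureN.
Qed.

Lemma ge0_integral_pos_scale (f : R -> \bar R) (c : R) : 0 < c ->
  measurable_fun setT f -> (forall x, (0 < x)%R -> 0 <= f x)%E ->
  ((c : R)%:E * \int[mu]_(x in pos) f (c * x : R)%R = \int[mu]_(x in pos) f x)%E.
Proof.
move=> c0 mf f0; rewrite integral_mkcond [RHS]integral_mkcond.
rewrite -[RHS](@ge0_integral_affine _ c 0)//.
- congr (_ * _)%E; apply: eq_integral => x _; rewrite addr0 !patchE.
  suff -> : (x \in pos) = (c * x \in pos) by [].
  by apply/idP/idP; rewrite !inE => /posP x0; apply/posP; rewrite pmulr_rgt0 in x0 *.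
- apply/(measurable_restrict _ measurable_pos) => //; exact: measurable_funTS.
- by move=> x; rewrite patchE; case: ifPn => // /[!inE]/posP; exact: f0.
Qed.

(** Substitution s -> 1/s maps each [seg k] onto itself, so the two sequences of truncated integrals
    coincide and their limits agree. *)
Lemma ge0_integral_pos_inv g : {in pos, continuous g} ->
  (forall s, 0 < s -> 0 <= g s) ->
  (\int[mu]_(s in pos) (s ^- 2 * g s^-1)%:E = \int[mu]_(s in pos) (g s)%:E)%E.
Proof.
move=> cg g0.
have cf : {in pos, continuous (fun s => s ^- 2 * g s^-1)}.
  move=> s /[!inE] /posP s0; apply: cvgM.
    apply: cvgV; first by rewrite expf_neq0// gt_eqF.
    exact: exprn_continuous.
  apply: continuous_comp; first by apply: inv_continuous; rewrite gt_eqF.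
  by apply: cg; rewrite inE; apply/posP; rewrite invr_gt0.
have f0 s : 0 < s -> 0 <= s ^- 2 * g s^-1.
  by move=> s0; rewrite mulr_ge0 ?g0 ?invr_gt0// invr_ge0 exprn_ge0// ltW.
have h1 := cvg_seg_ge0 cg g0; have h2 := cvg_seg_ge0 cf f0.
suff h : (\int[mu]_(s in seg k) (s ^- 2 * g s^-1)%:E @[k --> \oo] -->
    \int[mu]_(s in pos) (g s)%:E)%E by exact: (cvg_unique _ h2 h).
apply: (@cvg_trans _ ((\int[mu]_(s in seg k) (g s)%:E)%E @[k --> \oo])) => //.
apply: near_eq_cvg; exists 1%N => // k /= k1.
have kk : k.+1%:R^-1 <= k.+1%:R :> R.
  by rewrite (@le_trans _ _ 1)// ?invf_le1 ?ler1n// ltr0n.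
have k0 : 0 < k.+1%:R^-1 :> R by rewrite invr_gt0 ltr0n.
have dV s : s != 0 -> is_derive s 1 (@GRing.inv R) (- s ^- 2).
  move=> s0; apply: (is_derive_eq (is_deriveV _ _)) => //.
  by rewrite /GRing.scale/= mulr1.
have V' s : s != 0 -> (@GRing.inv R)^`()%classic s = - s ^- 2.
  by move=> s0; rewrite derive1E; have [_ ->] := dV _ s0.
have nz s : k.+1%:R^-1 <= s -> s != 0 by move=> ks; rewrite gt_eqF// (lt_le_trans k0).
have cV' s : 0 < s -> (@GRing.inv R)^`()%classic x @[x --> s] --> - s ^- 2.
  move=> s0; apply: (@cvg_trans _ ((fun x : R => - x ^- 2) x @[x --> s])).
    apply: near_eq_cvg; near=> x; rewrite V'// gt_eqF//.
    by near: x; exact: (@cvgr_gt _ _ _ _ id s).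
  have h : (fun x : R => x ^- 2) x @[x --> s] --> s ^- 2.
    by apply: cvgV; [rewrite expf_neq0// gt_eqF|exact: exprn_continuous].
  exact: (cvgN h).
have kp : 0 < k.+1%:R :> R by rewrite ltr0n.
have cV s : 0 < s -> x^-1 @[x --> s] --> s^-1.
  by move=> s0; apply: inv_continuous; rewrite gt_eqF.
have := @integration_by_substitution_decreasing R (@GRing.inv R) g _ _ kk.
rewrite invrK => ->.
- apply: eq_integral => s; rewrite inE/= in_itv/= => /andP[s1 _].
  by rewrite !fctE V' ?nz// opprK mulrC.
- move=> x y; rewrite !in_itv/= => /andP[x1 _] /andP[y1 _] xy.
  by rewrite ltf_pV2// posrE (lt_le_trans k0).
- move=> s; rewrite in_itv/= => /andP[s1 _].
  have s0 := lt_trans k0 s1.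
  by rewrite /continuous_at V' ?gt_eqF//; exact: cV'.
- by apply/cvg_ex; exists (- k.+1%:R^-1 ^- 2); apply: cvg_at_right_filter; exact: cV'.
- by apply/cvg_ex; exists (- k.+1%:R ^- 2); apply: cvg_at_left_filter; exact: cV'.
- split.
  + move=> s; rewrite in_itv/= => /andP[s1 _].
    by have [] := dV s; rewrite ?gt_eqF// (lt_trans k0 s1).
  + by apply: cvg_at_right_filter; exact: cV.
  + by apply: cvg_at_left_filter; exact: cV.
- apply: continuous_in_subspaceT => s; rewrite inE/= in_itv/= => /andP[s1 _].
  by apply: cg; rewrite inE; apply/posP; exact: lt_le_trans s1.
Unshelve. all: by end_near. Qed.

End half_line.

(** * One-variable derivatives *)

Section real_derive.
Context {R : realType}.
Implicit Types (f g : R -> R) (x a b c : R).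

Lemma is_derive_continuous f x a : is_derive x 1 f a -> {for x, continuous f}.
Proof. by case=> df _; apply: differentiable_continuous; exact/derivable1_diffP. Qed.

Lemma is_derive1_mul f g x a b : is_derive x 1 f a -> is_derive x 1 g b ->
  is_derive x 1 (fun t => f t * g t) (f x * b + g x * a).
Proof. by move=> df dg; exact: (is_deriveM df dg). Qed.

Lemma is_derive1_add f g x a b : is_derive x 1 f a -> is_derive x 1 g b ->
  is_derive x 1 (fun t => f t + g t) (a + b).
Proof. by move=> df dg; exact: (is_deriveD df dg). Qed.

Lemma is_derive1_opp f x a : is_derive x 1 f a ->
  is_derive x 1 (fun t => - f t) (- a).
Proof. by move=> df; exact: (is_deriveN df). Qed.

Lemma is_derive1_scale c f x a : is_derive x 1 f a ->
  is_derive x 1 (fun t => c * f t) (c * a).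
Proof. by move=> df; exact: (is_deriveZ c df). Qed.

Lemma is_derive1_inv f x a : f x != 0 -> is_derive x 1 f a ->
  is_derive x 1 (fun t => (f t)^-1) (- a / f x ^+ 2).
Proof.
move=> fx0 df; apply: (is_derive_eq (is_deriveV fx0 df)).
by rewrite /GRing.scale/= mulNr mulrC mulNr.
Qed.

Lemma is_derive1_compose f g x a b : is_derive (g x) 1 f a ->
  is_derive x 1 g b -> is_derive x 1 (fun t => f (g t)) (a * b).
Proof. exact: is_derive1_comp. Qed.

Lemma is_derive1_expR f x a : is_derive x 1 f a ->
  is_derive x 1 (fun t => expR (f t)) (expR (f x) * a).
Proof. by move=> df; exact: is_derive1_compose. Qed.

Lemma is_derive1_powRf f x a c : 0 < f x -> is_derive x 1 f a ->
  is_derive x 1 (fun t => f t `^ c) (c * f x `^ (c - 1) * a).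
Proof.
by move=> fx0 df; apply: (is_derive1_compose (is_derive1_powR c fx0)) => //.
Qed.

End real_derive.

(** * Measurability of real expressions *)

Section real_measurability.
Context d (T : measurableType d) (R : realType).
Implicit Types (D : set T) (f g : T -> R).

Lemma measurable_fun_powR D f b : measurable_fun D f ->
  measurable_fun D (fun x => f x `^ b).
Proof. by move=> mf; exact: (measurableT_comp (measurable_powR b) mf). Qed.

Lemma measurable_fun_expR D f : measurable_fun D f ->
  measurable_fun D (fun x => expR (f x)).
Proof. by move=> mf; apply: measurableT_comp. Qed.

Lemma measurable_fun_opp D f : measurable_fun D f ->
  measurable_fun D (fun x => - f x).
Proof. exact: measurable_funN. Qed.

Lemma measurable_fun_add D f g : measurable_fun D f -> measurable_fun D g ->
  measurable_fun D (fun x => f x + g x).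
Proof. exact: measurable_funD. Qed.

Lemma measurable_fun_mul D f g : measurable_fun D f -> measurable_fun D g ->
  measurable_fun D (fun x => f x * g x).
Proof. exact: measurable_funM. Qed.

Lemma measurable_fun_exp D f n : measurable_fun D f ->
  measurable_fun D (fun x => f x ^+ n).
Proof. exact: measurable_funX. Qed.

Lemma measurable_fun_inv D f : measurable_fun D f ->
  measurable_fun D (fun x => (f x)^-1).
Proof.
(* Squaring brings the argument into the domain where [powR_inv1] applies; at 0 both sides vanish
   because the inverse of 0 is 0. *)
move=> mf; have e x : (f x)^-1 = f x * (f x ^+ 2) `^ (- 1).
  have [->|fx0] := eqVneq (f x) 0; first by rewrite invr0 mul0r.
  by rewrite powR_inv1 ?sqr_ge0//; field.
under eq_fun do rewrite e.
by apply: measurable_fun_mul => //; apply/measurable_fun_powR/measurable_fun_exp.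
Qed.

Lemma measurable_fun_norm D f : measurable_fun D f ->
  measurable_fun D (fun x => `|f x|).
Proof. by move=> mf; apply: measurableT_comp. Qed.

Lemma measurable_fun_sqrt D f : measurable_fun D f ->
  measurable_fun D (fun x => Num.sqrt (f x)).
Proof.
(* [Num.sqrt] vanishes on negative numbers, and so does the power of the positive part, written as
   half of |f x| + f x. *)
move=> mf; have e x : Num.sqrt (f x) = (2^-1 * (`|f x| + f x)) `^ 2^-1.
  have [fx0|fx0] := leP 0 (f x).
    by rewrite ger0_norm// (_ : _ * _ = f x) ?powR12_sqrt//; field.
  by rewrite ltr0_norm// addNr mulr0 powR0 ?invr_eq0// ltr0_sqrtr.
under eq_fun do rewrite e.
apply/measurable_fun_powR/measurable_fun_mul => //.
by apply: measurable_fun_add => //; exact: measurable_fun_norm.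
Qed.

Lemma measurable_fun_EFin D f : measurable_fun D f ->
  measurable_fun D (fun x => (f x)%:E).
Proof. by move=> mf; exact/measurable_EFinP. Qed.

End real_measurability.

Ltac real_measurability :=
  repeat first
  [ exact: measurable_cst | exact: measurable_fst | exact: measurable_snd
  | exact: measurable_id | assumption
  | apply: measurable_fun_EFin | apply: measurable_fun_expR | apply: measurable_fun_powR
  | apply: measurable_fun_inv | apply: measurable_fun_sqrt | apply: measurable_fun_norm
  | apply: measurable_fun_mul | apply: measurable_fun_exp
  | apply: measurable_fun_opp | apply: measurable_fun_add | done ].

Lemma powRDp (R : realType) (a x y : R) : 0 < a -> a `^ (x + y) = a `^ x * a `^ y.
Proof. by move=> a0; rewrite powRD// (gt_eqF a0) implybT. Qed.

(** * The Gamma function *)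

Section Gamma_function.
Context {R : realType}.
Notation mu := (@lebesgue_measure R).
Implicit Types (a b c s t A : R).

Lemma powR_expR a b : 0 < a -> a `^ b = expR (b * ln a).
Proof. by move=> a0; rewrite /powR gt_eqF. Qed.

Lemma mulr_powRN a b : 0 < a -> a `^ b * a `^ (- b) = 1.
Proof. by move=> a0; rewrite -powRDp// subrr powRr0. Qed.

Lemma measurable_powR_expR b A :
  measurable_fun setT (fun s : R => s `^ b * expR (- (A * s))).
Proof.
apply: measurable_funM; first exact: measurable_powR.
by apply: measurableT_comp => //; apply: measurable_funN; exact: measurable_funM.
Qed.

Lemma is_derive1_1D s : is_derive s 1 (fun s : R => 1 + s) 1.
Proof.
apply: (is_derive_eq (is_derive1_add (is_derive_cst (1 : R) s 1) (is_derive_id s 1))).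
exact: add0r.
Qed.

Lemma continuous_powR_1D b s : 0 < s ->
  {for s, continuous (fun s : R => (1 + s) `^ b)}.
Proof.
move=> s0; have s10 : 0 < 1 + s by rewrite addr_gt0.
exact: (is_derive_continuous (is_derive1_powRf (f := fun s : R => 1 + s) b s10
  (is_derive1_1D s))).
Qed.

(** The antiderivative is b^-1 (s / (1 + s))^b. This is the Beta integral with second parameter 1;
    the convergence of the Gamma integral is deduced from it by comparison. *)
Lemma integral_beta_tail b : 0 < b ->
  (\int[mu]_(s in pos) (s `^ (b - 1) * (1 + s) `^ (- b - 1))%:E = (b^-1)%:E)%E.
Proof.
move=> b0.
have d s : 0 < s -> is_derive s 1 (fun s => b^-1 * (1 - (1 + s)^-1) `^ b)
    (s `^ (b - 1) * (1 + s) `^ (- b - 1)).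
  move=> s0; have s10 : 0 < 1 + s by rewrite addr_gt0.
  have e : 1 - (1 + s)^-1 = s * (1 + s)^-1 by field; rewrite gt_eqF.
  have u0 : 0 < 1 - (1 + s)^-1 by rewrite e mulr_gt0 ?invr_gt0.
  have d1 : is_derive s 1 (fun s => 1 + s) (0 + 1) by apply: is_derive1_add.
  have d2 := is_derive1_opp (is_derive1_inv (lt0r_neq0 s10) d1).
  have d3 := is_derive1_add (is_derive_cst (1 : R) s 1) d2.
  have d4 := is_derive1_scale b^-1 (is_derive1_powRf (f := fun s => 1 - (1 + s)^-1) b u0 d3).
  apply: (is_derive_eq d4); rewrite /= e powRM ?invr_ge0 ?ltW//.
  rewrite -(powR_inv1 (ltW s10)) -powRrM (_ : -1 * (b - 1) = (- b - 1) + 2); last by ring.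
  rewrite (powRDp (- b - 1) 2 s10) (powR_mulrn 2%N (ltW s10)).
  by field; rewrite !gt_eqF.
rewrite (@integral_pos_ge0_FTC R _ _ 0 b^-1 d) ?subr0//.
- move=> s; rewrite inE => /posP s0; have s10 : 0 < 1 + s by rewrite addr_gt0.
  apply: cvgM; first exact: (is_derive_continuous (is_derive1_powR _ s0)).
  exact: continuous_powR_1D.
- by move=> s _; rewrite mulr_ge0 ?powR_ge0.
- rewrite -[X in _ --> X](mulr0 b^-1); apply: cvgM; first exact: cvg_cst.
  apply: (@squeeze_cvgr _ _ _ _ (cst 0) (fun s => s `^ b)); last 2 first.
  + exact: cvg_cst.
  + exact: powR_cvg0.
  near=> s; have s0 : 0 < s by near: s; exact: nbhs_right_gt.
  have s10 : 0 < 1 + s by rewrite addr_gt0.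
  have e : 1 - (1 + s)^-1 = s * (1 + s)^-1 by field; rewrite gt_eqF.
  rewrite /= powR_ge0/= ge0_ler_powR ?nnegrE ?(ltW b0) ?(ltW s0)// e.
    by rewrite mulr_ge0 ?invr_ge0 ?ltW.
  by rewrite ler_piMr ?(ltW s0)// invf_le1// lerDl ltW.
- rewrite -[X in _ --> X]mulr1; apply: cvgM; first exact: cvg_cst.
  rewrite [X in _ --> X](_ : 1 = 1 `^ b :> R); last by rewrite powR1.
  have h1 : 1 - (1 + s)^-1 @[s --> +oo] --> (1 : R).
    rewrite -[X in _ --> X]subr0; apply: cvgB; first exact: cvg_cst.
    apply/(@gtr0_cvgV0 _ _ _ _ (fun s : R => 1 + s)); last exact: cvg_addrl.
    by near=> s; rewrite addr_gt0//; near: s; exact: nbhs_pinfty_gt.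
  have h2 := is_derive_continuous (is_derive1_powR b (@ltr01 R)).
  exact: (cvg_comp _ _ h1 h2).
Unshelve. all: by end_near. Qed.

(** From 1 + u <= exp u at u = t / a one gets a + t <= a exp (t / a), and 1 <= a gives 1 + t <= a +
    t; then the power [a] is taken. *)
Lemma powR_le_expR a t : 1 <= a -> 0 < t -> (1 + t) `^ a <= a `^ a * expR t.
Proof.
move=> a1 t0; have a0 : 0 < a by exact: lt_le_trans a1.
have h : 1 + t <= a * expR (t / a).
  have := expR_ge1Dx (t / a); rewrite -(ler_pM2l a0); apply: le_trans.
  by rewrite mulrDr mulr1 mulrCA divff ?gt_eqF// mulr1 lerD2r.
apply: le_trans (_ : (a * expR (t / a)) `^ a <= _).
  by apply: ge0_ler_powR => //; rewrite ?nnegrE ?ltW// ?addr_gt0// mulr_gt0// expR_gt0.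
rewrite (powRM _ (ltW a0) (ltW (expR_gt0 _))) -expRM divfK ?lexx//.
by rewrite gt_eqF.
Qed.

Lemma integral_Gamma_lty b : 0 < b ->
  (\int[mu]_(s in pos) (s `^ (b - 1) * expR (- s))%:E < +oo)%E.
Proof.
(* The constant of [powR_le_expR] at the exponent b + 1: it gives exp (-s) <= C (1 + s)^(-b-1). *)
move=> b0; set C := (b + 1) `^ (b + 1).
have C0 : 0 < C by rewrite powR_gt0// addr_gt0.
apply: (@le_lt_trans _ _ (\int[mu]_(s in pos)
  (C%:E * (s `^ (b - 1) * (1 + s) `^ (- b - 1))%:E))%E); last first.
  rewrite ge0_integralZl_EFin ?integral_beta_tail -?EFinM ?ltry//.
  - exact: measurable_pos.
  - by move=> s _; rewrite lee_fin mulr_ge0// powR_ge0.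
  - apply/measurable_EFinP; apply: measurable_funM.
      by apply: measurable_funTS; exact: measurable_powR.
    by apply: measurable_funTS; real_measurability.
  - exact: ltW.
apply: ge0_le_integral.
- exact: measurable_pos.
- by move=> s _; rewrite lee_fin mulr_ge0// ?powR_ge0 ?expR_ge0.
- apply/measurable_EFinP; apply: measurable_funTS.
  have := measurable_powR_expR (b - 1) 1; apply: eq_measurable_fun => s _.
  by rewrite mul1r.
- apply/measurable_EFinP; apply: measurable_funTS; apply: measurable_funM => //.
  by real_measurability.
- move=> s /posP s0; rewrite -EFinM lee_fin mulrCA ler_wpM2l ?powR_ge0//.
  rewrite expRN (_ : - b - 1 = - (b + 1)); last by ring.
  rewrite powRN ler_pdivlMr ?powR_gt0 ?addr_gt0// mulrC ler_pdivrMr ?expR_gt0//.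
  by apply: powR_le_expR => //; rewrite lerDr ltW.
Qed.

Lemma integrable_Gamma b : 0 < b ->
  mu.-integrable pos (EFin \o (fun s => s `^ (b - 1) * expR (- s))).
Proof.
move=> b0; apply: integrable_ge0.
- exact: measurable_pos.
- apply: measurable_funTS; have := measurable_powR_expR (b - 1) 1.
  by apply: eq_measurable_fun => s _; rewrite mul1r.
- by move=> s _; rewrite mulr_ge0// ?powR_ge0 ?expR_ge0.
- exact: integral_Gamma_lty.
Qed.

Lemma integral_Gamma1 b : 0 < b ->
  (\int[mu]_(s in pos) (s `^ (b - 1) * expR (- s))%:E = (Gamma b)%:E)%E.
Proof.
move=> b0; rewrite integral_EFin_Rintegral//; first exact: measurable_pos.
exact: integrable_Gamma.
Qed.

Lemma Gamma_gt0 b : 0 < b -> 0 < Gamma b.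
Proof.
move=> b0; rewrite -lte_fin -integral_Gamma1//.
(* A lower bound of the integrand on [1, 2]: there 0 <= ln s <= 1, so s^(b-1) >= exp (-|b-1|), while
   exp (-s) >= exp (-2). *)
set c := expR (- `|b - 1| - 2).
apply: (@lt_le_trans _ _ (\int[mu]_(s in `[1%R, 2%R]) c%:E)%E).
  rewrite integral_cst//= lebesgue_measure_itv/= lte_fin ltr1n -EFinD -EFinM lte_fin.
  by rewrite mulr_gt0// ?expR_gt0// subr_gt0 ltr1n.
have m1 : measurable_fun setT (fun s : R => (s `^ (b - 1) * expR (- s))%:E).
  apply/measurable_EFinP; have := measurable_powR_expR (b - 1) 1.
  by apply: eq_measurable_fun => s _; rewrite mul1r.
apply: (@le_trans _ _ (\int[mu]_(s in `[1%R, 2%R]) (s `^ (b - 1) * expR (- s))%:E)%E).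
  apply: ge0_le_integral => //; first by move=> s _; rewrite lee_fin expR_ge0.
    exact: measurable_funTS.
  move=> s /=; rewrite in_itv/= => /andP[s1 s2].
  have s0 : 0 < s by exact: lt_le_trans s1.
  rewrite lee_fin powR_expR// -expRD ler_expR lerD ?lerN2//.
  rewrite lerNl -mulNr; apply: (le_trans (ler_norm _)); rewrite normrM normrN ler_piMr//.
  have h := expR_ge1Dx (ln s); rewrite lnK ?posrE// in h.
  have h0 : 0 <= ln s by rewrite ln_ge0.
  rewrite ger0_norm//; lra.
apply: ge0_subset_integral => //; first exact: measurable_pos.
- exact: measurable_funTS.
- by move=> s _; rewrite lee_fin mulr_ge0// ?powR_ge0 ?expR_ge0.
- move=> s /=; rewrite in_itv/= => /andP[s1 _]; apply/posP.
  exact: lt_le_trans s1.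
Qed.

Lemma integral_GammaE b A : 0 < b -> 0 < A ->
  (\int[mu]_(s in pos) (s `^ (b - 1) * expR (- (A * s)))%:E =
   (Gamma b * A `^ (- b))%:E)%E.
Proof.
move=> b0 A0; rewrite mulrC EFinM -integral_Gamma1//.
rewrite -(@ge0_integral_pos_scale R (fun s => (s `^ (b - 1) * expR (- s))%:E) A)//.
- rewrite muleA -EFinM -ge0_integralZl_EFin//.
  + apply: eq_ge0_integral => s /posP s0; rewrite -EFinM; congr EFin.
    have e : A `^ (- b) * A * A `^ (b - 1) = 1.
      rewrite -{2}(powRr1 (ltW A0)) -!powRDp// (_ : _ + _ = 0) ?powRr0//; ring.
    transitivity ((A `^ (- b) * A * A `^ (b - 1)) * (s `^ (b - 1) * expR (- (A * s)))).
      by rewrite e mul1r.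
    by rewrite powRM ?(ltW A0) ?(ltW s0)//; ring.
  + exact: measurable_pos.
  + by move=> s /posP s0; rewrite lee_fin mulr_ge0// ?powR_ge0 ?expR_ge0.
  + apply/measurable_EFinP; apply: measurable_funTS; apply: measurable_funM.
      by real_measurability.
    by real_measurability.
  + by rewrite mulr_ge0 ?powR_ge0// ltW.
- apply/measurable_EFinP; have := measurable_powR_expR (b - 1) 1.
  by apply: eq_measurable_fun => s _; rewrite mul1r.
- by move=> s _; rewrite lee_fin mulr_ge0// ?powR_ge0 ?expR_ge0.
Qed.

Lemma continuous_powR_expR b A :
  {in (@pos R), continuous (fun s => s `^ b * expR (- (A * s)))}.
Proof.
move=> s /[!inE] /posP s0.
apply: (@is_derive_continuous _ _ _ _ (is_derive1_mul (is_derive1_powR b s0)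
  (is_derive1_expR (is_derive1_opp (is_derive1_scale A (is_derive_id s 1)))))).
Qed.

Lemma continuous_powR_expRN b :
  {in (@pos R), continuous (fun s => s `^ b * expR (- s))}.
Proof.
move=> s /[!inE] /posP s0.
apply: (@is_derive_continuous _ _ _ _ (is_derive1_mul (is_derive1_powR b s0)
  (is_derive1_expR (is_derive1_opp (is_derive_id s 1))))).
Qed.

Lemma cvgy_inv : s^-1 @[s --> +oo] --> (0 : R).
Proof.
by apply/(@gtr0_cvgV0 _ _ _ _ id) => //; near=> s; near: s; exact: nbhs_pinfty_gt.
Unshelve. all: by end_near. Qed.

Lemma cvgy_sqrt : Num.sqrt s @[s --> +oo] --> (+oo : set_system R).
Proof.
apply/cvgryPge => A; near=> s.
apply: (le_trans (ler_norm A)).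
have : A ^+ 2 <= s by near: s; apply: nbhs_pinfty_ge; exact: num_real.
by move=> /ler_wsqrtr; rewrite sqrtr_sqr.
Unshelve. all: by end_near. Qed.

(** The image of [integral_GammaE] under s -> 1/s. It is the form met when a heat kernel is
    integrated in time, since its exponent is proportional to 1/s. *)
Lemma integral_inv_GammaE b A : 0 < b -> 0 < A ->
  (\int[mu]_(s in pos) (s `^ (- b - 1) * expR (- (A / s)))%:E =
   (Gamma b * A `^ (- b))%:E)%E.
Proof.
move=> b0 A0; rewrite -integral_GammaE// -(@ge0_integral_pos_inv R (fun s => s `^ (b - 1) * expR (- (A * s))))//.
- apply: eq_ge0_integral => s /posP s0; congr EFin.
  rewrite mulrA; congr (_ * _).
  rewrite -(powR_invn 2%N (ltW s0)) -(powR_inv1 (ltW s0)) -powRrM -powRDp//.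
  by congr powR; ring.
- exact: continuous_powR_expR.
- by move=> s _; rewrite mulr_ge0// ?powR_ge0 ?expR_ge0.
Qed.

(** The factor (1 + s)^-(a+c) is a Gamma integral in a second variable [r]; after the exchange there
    remain a Gamma integral in [s] and then one in [r]. *)
Lemma integral_beta a c : 0 < a -> 0 < c ->
  (\int[mu]_(s in pos) (s `^ (a - 1) * (1 + s) `^ (- (a + c)))%:E =
   (Gamma a * Gamma c / Gamma (a + c))%:E)%E.
Proof.
move=> a0 c0; have ac0 : 0 < a + c by rewrite addr_gt0.
have mI : measurable_fun setT (fun p : R * R => (p.1 `^ (a - 1) *
   (p.2 `^ (a + c - 1) * expR (- ((1 + p.1) * p.2))))%:E).
  by real_measurability.
transitivity ((Gamma (a + c))^-1%:E * \int[mu]_(s in pos) \int[mu]_(r in pos)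
   (s `^ (a - 1) * (r `^ (a + c - 1) * expR (- ((1 + s) * r))))%:E)%E.
  rewrite -ge0_integralZl_EFin//.
  - apply: eq_ge0_integral => s /posP s0.
    under eq_integral do rewrite EFinM.
    rewrite ge0_integralZl_EFin ?powR_ge0//.
    + rewrite integral_GammaE ?addr_gt0// -!EFinM; congr EFin.
      by field; rewrite gt_eqF// Gamma_gt0.
    + exact: measurable_pos.
    + by move=> r _; rewrite lee_fin mulr_ge0// ?powR_ge0 ?expR_ge0.
    + by apply/measurable_EFinP; apply: measurable_funTS; exact: measurable_powR_expR.
  - exact: measurable_pos.
  - by move=> s _; apply: integral_ge0 => r _; rewrite lee_fin !mulr_ge0// ?powR_ge0 ?expR_ge0.
  - apply: measurable_funTS.
    apply: (@measurable_fun_integral_on _ _ (measurableTypeR R) (measurableTypeR R) R mu _ measurable_pos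
      (fun s r => (s `^ (a - 1) * (r `^ (a + c - 1) * expR (- ((1 + s) * r))))%:E)) => //.
    by move=> s r _; rewrite lee_fin !mulr_ge0// ?powR_ge0 ?expR_ge0.
  - by rewrite invr_ge0 ltW// Gamma_gt0.
rewrite (@tonelli_on _ _ (measurableTypeR R) (measurableTypeR R) R mu mu pos pos
  measurable_pos measurable_pos _ mI); last first.
  by move=> s r _ _; rewrite lee_fin !mulr_ge0// ?powR_ge0 ?expR_ge0.
rewrite (_ : (\int[mu]_(r in pos) _)%E = (Gamma a * Gamma c)%:E).
  by rewrite -EFinM; congr EFin; rewrite mulrC.
transitivity ((Gamma a)%:E * (Gamma c)%:E)%E; last by rewrite EFinM.
rewrite -[in RHS](integral_Gamma1 c0) -ge0_integralZl_EFin//.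
- apply: eq_ge0_integral => r /posP r0.
  transitivity (\int[mu]_(s in pos) ((r `^ (a + c - 1) * expR (- r))%:E *
    (s `^ (a - 1) * expR (- (r * s)))%:E))%E.
    apply: eq_ge0_integral => s _; rewrite -EFinM; congr EFin.
    rewrite mulrDl mul1r opprD expRD (mulrC s r); ring.
  rewrite ge0_integralZl_EFin//.
  + rewrite integral_GammaE// -!EFinM; congr EFin.
    rewrite (_ : a + c - 1 = (c - 1) + a); last by ring.
    rewrite powRDp//; transitivity (Gamma a * (r `^ (c - 1) * expR (- r)) * (r `^ a * r `^ (- a))).
      ring.
    by rewrite mulr_powRN// mulr1.
  + exact: measurable_pos.
  + by move=> s _; rewrite lee_fin mulr_ge0// ?powR_ge0 ?expR_ge0.
  + by apply/measurable_EFinP; apply: measurable_funTS; exact: measurable_powR_expR.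
  + by rewrite mulr_ge0// ?powR_ge0 ?expR_ge0.
- exact: measurable_pos.
- by move=> s _; rewrite lee_fin mulr_ge0// ?powR_ge0 ?expR_ge0.
- apply/measurable_EFinP; apply: measurable_funTS.
  have := measurable_powR_expR (c - 1) 1.
  by apply: eq_measurable_fun => s _; rewrite mul1r.
- by rewrite ltW// Gamma_gt0.
Qed.

Lemma cvg_powR_expRN b : 0 < b -> s `^ b * expR (- s) @[s --> +oo] --> (0 : R).
Proof.
move=> b0; set C := (b + 1) `^ (b + 1).
have h : C * s^-1 @[s --> +oo] --> (0 : R).
  by rewrite -[X in _ --> X](mulr0 C); apply: cvgM; [exact: cvg_cst|exact: cvgy_inv].
apply: (@squeeze_cvgr _ _ _ _ (cst 0) _ _ _ _ (cvg_cst _) h).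
near=> s; have s0 : 0 < s by near: s; exact: nbhs_pinfty_gt.
rewrite /= mulr_ge0 ?powR_ge0 ?expR_ge0//= expRN ler_pdivrMr ?expR_gt0//.
rewrite mulrAC ler_pdivlMr//.
have b1 : 1 <= b + 1 by rewrite lerDr ltW.
apply: le_trans (powR_le_expR b1 s0).
rewrite -{2}(powRr1 (ltW s0)) -powRDp//.
apply: ge0_ler_powR; rewrite ?nnegrE ?lerDr ?addr_ge0 ?ltW//.
Unshelve. all: by end_near. Qed.

Lemma GammaS b : 0 < b -> Gamma (b + 1) = b * Gamma b.
Proof.
move=> b0; have b10 : 0 < b + 1 by rewrite addr_gt0.
have d s : 0 < s -> is_derive s 1 (fun s => s `^ b * expR (- s))
   (b * (s `^ (b - 1) * expR (- s)) - s `^ (b + 1 - 1) * expR (- s)).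
  move=> s0; apply: (is_derive_eq (is_derive1_mul (is_derive1_powR b s0)
    (is_derive1_expR (is_derive1_opp (is_derive_id s 1))))).
  by rewrite addrK /=; ring.
have i1 : mu.-integrable pos (EFin \o (fun s => b * (s `^ (b - 1) * expR (- s)))).
  apply: integrable_scale; [exact: measurable_pos|exact: integrable_Gamma].
have i2 := integrable_Gamma b10.
have := @integral_pos_FTC R _ _ 0 0 d.
rewrite subrr RintegralB//; last exact: measurable_pos.
rewrite RintegralZl//; [|exact: measurable_pos|exact: integrable_Gamma].
move=> H; apply/esym/eqP; rewrite -subr_eq0; apply/eqP/H.
- move=> s s0; apply: cvgB; last exact: continuous_powR_expRN.
  by apply: cvgM; [exact: cvg_cst|exact: continuous_powR_expRN].
- apply: integrable_sub => //; exact: measurable_pos.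
- rewrite -[X in _ --> X](mul0r (expR (- 0))); apply: cvgM.
    exact: powR_cvg0.
  apply: cvg_at_right_filter; apply: continuous_comp; first exact: continuousN.
  exact: continuous_expR.
- exact: cvg_powR_expRN.
Qed.

Lemma Gamma1 : Gamma 1 = 1 :> R.
Proof.
have d s : 0 < s -> is_derive s 1 (fun s : R => - expR (- s)) (s `^ (1 - 1) * expR (- s)).
  move=> s0; apply: (is_derive_eq (is_derive1_opp
    (is_derive1_expR (is_derive1_opp (is_derive_id s 1))))).
  by rewrite subrr powRr0 /=; ring.
have := @integral_pos_ge0_FTC R _ _ (- 1) 0 d.
rewrite integral_Gamma1// sub0r opprK => H; apply: EFin_inj; apply: H.
- exact: continuous_powR_expRN.
- by move=> s _; rewrite mulr_ge0 ?powR_ge0 ?expR_ge0.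
- apply: cvgN; rewrite -[X in _ --> X]expR0 -{2}oppr0.
  apply: cvg_at_right_filter; apply: continuous_comp; first exact: continuousN.
  exact: continuous_expR.
- by rewrite -oppr0; apply: cvgN; exact: cvgr_expR.
Qed.

(** [integral_beta] at (1/2, 1/2) is Gamma(1/2)^2, while the antiderivative 2 atan (sqrt s)
    evaluates the same integral to pi. *)
Lemma Gamma_half : Gamma 2^-1 = Num.sqrt pi :> R.
Proof.
have h0 : 0 < 2^-1 :> R by rewrite invr_gt0.
have h1 : 2^-1 + 2^-1 = 1 :> R by field.
have := integral_beta h0 h0; rewrite h1 Gamma1 divr1.
have d s : 0 < s -> is_derive s 1 (fun s : R => 2 * atan (Num.sqrt s))
    (s `^ (2^-1 - 1) * (1 + s) `^ (- 1)).
  move=> s0; have s10 : 0 < 1 + s by rewrite addr_gt0.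
  apply: (is_derive_eq (is_derive1_scale 2 (is_derive1_compose
    (is_derive1_atan _) (is_derive1_sqrt s0)))).
  rewrite sqr_sqrtr ?ltW// powR_inv1 ?ltW// (_ : 2^-1 - 1 = - 2^-1); last by field.
  rewrite powRN powR12_sqrt ?ltW//; field.
  by rewrite !gt_eqF// sqrtr_gt0.
rewrite (@integral_pos_ge0_FTC R _ _ 0 pi d) ?subr0.
- move=> [H]; move: H; rewrite -expr2 => ->; rewrite sqrtr_sqr ger0_norm//.
  by rewrite ltW// Gamma_gt0.
- move=> s; rewrite inE => /posP s0; have s10 : 0 < 1 + s by rewrite addr_gt0.
  apply: cvgM; first exact: (is_derive_continuous (is_derive1_powR _ s0)).
  exact: continuous_powR_1D.
- by move=> s _; rewrite mulr_ge0 ?powR_ge0.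
- rewrite -[X in _ --> X](mulr0 2); apply: cvgM; first exact: cvg_cst.
  have h : {for (0 : R), continuous (atan \o Num.sqrt)}.
    by apply: continuous_comp; [exact: sqrt_continuous|exact: continuous_atan].
  by have := cvg_at_right_filter h; rewrite /= sqrtr0 atan0.
- rewrite -[X in _ --> X](divfK (_ : 2 != 0)) // mulrC; apply: cvgM; first exact: cvg_cst.
  apply: (@cvg_comp _ _ _ Num.sqrt atan _ (pinfty_nbhs R)); last exact: cvgy_atan.
  exact: cvgy_sqrt.
Qed.

End Gamma_function.

(** * Integration over row vectors *)

Section row_vectors.
Context {R : realType}.

Lemma xjoinD n (y z : 'rV[R]_n) (t u : R) :
  xjoin (y + z) (t + u) = xjoin y t + xjoin z u.
Proof. by apply/rowP => i; rewrite !mxE; case: unliftP => // j _; rewrite !mxE. Qed.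

Lemma xjoinN n (y : 'rV[R]_n) (t : R) : xjoin (- y) (- t) = - xjoin y t.
Proof. by apply/rowP => i; rewrite !mxE; case: unliftP => // j _; rewrite !mxE. Qed.

Lemma dotp_xjoin n (y z : 'rV[R]_n) (t u : R) :
  dotp (xjoin y t) (xjoin z u) = dotp y z + t * u.
Proof.
rewrite /dotp (bigD1_ord ord_max)//= addrC; congr (_ + _).
  by apply: eq_bigr => i _; rewrite !mxE !liftK.
by rewrite !mxE !unlift_none.
Qed.

Lemma dotp_ge0 n (y : 'rV[R]_n) : 0 <= dotp y y.
Proof. by apply: sumr_ge0 => i _; rewrite -expr2 sqr_ge0. Qed.

Lemma enorm_ge0 n (y : 'rV[R]_n) : 0 <= enorm y.
Proof. exact: sqrtr_ge0. Qed.

Lemma enorm_sqr n (y : 'rV[R]_n) : enorm y ^+ 2 = dotp y y.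
Proof. by rewrite sqr_sqrtr// dotp_ge0. Qed.

Lemma dotp0 n : dotp (0 : 'rV[R]_n) 0 = 0.
Proof. by rewrite /dotp big1// => i _; rewrite mxE mulr0. Qed.

Lemma dotp_eq0 n (y : 'rV[R]_n) : (dotp y y == 0) = (y == 0).
Proof.
apply/eqP/eqP => [|->]; last exact: dotp0.
move=> y0; apply/rowP => i; rewrite mxE; apply/eqP; rewrite -sqrf_eq0 expr2.
have := psumr_eq0P (P := xpredT) (F := fun i => y 0 i * y 0 i) => /(_ _ y0) -> //.
by move=> j _; rewrite -expr2 sqr_ge0.
Qed.

Lemma dotp_gt0 n (y : 'rV[R]_n) : (0 < dotp y y) = (y != 0).
Proof. by rewrite lt0r dotp_ge0 andbT dotp_eq0. Qed.

Lemma enorm_gt0 n (y : 'rV[R]_n) : (0 < enorm y) = (y != 0).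
Proof. by rewrite sqrtr_gt0 lt0r dotp_ge0 andbT dotp_eq0. Qed.

Lemma dotpC n (y z : 'rV[R]_n) : dotp y z = dotp z y.
Proof. by apply: eq_bigr => i _; rewrite mulrC. Qed.

Lemma dotpDl n (x y z : 'rV[R]_n) : dotp (x + y) z = dotp x z + dotp y z.
Proof. by rewrite -big_split/=; apply: eq_bigr => i _; rewrite mxE mulrDl. Qed.

Lemma dotpNl n (y z : 'rV[R]_n) : dotp (- y) z = - dotp y z.
Proof. by rewrite -sumrN; apply: eq_bigr => i _; rewrite mxE mulNr. Qed.

Lemma dotpZl n (a : R) (y z : 'rV[R]_n) : dotp (a *: y) z = a * dotp y z.
Proof. by rewrite mulr_sumr; apply: eq_bigr => i _; rewrite mxE mulrA. Qed.

Lemma dotpDr n (x y z : 'rV[R]_n) : dotp z (x + y) = dotp z x + dotp z y.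
Proof. by rewrite dotpC dotpDl !(dotpC z). Qed.

Lemma dotpNr n (y z : 'rV[R]_n) : dotp z (- y) = - dotp z y.
Proof. by rewrite dotpC dotpNl dotpC. Qed.

Lemma dotpZr n (a : R) (y z : 'rV[R]_n) : dotp z (a *: y) = a * dotp z y.
Proof. by rewrite dotpC dotpZl dotpC. Qed.

Lemma enormN n (y : 'rV[R]_n) : enorm (- y) = enorm y.
Proof. by rewrite /enorm dotpNl dotpNr opprK. Qed.

Lemma dotp_delta n (y : 'rV[R]_n) (i : 'I_n) : dotp y (delta_mx 0 i) = y 0 i.
Proof.
rewrite /dotp (bigD1 i)//= big1 ?addr0.
  by rewrite mxE !eqxx mulr1.
by move=> j /negPf ji; rewrite mxE eqxx ji mulr0.
Qed.

Lemma sqr_coord_le n (y : 'rV[R]_n) (i : 'I_n) : y 0 i ^+ 2 <= dotp y y.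
Proof.
rewrite /dotp (bigD1 i)//= expr2 lerDl; apply: sumr_ge0 => j _.
by rewrite -expr2 sqr_ge0.
Qed.

(** The difference of the two sides is |y + 2 z|^2. The lemma compares Gaussians at translated
    points. *)
Lemma dotp_le_double n (y z : 'rV[R]_n) :
  dotp y y <= 2 * dotp (y + z) (y + z) + 2 * dotp z z.
Proof.
rewrite -subr_ge0 (_ : _ - _ = dotp (y + 2 *: z) (y + 2 *: z)) ?dotp_ge0//.
rewrite !(dotpDl, dotpDr, dotpZl, dotpZr) (dotpC z y); ring.
Qed.

End row_vectors.

Section measurable_row_vectors.
Context d (T : measurableType d) {R : realType}.

Lemma measurable_fun_coord D n (f : T -> 'rV[R]_n) i : measurable_fun D f ->
  measurable_fun D (fun x => f x 0 i).
Proof. by move=> mf; exact: (measurableT_comp (measurable_coord i) mf). Qed.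

Lemma measurable_fun_rVPD D n (f : T -> 'rV[R]_n) : measurable D ->
  (forall i, measurable_fun D (fun t => f t 0 i)) -> measurable_fun D f.
Proof.
move=> mD mf.
apply: (@measurability _ _ _ _ D f
  (\big[setU/set0]_(i < n)
     preimage_set_system setT (fun x : 'rV[R]_n => x 0 i) measurable)) => //.
move=> _ [C + <-]; rewrite -bigcup_seq/= => -[i _ [B mB <-]].
by rewrite [X in _ `&` (f @^-1` X)]setTI; exact: mf.
Qed.

Lemma measurable_fun_dotp D n (f g : T -> 'rV[R]_n) : measurable_fun D f ->
  measurable_fun D g -> measurable_fun D (fun x => dotp (f x) (g x)).
Proof.
move=> mf mg; apply: measurable_sum => i.
by apply: measurable_fun_mul; exact: measurable_fun_coord.
Qed.

Lemma measurable_fun_enorm D n (f : T -> 'rV[R]_n) : measurable_fun D f ->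
  measurable_fun D (fun x => enorm (f x)).
Proof. by move=> mf; apply/measurable_fun_sqrt/measurable_fun_dotp. Qed.

Lemma measurable_fun_addv n (f g : T -> 'rV[R]_n) : measurable_fun setT f ->
  measurable_fun setT g -> measurable_fun setT (fun x => f x + g x).
Proof.
move=> mf mg; apply: measurable_fun_rVPD => // i; under eq_fun do rewrite mxE.
by apply: measurable_fun_add; exact: measurable_fun_coord.
Qed.

Lemma measurable_fun_oppv n (f : T -> 'rV[R]_n) : measurable_fun setT f ->
  measurable_fun setT (fun x => - f x).
Proof.
move=> mf; apply: measurable_fun_rVPD => // i; under eq_fun do rewrite mxE.
by apply: measurable_fun_opp; exact: measurable_fun_coord.
Qed.

Lemma measurable_fun_xjoin n (f : T -> 'rV[R]_n) (g : T -> R) :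
  measurable_fun setT f -> measurable_fun setT g ->
  measurable_fun setT (fun x => xjoin (f x) (g x)).
Proof.
move=> mf mg; apply: measurable_fun_rVPD => // i; under eq_fun do rewrite mxE.
by case: unliftP => [j _|_] //; exact: measurable_fun_coord.
Qed.

Lemma measurable_fun_xinit n (f : T -> 'rV[R]_n.+1) :
  measurable_fun setT f -> measurable_fun setT (fun x => xinit (f x)).
Proof.
move=> mf; apply: measurable_fun_rVPD => // i; under eq_fun do rewrite mxE.
exact: measurable_fun_coord.
Qed.

Lemma measurable_fun_xlast D n (f : T -> 'rV[R]_n.+1) :
  measurable_fun D f -> measurable_fun D (fun x => xlast (f x)).
Proof. exact: measurable_fun_coord. Qed.

End measurable_row_vectors.

Lemma measurable_idR (R : realType) :
  measurable_fun setT ((fun x => x) : measurableTypeR R -> R).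
Proof. by move=> _ A mA; rewrite setTI. Qed.

Ltac measurability_step :=
  lazymatch goal with
  | |- measurable_fun _ (fun x => x) => first [exact: measurable_id | exact: measurable_idR]
  | |- measurable_fun _ (@enorm _ _) => apply: (measurable_fun_enorm (f := fun x => x))
  | |- measurable_fun _ (@dotp _ _ ?z) =>
    apply: (measurable_fun_dotp (f := fun=> z) (g := fun x => x))
  | |- measurable_fun _ (@GRing.inv _) => apply: (measurable_fun_inv (f := fun x => x))
  | |- measurable_fun _ (fun x => (@?f x)%:E) => apply: measurable_fun_EFin
  | |- measurable_fun _ (fun x => expR (@?f x)) => apply: measurable_fun_expR
  | |- measurable_fun _ (fun x => (@?f x) `^ _) => apply: measurable_fun_powR
  | |- measurable_fun _ (fun x => (@?f x)^-1) => apply: measurable_fun_inv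
  | |- measurable_fun _ (fun x => Num.sqrt (@?f x)) => apply: measurable_fun_sqrt
  | |- measurable_fun _ (fun x => `|@?f x|) => apply: measurable_fun_norm
  | |- measurable_fun _ (fun x => @?f x * @?g x) => apply: measurable_fun_mul
  | |- measurable_fun _ (fun x => @?f x ^+ _) => apply: measurable_fun_exp
  | |- measurable_fun _ (fun x => dotp (@?f x) (@?g x)) => apply: measurable_fun_dotp
  | |- measurable_fun _ (fun x => enorm (@?f x)) => apply: measurable_fun_enorm
  | |- measurable_fun _ (fun x => xjoin (@?f x) (@?g x)) => apply: measurable_fun_xjoin
  | |- measurable_fun _ (fun x => xinit (@?f x)) => apply: measurable_fun_xinit
  | |- measurable_fun _ (fun x => xlast (@?f x)) => apply: measurable_fun_xlast
  | |- measurable_fun _ (fun x => fun_of_matrix (@?f x) _ _) => apply: measurable_fun_coord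
  | |- measurable_fun _ (fun x => - @?f x) =>
    first [apply: measurable_fun_opp | apply: measurable_fun_oppv]
  | |- measurable_fun _ (fun x => @?f x + @?g x) =>
    first [apply: measurable_fun_add | apply: measurable_fun_addv]
  end.

Ltac measurability :=
  repeat first
  [ measurability_step
  | exact: measurable_cst | exact: measurable_fst | exact: measurable_snd
  | assumption | done
  | apply: measurable_fun_xjoin | apply: measurable_fun_oppv | apply: measurable_fun_addv
  | apply: measurable_fun_add | apply: measurable_fun_mul ].

(** * Open sets and continuous functions are measurable for the product sigma-algebra *)

Section borel_row_vectors.
Context {R : realType}.

(** An open set is a countable union of boxes with rational centres and radii 1/(k+1), and a box is
    a finite intersection of conditions on single coordinates. *)
Lemma open_measurable_rV n (U : set 'rV[R]_n) : open U -> measurable U.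
Proof.
move=> oU.
pose B (p : 'rV[rat]_n * nat) : set 'rV[R]_n :=
  [set y | forall i, `|ratr (p.1 0 i) - y 0 i| < p.2.+1%:R^-1].
have mB p : measurable (B p).
  rewrite (_ : B p = \bigcap_(i in [set: 'I_n])
      (setT `&` (fun y : 'rV[R]_n => `|ratr (p.1 0 i) - y 0 i|) @^-1` `]-oo, p.2.+1%:R^-1[)).
    apply: fin_bigcap_measurable => // i _.
    have h : measurable_fun setT (fun y : 'rV[R]_n => `|ratr (p.1 0 i) - y 0 i|).
      by measurability.
    by apply: h.
  apply/seteqP; split => y; rewrite /B /= => h.
    by move=> i _; rewrite /= in_itv/=; split => //; exact: h.
  by move=> i; have [_] := h i I; rewrite /= in_itv/=.
have -> : U = \bigcup_(p in [set p | B p `<=` U]) B p.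
  apply/seteqP; split => [x Ux|x [p /= pU]]; last exact: pU.
  move: (oU); rewrite openE => /(_ _ Ux); rewrite /interior/= nbhs_ballP => -[e /= e0 eU].
  (* Chosen so that 2/(k+1) < e: one radius from [x] to the rational centre, another from the centre
     to a point of the box. *)
  pose k := Num.truncn (2 / e).
  have k0 : 0 < k.+1%:R^-1 :> R by rewrite invr_gt0 ltr0n.
  have ke : k.+1%:R^-1 + k.+1%:R^-1 < e.
    rewrite (_ : _ + _ = 2 / k.+1%:R); last by rewrite mulr_natl mulr2n.
    by rewrite ltr_pdivrMr ?ltr0n// mulrC -ltr_pdivrMr// truncnS_gt.
  have /choice[q qx] : forall i : 'I_n, exists q : rat, `|ratr q - x 0 i| < k.+1%:R^-1.
    move=> i; have : x 0 i - k.+1%:R^-1 < x 0 i + k.+1%:R^-1 by rewrite ltrD2l gtrN.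
    by move=> /rat_in_itvoo[q]; rewrite in_itv/= -ltr_distlC distrC => h; exists q.
  exists (\row_i q i, k) => /=; last by move=> i; rewrite /= mxE; exact: qx.
  move=> y /= h; apply: eU; split => // i j; rewrite (ord1 i) /ball/= /ball_.
  apply: le_lt_trans ke; have := h j; rewrite mxE => hj; have := qx j.
  move=> qj; rewrite (_ : x 0 j - y 0 j = (x 0 j - ratr (q j)) + (ratr (q j) - y 0 j)); last by ring.
  by apply: (le_trans (ler_normD _ _)); rewrite lerD// ltW// distrC.
rewrite bigcup_mkcond; apply: countable_bigcupT_measurable => //; by move=> p; case: ifP.
Qed.

Lemma continuous_measurable_rV n (f : 'rV[R]_n -> R) :
  continuous f -> measurable_fun setT f.
Proof.
move=> cf; apply: (measurability _ (RGenOInfty.measurableE R)).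
move=> _ [_ [a ->]] <-; rewrite setTI; apply: open_measurable_rV.
by apply: open_comp => //; exact: interval_open.
Qed.

End borel_row_vectors.

Section lebesgue_rV_integral.
Context {R : realType}.
Notation mu := (@lebesgue_measure R).
Local Open Scope ereal_scope.

(** The measure in dimension n + 1 is the pushforward of a product by [xjoin]. Every induction on
    the dimension goes through this formula. *)
Lemma ge0_integral_rVS n (f : 'rV[R]_n.+1 -> \bar R) :
  measurable_fun setT f -> (forall x, 0 <= f x) ->
  \int[lebesgue_rV R n.+1]_x f x =
  \int[lebesgue_rV R n]_y \int[mu]_t f (xjoin y t).
Proof.
move=> mf f0.
have mj : measurable_fun setT (fun p : 'rV[R]_n * measurableTypeR R => xjoin p.1 p.2).
  exact: measurable_xjoin.
have -> : \int[lebesgue_rV R n.+1]_x f x =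
    \int[measure_function_pushforward__canonical__measure_function_Measure
      (lebesgue_rV R n \x mu) mj]_x f x by [].
rewrite (ge0_integral_pushforward mj)// preimage_setT.
apply: (@fubini_tonelli1 _ _ _ _ R (lebesgue_rV R n) mu
  (f \o (fun p : 'rV[R]_n * measurableTypeR R => xjoin p.1 p.2))).
  by apply: measurableT_comp.
by move=> p; exact: f0.
Qed.

Lemma ge0_integral_rV_shift n (f : 'rV[R]_n -> \bar R) (a : 'rV[R]_n) :
  measurable_fun setT f -> (forall x, 0 <= f x) ->
  \int[lebesgue_rV R n]_x f (x + a)%R = \int[lebesgue_rV R n]_x f x.
Proof.
elim: n f a => [|n IHn] f a mf f0.
  by apply: eq_integral => x _; congr f; apply/rowP => -[].
have mfa : measurable_fun setT (fun x : 'rV[R]_n.+1 => f (x + a)%R).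
  by apply: measurableT_comp => //; measurability.
rewrite ge0_integral_rVS// [RHS]ge0_integral_rVS//.
have mfj : measurable_fun setT (fun p : 'rV[R]_n * measurableTypeR R => f (xjoin p.1 p.2)).
  by apply: measurableT_comp => //; exact: measurable_xjoin.
rewrite -[RHS](IHn _ (xinit a)).
- apply: eq_integral => y _.
  rewrite -[RHS](ge0_integral_shift (xlast a))//.
  + by apply: eq_integral => t _; rewrite xjoinD xjoinK.
  + by apply: measurableT_comp => //; measurability.
- by apply: (@measurable_fun_integral_on _ _ _ (measurableTypeR R) R mu _ measurableT (fun y t => f (xjoin y t))).
- by move=> y; apply: integral_ge0.
Qed.

Lemma ge0_integral_rV_opp n (f : 'rV[R]_n -> \bar R) :
  measurable_fun setT f -> (forall x, 0 <= f x) ->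
  \int[lebesgue_rV R n]_x f (- x)%R = \int[lebesgue_rV R n]_x f x.
Proof.
elim: n f => [|n IHn] f mf f0.
  by apply: eq_integral => x _; congr f; apply/rowP => -[].
have mfa : measurable_fun setT (fun x : 'rV[R]_n.+1 => f (- x)%R).
  by apply: measurableT_comp => //; measurability.
rewrite ge0_integral_rVS// [RHS]ge0_integral_rVS//.
have mfj : measurable_fun setT (fun p : 'rV[R]_n * measurableTypeR R => f (xjoin p.1 p.2)).
  by apply: measurableT_comp => //; exact: measurable_xjoin.
rewrite -[RHS]IHn.
- apply: eq_integral => y _.
  rewrite -[RHS]ge0_integral_opp//.
  + by apply: eq_integral => t _; rewrite xjoinN.
  + by apply: measurableT_comp => //; measurability.
- by apply: (@measurable_fun_integral_on _ _ _ (measurableTypeR R) R mu _ measurableT (fun y t => f (xjoin y t))).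
- by move=> y; apply: integral_ge0.
Qed.

(** The positive and the negative part, whose integrals define the signed one, are translated
    separately, whether these are finite or not. *)
Lemma integral_rV_shift n (f : 'rV[R]_n -> \bar R) (a : 'rV[R]_n) :
  measurable_fun setT f ->
  \int[lebesgue_rV R n]_x f (x + a)%R = \int[lebesgue_rV R n]_x f x.
Proof.
move=> mf; rewrite integralE [RHS]integralE.
congr (_ - _).
  transitivity (\int[lebesgue_rV R n]_x (f^\+ (x + a)%R)).
    by apply: eq_integral => x _; exact: (congr1 (@^~ x) (funepos_comp f (fun x => x + a)%R)).
  by apply: ge0_integral_rV_shift; [exact: measurable_funepos|move=> x; exact: funepos_ge0].
transitivity (\int[lebesgue_rV R n]_x (f^\- (x + a)%R)).
    by apply: eq_integral => x _; exact: (congr1 (@^~ x) (funeneg_comp f (fun x => x + a)%R)).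
  by apply: ge0_integral_rV_shift; [exact: measurable_funeneg|move=> x; exact: funeneg_ge0].
Qed.

Lemma integral_rV_opp n (f : 'rV[R]_n -> \bar R) :
  measurable_fun setT f ->
  \int[lebesgue_rV R n]_x f (- x)%R = \int[lebesgue_rV R n]_x f x.
Proof.
move=> mf; rewrite integralE [RHS]integralE.
congr (_ - _).
  transitivity (\int[lebesgue_rV R n]_x (f^\+ (- x)%R)).
    by apply: eq_integral => x _; exact: (congr1 (@^~ x) (funepos_comp f (fun x => - x)%R)).
  by apply: ge0_integral_rV_opp; [exact: measurable_funepos|move=> x; exact: funepos_ge0].
transitivity (\int[lebesgue_rV R n]_x (f^\- (- x)%R)).
    by apply: eq_integral => x _; exact: (congr1 (@^~ x) (funeneg_comp f (fun x => - x)%R)).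
  by apply: ge0_integral_rV_opp; [exact: measurable_funeneg|move=> x; exact: funeneg_ge0].
Qed.

Lemma integral_rV_reflect n (f : 'rV[R]_n -> \bar R) (a : 'rV[R]_n) :
  measurable_fun setT f ->
  \int[lebesgue_rV R n]_x f (a - x)%R = \int[lebesgue_rV R n]_x f x.
Proof.
move=> mf; rewrite -[RHS](integral_rV_shift a)// -[RHS]integral_rV_opp.
  by apply: eq_integral => x _; rewrite addrC.
by apply: measurableT_comp => //; measurability.
Qed.

Lemma measurable_rV0 n : measurable [set 0%R : 'rV[R]_n].
Proof.
rewrite (_ : [set 0%R] = setT `&` (fun x : 'rV[R]_n => dotp x x) @^-1` [set 0%R]).
  have h : measurable_fun setT (fun x : 'rV[R]_n => dotp x x) by measurability.
  by apply: h.
apply/seteqP; split => x /=; first by move=> ->; rewrite dotp0.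
by move=> [_ /eqP]; rewrite dotp_eq0 => /eqP.
Qed.

(** In dimension 0 the origin has mass 1; from dimension 1 on, the factor of the last coordinate is
    null. The kernels singular at the origin are handled through this. *)
Lemma lebesgue_rV_set0 n : lebesgue_rV R n.+1 [set 0%R] = 0.
Proof.
transitivity ((lebesgue_rV R n \x mu)
    ((fun p : 'rV[R]_n * measurableTypeR R => xjoin p.1 p.2) @^-1` [set 0%R])) => //.
rewrite (_ : _ @^-1` _ = [set 0%R] `*` [set 0%R]).
  rewrite product_measure1E//; last exact: measurable_rV0.
  transitivity (lebesgue_rV R n [set 0%R] * 0); last exact: mule0.
  by congr (_ * _); exact: lebesgue_measure_set1.
apply/seteqP; split => -[y t] /=.
  move=> yt0; split.
    by rewrite -(xinit_join y t) yt0; apply/rowP => i; rewrite !mxE.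
  by rewrite -(xlast_join y t) yt0 /xlast mxE.
move=> [-> ->]; apply/rowP => i; rewrite !mxE; case: unliftP => // j _.
by rewrite mxE.
Qed.

Lemma ae_rV_neq0 n : {ae lebesgue_rV R n.+1, forall x, x != 0%R}.
Proof.
exists [set 0%R]; split; [exact: measurable_rV0|exact: lebesgue_rV_set0|].
by move=> x /= /negP; rewrite negbK => /eqP.
Qed.

End lebesgue_rV_integral.

(** * Gaussians and the heat semigroup *)

Section gaussian.
Context {R : realType}.
Notation mu := (@lebesgue_measure R).

(** The heat kernel of the line: the centred Gaussian density of variance 2 s. *)
Definition gauss_kernel (s t : R) : R :=
  (4 * pi * s) `^ (- 2^-1) * expR (- (t ^+ 2 / (4 * s))).

Definition heat_kernel n (s : R) (y : 'rV[R]_n) : R :=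
  (4 * pi * s) `^ (- (n%:R / 2)) * expR (- (dotp y y / (4 * s))).

Lemma fourpi_gt0 (s : R) : 0 < s -> 0 < 4 * pi * s.
Proof. by move=> s0; rewrite !mulr_gt0// pi_gt0. Qed.

Lemma gauss_kernel_ge0 s t : 0 <= gauss_kernel s t.
Proof. by rewrite mulr_ge0 ?powR_ge0 ?expR_ge0. Qed.

Lemma heat_kernel_ge0 n s (y : 'rV[R]_n) : 0 <= heat_kernel s y.
Proof. by rewrite mulr_ge0 ?powR_ge0 ?expR_ge0. Qed.

Lemma heat_kernel_xjoin n s (y : 'rV[R]_n) t : 0 < s ->
  heat_kernel s (xjoin y t) = heat_kernel s y * gauss_kernel s t.
Proof.
move=> s0; rewrite /heat_kernel /gauss_kernel dotp_xjoin -expr2.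
have -> : - (n.+1%:R / 2) = - (n%:R / 2) + - 2^-1 :> R by rewrite -natr1; field.
rewrite powRDp ?fourpi_gt0// (mulrDl (dotp y y)) opprD expRD; ring.
Qed.

Lemma heat_kernelN n s (y : 'rV[R]_n) : heat_kernel s (- y) = heat_kernel s y.
Proof. by rewrite /heat_kernel dotpNl dotpNr opprK. Qed.

Lemma gauss_kernelN s t : gauss_kernel s (- t) = gauss_kernel s t.
Proof. by rewrite /gauss_kernel sqrrN. Qed.

Lemma measurable_gauss_kernel d (T : measurableType d) D (f g : T -> R) :
  measurable_fun D f -> measurable_fun D g ->
  measurable_fun D (fun x => gauss_kernel (f x) (g x)).
Proof. by move=> mf mg; rewrite /gauss_kernel; measurability. Qed.

Lemma measurable_heat_kernel d (T : measurableType d) D n (f : T -> R) (g : T -> 'rV[R]_n) :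
  measurable_fun D f -> measurable_fun D g ->
  measurable_fun D (fun x => heat_kernel (f x) (g x)).
Proof. by move=> mf mg; rewrite /heat_kernel; measurability. Qed.

Lemma powR_sqrV (c : R) : 0 < c -> (c ^+ 2) `^ (- 2^-1) = c^-1.
Proof.
move=> c0; rewrite -(powR_mulrn 2%N (ltW c0)) -powRrM mulrN mulfV// powRN.
by rewrite powRr1// ltW.
Qed.

Lemma gauss_kernel_scale (s c t : R) : 0 < s -> 0 < c ->
  c * gauss_kernel (s * c ^+ 2) (c * t) = gauss_kernel s t.
Proof.
move=> s0 c0; rewrite /gauss_kernel mulrA.
have -> : 4 * pi * (s * c ^+ 2) = (4 * pi * s) * c ^+ 2 by ring.
rewrite powRM ?ltW ?fourpi_gt0 ?exprn_gt0//.
rewrite powR_sqrV// (_ : (c * t) ^+ 2 / (4 * (s * c ^+ 2)) = t ^+ 2 / (4 * s)).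
  by rewrite mulrCA divff ?gt_eqF// mulr1.
by field; rewrite !gt_eqF.
Qed.

Lemma integral_gauss_kernel (s : R) : 0 < s ->
  (\int[mu]_t (gauss_kernel s t)%:E = 1)%E.
Proof.
(* The substitution t = c u turns t^2 / (4 s) into u^2, the exponent of [gauss_fun]. *)
move=> s0; set c := 2 * Num.sqrt s.
have c0 : 0 < c by rewrite mulr_gt0// sqrtr_gt0.
have cs : c ^+ 2 = 4 * s by rewrite exprMn sqr_sqrtr ?ltW//; ring.
rewrite -(@ge0_integral_affine R _ c 0)//.
- transitivity (\int[mu]_t ((Num.sqrt pi)^-1%:E * (gauss_fun t)%:E))%E.
    rewrite -ge0_integralZl_EFin ?(ltW c0)//.
    + apply: eq_integral => t _; rewrite addr0 -!EFinM; congr EFin.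
      rewrite /gauss_kernel /gauss_fun exprMn cs.
      rewrite (mulrC (4 * s)) mulfK; last by rewrite gt_eqF// mulr_gt0.
      rewrite (_ : 4 * pi * s = pi * c ^+ 2); last by rewrite cs; ring.
      rewrite powRM ?sqr_ge0 ?pi_ge0// powR_sqrV//.
      rewrite powRN powR12_sqrt ?pi_ge0//.
      by field; rewrite !gt_eqF// sqrtr_gt0 pi_gt0.
    + by move=> t _; rewrite lee_fin gauss_kernel_ge0.
    + apply: measurable_fun_EFin; apply: measurable_gauss_kernel => //.
      by measurability.
  rewrite ge0_integralZl_EFin//.
  + rewrite integralT_gauss -EFinM mulVf// gt_eqF// sqrtr_gt0 pi_gt0//.
  + by move=> t _; rewrite lee_fin expR_ge0.
  + by apply: measurable_fun_EFin; exact: measurable_gauss_fun.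
- by apply: measurable_fun_EFin; apply: measurable_gauss_kernel.
- by move=> t; rewrite lee_fin gauss_kernel_ge0.
Qed.

(** Completion of the square in [r]: the second factor on the right is a translated Gaussian of
    total mass 1, so integrating in [r] yields the convolution formula. *)
Lemma gauss_kernelM (s u r t : R) : 0 < s -> 0 < u ->
  gauss_kernel s (t - r) * gauss_kernel u r =
  gauss_kernel (s + u) t * gauss_kernel (s * u / (s + u)) (r - t * u / (s + u)).
Proof.
move=> s0 u0; have su0 : 0 < s + u by rewrite addr_gt0.
have w0 : 0 < s * u / (s + u) by rewrite divr_gt0// mulr_gt0.
rewrite /gauss_kernel.
have -> : (4 * pi * s) `^ (- 2^-1) * expR (- ((t - r) ^+ 2 / (4 * s))) *
   ((4 * pi * u) `^ (- 2^-1) * expR (- (r ^+ 2 / (4 * u)))) =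
   ((4 * pi * s) `^ (- 2^-1) * (4 * pi * u) `^ (- 2^-1)) *
   (expR (- ((t - r) ^+ 2 / (4 * s))) * expR (- (r ^+ 2 / (4 * u)))) by ring.
rewrite [RHS]mulrACA -!expRD -!powRM ?ltW ?fourpi_gt0//.
congr (_ * _).
  by congr powR; field; rewrite gt_eqF.
by congr expR; field; rewrite !gt_eqF.
Qed.

Lemma gauss_kernel_conv (s u t : R) : 0 < s -> 0 < u ->
  (\int[mu]_r (gauss_kernel s (t - r) * gauss_kernel u r)%:E =
   (gauss_kernel (s + u) t)%:E)%E.
Proof.
move=> s0 u0; have su0 : 0 < s + u by rewrite addr_gt0.
have w0 : 0 < s * u / (s + u) by rewrite divr_gt0// mulr_gt0.
have mg : measurable_fun setT (fun r => (gauss_kernel (s * u / (s + u)) r)%:E).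
  by apply: measurable_fun_EFin; apply: measurable_gauss_kernel.
transitivity (\int[mu]_r ((gauss_kernel (s + u) t)%:E *
    (gauss_kernel (s * u / (s + u)) (r - t * u / (s + u)))%:E))%E.
  by apply: eq_integral => r _; rewrite gauss_kernelM// EFinM.
rewrite ge0_integralZl_EFin//.
- rewrite (ge0_integral_shift (f := fun r => (gauss_kernel (s * u / (s + u)) r)%:E))//.
    by rewrite integral_gauss_kernel// mule1.
  by move=> r; rewrite lee_fin gauss_kernel_ge0.
- by move=> r _; rewrite lee_fin gauss_kernel_ge0.
- apply: measurable_fun_EFin; apply: measurable_gauss_kernel => //.
  by measurability.
- exact: gauss_kernel_ge0.
Qed.

Lemma integral_rV0 (f : 'rV[R]_0 -> \bar R) : measurable_fun setT f ->
  (\int[lebesgue_rV R 0]_x f x = f 0%R)%E.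
Proof.
by move=> mf; rewrite integral_dirac// diracE mem_set// mul1e.
Qed.

Lemma integral_heat_kernel n (s : R) : 0 < s ->
  (\int[lebesgue_rV R n]_y (heat_kernel s y)%:E = 1)%E.
Proof.
move=> s0; elim: n => [|n IHn].
  rewrite integral_rV0; last by apply: measurable_fun_EFin; exact: measurable_heat_kernel.
  by rewrite /heat_kernel mul0r oppr0 powRr0 dotp0 mul0r oppr0 expR0 mulr1.
rewrite ge0_integral_rVS.
- rewrite -[RHS]IHn; apply: eq_integral => y _.
  under eq_integral do rewrite heat_kernel_xjoin// EFinM.
  rewrite ge0_integralZl_EFin ?heat_kernel_ge0//.
  + by rewrite integral_gauss_kernel// mule1.
  + by move=> t _; rewrite lee_fin gauss_kernel_ge0.
  + by apply: measurable_fun_EFin; exact: measurable_gauss_kernel.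
- by apply: measurable_fun_EFin; exact: measurable_heat_kernel.
- by move=> x; rewrite lee_fin heat_kernel_ge0.
Qed.

Lemma heat_kernel_conv n (s u : R) (x : 'rV[R]_n) : 0 < s -> 0 < u ->
  (\int[lebesgue_rV R n]_y (heat_kernel s (x - y) * heat_kernel u y)%:E =
   (heat_kernel (s + u) x)%:E)%E.
Proof.
move=> s0 u0; have su0 : 0 < s + u by rewrite addr_gt0.
have mh k (z : 'rV[R]_k) : measurable_fun setT (fun y : 'rV[R]_k =>
    (heat_kernel s (z - y) * heat_kernel u y)%:E).
  apply: measurable_fun_EFin; apply: measurable_fun_mul.
    by apply: measurable_heat_kernel => //; measurability.
  exact: measurable_heat_kernel.
elim: n x => [|n IHn] x.
  rewrite integral_rV0// (_ : x = 0); last by apply/rowP => -[].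
  rewrite subr0 /heat_kernel !mul0r !oppr0 !powRr0 dotp0.
  by rewrite !mul0r oppr0 expR0 !mulr1.
rewrite ge0_integral_rVS//; last by move=> y; rewrite lee_fin mulr_ge0// heat_kernel_ge0.
transitivity (\int[lebesgue_rV R n]_y ((gauss_kernel (s + u) (xlast x))%:E *
   (heat_kernel s (xinit x - y) * heat_kernel u y)%:E))%E.
  apply: eq_integral => y _.
  transitivity (\int[mu]_t ((heat_kernel s (xinit x - y) * heat_kernel u y)%:E *
      (gauss_kernel s (xlast x - t) * gauss_kernel u t)%:E))%E.
    apply: eq_integral => t _; rewrite -EFinM; congr EFin.
    rewrite -{1}(xjoinK x) -xjoinN -xjoinD !heat_kernel_xjoin//; ring.
  rewrite ge0_integralZl_EFin//.
  + by rewrite gauss_kernel_conv// muleC.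
  + by move=> t _; rewrite lee_fin mulr_ge0 ?gauss_kernel_ge0.
  + apply: measurable_fun_EFin; apply: measurable_fun_mul.
      by apply: measurable_gauss_kernel => //; measurability.
    exact: measurable_gauss_kernel.
  + by rewrite mulr_ge0 ?heat_kernel_ge0.
rewrite ge0_integralZl_EFin//.
- rewrite IHn -EFinM; congr EFin.
  by rewrite mulrC -heat_kernel_xjoin// xjoinK.
- by move=> t _; rewrite lee_fin mulr_ge0 ?heat_kernel_ge0.
- exact: mh.
- exact: gauss_kernel_ge0.
Qed.

(** Multiplying a centred Gaussian variable by [c] multiplies its variance by c^2; a negative [c] is
    reduced to a positive one by the evenness of the kernel. *)
Lemma gauss_integral_scale (h : R -> \bar R) (s c a : R) : 0 < s -> c != 0 ->
  measurable_fun setT h -> (forall t, 0 <= h t)%E ->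
  (\int[mu]_t (h (a + t * c)%R * (gauss_kernel s t)%:E) =
   \int[mu]_t (h (a + t)%R * (gauss_kernel (s * c ^+ 2) t)%:E))%E.
Proof.
move=> s0 c0 mh h0.
have mhG e b w : measurable_fun setT (fun t : R => h (b + t * e)%R * (gauss_kernel w t)%:E)%E.
  apply: emeasurable_funM; last by apply: measurable_fun_EFin; exact: measurable_gauss_kernel.
  by apply: measurableT_comp => //; measurability.
wlog {c0} c0 : c / 0 < c => [H|].
  move: c0; rewrite neq_lt => /orP[cn|cp]; last exact: H.
  rewrite -(sqrrN c) -H ?oppr_gt0//.
  rewrite -[RHS](ge0_integral_opp (f := fun t => h (a + t * - c)%R * (gauss_kernel s t)%:E)%E).
  - by apply: eq_integral => t _; rewrite gauss_kernelN mulrNN.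
  - exact: mhG.
  - by move=> t; rewrite mule_ge0// lee_fin gauss_kernel_ge0.
rewrite -[RHS](@ge0_integral_affine R _ c 0)//.
- rewrite -ge0_integralZl_EFin ?(ltW c0)//.
  + apply: eq_integral => t _.
    by rewrite addr0 muleCA -EFinM gauss_kernel_scale// (mulrC c).
  + by move=> t _; rewrite mule_ge0// lee_fin gauss_kernel_ge0.
  + apply: emeasurable_funM.
      by apply: measurableT_comp => //; measurability.
    by apply: measurable_fun_EFin; apply: measurable_gauss_kernel => //; measurability.
- by have := mhG 1 a (s * c ^+ 2); under eq_fun do rewrite mulr1.
- by move=> t; rewrite mule_ge0// lee_fin gauss_kernel_ge0.
Qed.

(** A linear form of a Gaussian vector is a Gaussian variable. The coordinates are added one at a
    time, their contributions being convolved by [gauss_kernel_conv]; this does the work of a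
    rotation carrying [v] to an axis. *)
Lemma gauss_integral_linear_form n (h : R -> \bar R) (s : R) (v : 'rV[R]_n) :
  0 < s -> v != 0 -> measurable_fun setT h -> (forall t, 0 <= h t)%E ->
  (\int[lebesgue_rV R n]_z (h (dotp z v) * (heat_kernel s z)%:E) =
   \int[mu]_t (h t * (gauss_kernel (s * dotp v v) t)%:E))%E.
Proof.
move=> s0; elim: n h v => [|n IHn] h v v0 mh h0.
  by move: v0; rewrite (_ : v = 0) ?eqxx//; apply/rowP => -[].
rewrite -(xjoinK v) in v0 *; move: (xinit v) (xlast v) v0 => w c v0 {v}.
have mH k (v : 'rV[R]_k) (g : R -> \bar R) : measurable_fun setT g ->
    measurable_fun setT (fun z : 'rV[R]_k => g (dotp z v) * (heat_kernel s z)%:E)%E.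
  move=> mg; apply: emeasurable_funM.
    by apply: measurableT_comp => //; measurability.
  by apply: measurable_fun_EFin; exact: measurable_heat_kernel.
have mG u a b (g : R -> \bar R) : measurable_fun setT g ->
    measurable_fun setT (fun t : R => g (a + t * b)%R * (gauss_kernel u t)%:E)%E.
  move=> mg; apply: emeasurable_funM; last by apply: measurable_fun_EFin; exact: measurable_gauss_kernel.
  by apply: measurableT_comp => //; measurability.
rewrite ge0_integral_rVS//; last 2 first.
- exact: mH.
- by move=> z; rewrite mule_ge0// lee_fin heat_kernel_ge0.
(* The integral over the last coordinate, as a function of the part of the linear form due to the
   other ones: the induction hypothesis is applied to it. *)
pose Phi a := (\int[mu]_t (h (a + t * c)%R * (gauss_kernel s t)%:E))%E.
have mPhi : measurable_fun setT Phi.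
  apply: (@measurable_fun_integral_on _ _ (measurableTypeR R) (measurableTypeR R) R mu _ measurableT
     (fun a t => h (a + t * c)%R * (gauss_kernel s t)%:E)%E).
    apply: emeasurable_funM.
      by apply: measurableT_comp => //; measurability.
    by apply: measurable_fun_EFin; exact: measurable_gauss_kernel.
  by move=> a t _; rewrite mule_ge0// lee_fin gauss_kernel_ge0.
have Phi0 a : (0 <= Phi a)%E.
  by apply: integral_ge0 => t _; rewrite mule_ge0// lee_fin gauss_kernel_ge0.
transitivity (\int[lebesgue_rV R n]_y (Phi (dotp y w) * (heat_kernel s y)%:E))%E.
  apply: eq_integral => y _; rewrite muleC -ge0_integralZl_EFin ?heat_kernel_ge0//.
  - apply: eq_integral => t _.
    by rewrite dotp_xjoin heat_kernel_xjoin// EFinM muleCA.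
  - by move=> t _; rewrite mule_ge0// lee_fin gauss_kernel_ge0.
  - exact: mG.
rewrite dotp_xjoin -expr2.
(* A zero component would contribute a Gaussian of variance 0, which has no density, so c = 0 and w
   = 0 are treated apart. *)
have [c0|c0] := eqVneq c 0.
  have w0 : w != 0.
    apply: contra v0 => /eqP ->; rewrite c0; apply/eqP/rowP => i.
    by rewrite !mxE; case: unliftP => // j _; rewrite mxE.
  rewrite c0 expr0n/= addr0 -IHn//; apply: eq_integral => y _; congr (_ * _)%E.
  rewrite /Phi c0; under eq_integral do rewrite mulr0 addr0.
  rewrite ge0_integralZl//.
  - by rewrite integral_gauss_kernel// mule1.
  - by apply: measurable_fun_EFin; exact: measurable_gauss_kernel.
  - by move=> t _; rewrite lee_fin gauss_kernel_ge0.
have Phia a : Phi a = (\int[mu]_t (h (a + t)%R * (gauss_kernel (s * c ^+ 2) t)%:E))%E.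
  exact: gauss_integral_scale.
have [w0|w0] := eqVneq w 0.
  rewrite w0 dotp0 add0r.
  transitivity (\int[lebesgue_rV R n]_y (Phi 0%R * (heat_kernel s y)%:E))%E.
    by apply: eq_integral => y _; rewrite /dotp big1// => i _; rewrite mxE mulr0.
  rewrite ge0_integralZl//.
  - rewrite integral_heat_kernel// mule1 Phia.
    by under eq_integral do rewrite add0r.
  - by apply: measurable_fun_EFin; exact: measurable_heat_kernel.
  - by move=> t _; rewrite lee_fin heat_kernel_ge0.
rewrite IHn//.
transitivity (\int[mu]_a \int[mu]_t (h t * (gauss_kernel (s * c ^+ 2) (t - a) *
   gauss_kernel (s * dotp w w) a)%:E))%E.
  apply: eq_integral => a _; rewrite Phia muleC -ge0_integralZl_EFin ?gauss_kernel_ge0//.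
  - rewrite -[RHS](ge0_integral_shift a).
    + apply: eq_integral => t _.
      by rewrite addrK EFinM (addrC t) muleC -muleA.
    + apply: emeasurable_funM => //; apply: measurable_fun_EFin.
      apply: measurable_fun_mul => //.
      by apply: measurable_gauss_kernel => //; measurability.
    + by move=> t; rewrite mule_ge0// lee_fin mulr_ge0// gauss_kernel_ge0.
  - by move=> t _; rewrite mule_ge0// lee_fin gauss_kernel_ge0.
  - by have := mG (s * c ^+ 2) a 1 h mh; under eq_fun do rewrite mulr1.
rewrite (@tonelli_on _ _ (measurableTypeR R) (measurableTypeR R) R mu mu setT setT
  measurableT measurableT (fun a t => h t * (gauss_kernel (s * c ^+ 2) (t - a) *
   gauss_kernel (s * dotp w w) a)%:E)%E).
- apply: eq_integral => t _; rewrite ge0_integralZl//.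
  + rewrite gauss_kernel_conv; first by rewrite mulrDr (addrC (s * _)).
      by rewrite mulr_gt0// lt0r sqr_ge0 sqrf_eq0 c0.
    by rewrite mulr_gt0// dotp_gt0.
  + apply: measurable_fun_EFin; apply: measurable_fun_mul.
      by apply: measurable_gauss_kernel => //; measurability.
    exact: measurable_gauss_kernel.
  + by move=> a _; rewrite lee_fin mulr_ge0// gauss_kernel_ge0.
- apply: emeasurable_funM; first by apply: measurableT_comp.
  apply: measurable_fun_EFin; apply: measurable_fun_mul.
    by apply: measurable_gauss_kernel => //; measurability.
  by apply: measurable_gauss_kernel.
- by move=> a t _ _; rewrite mule_ge0// lee_fin mulr_ge0// gauss_kernel_ge0.
Qed.

End gaussian.

(** * Directional derivatives as derivatives along a line *)

Section directional_derivative.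
Context {R : realType}.

Lemma is_derive_along n (f : 'rV[R]_n -> R) (z v : 'rV[R]_n) (t l : R) :
  is_derive (t *: v + z) v f l -> is_derive t 1 (fun t : R => f (t *: v + z)) l.
Proof.
case=> df dl; have e : (fun h : R => h^-1 *: (f (h *: v + (t *: v + z)) - f (t *: v + z))) =
    (fun h : R => h^-1 *: ((fun t : R => f (t *: v + z)) (h *: 1 + t) - f (t *: v + z))).
  apply/funext => h; congr (_ *: (f _ - _)).
  by rewrite addrA /GRing.scale/= mulr1 -scalerDl.
split; first by move: df; rewrite /derivable e.
by rewrite -dl /derive e.
Qed.

Lemma is_derive_from_line n (f : 'rV[R]_n -> R) (z v : 'rV[R]_n) (l : R) :
  is_derive (0 : R) 1 (fun t : R => f (t *: v + z)) l -> is_derive z v f l.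
Proof.
case=> df dl; have e : (fun h : R => h^-1 *: (f (h *: v + z) - f z)) =
    (fun h : R => h^-1 *: ((fun t : R => f (t *: v + z)) (h *: 1 + 0) - f (0 *: v + z))).
  apply/funext => h; congr (_ *: (f _ - f _)).
    by rewrite addr0 /GRing.scale/= mulr1.
  by rewrite scale0r add0r.
split; first by rewrite /derivable e.
by rewrite /derive e.
Qed.

End directional_derivative.

(** * Derivatives and pointwise bounds of the heat kernel *)

Section heat_kernel_estimates.
Context {R : realType}.
Implicit Types (s t : R).

Lemma heat_kernel_gt0 n s (y : 'rV[R]_n) : 0 < s -> 0 < heat_kernel s y.
Proof. by move=> s0; rewrite mulr_gt0 ?expR_gt0// powR_gt0// fourpi_gt0. Qed.

Lemma heat_kernel_le n s (y : 'rV[R]_n) : 0 < s ->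
  heat_kernel s y <= (4 * pi * s) `^ (- (n%:R / 2)).
Proof.
move=> s0; rewrite ler_piMr ?powR_ge0// expR_le1// oppr_le0.
by rewrite divr_ge0 ?dotp_ge0// mulr_ge0// ltW.
Qed.

(** Half of the exponent is set aside to absorb polynomial factors; the other half is a kernel at
    the doubled time. *)
Lemma heat_kernel_double n s (y : 'rV[R]_n) : 0 < s ->
  heat_kernel s y =
  2 `^ (n%:R / 2) * expR (- (dotp y y / (8 * s))) * heat_kernel (2 * s) y.
Proof.
move=> s0; rewrite /heat_kernel (_ : 4 * pi * (2 * s) = 2 * (4 * pi * s)); last by ring.
rewrite (powRM _ (ler0n _ 2%N) (ltW (fourpi_gt0 s0))).
transitivity ((2 `^ (n%:R / 2) * 2 `^ (- (n%:R / 2))) * (4 * pi * s) `^ (- (n%:R / 2)) *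
   (expR (- (dotp y y / (8 * s))) * expR (- (dotp y y / (4 * (2 * s)))))); last by ring.
rewrite mulr_powRN// mul1r -expRD; congr (_ * expR _).
by field; rewrite gt_eqF.
Qed.

(** For bounded [h] this gives a majorant independent of [h], at the price of passing from time 1/4
    to time 1/2. Differentiation under the integral sign relies on it. *)
Lemma heat_kernel_translate n (z h : 'rV[R]_n) :
  heat_kernel 4^-1 (z + h) <=
  2 `^ (n%:R / 2) * expR (dotp h h) * heat_kernel 2^-1 z.
Proof.
rewrite /heat_kernel; set A := (4 * pi * 4^-1) `^ (- (n%:R / 2)).
have -> : (4 * pi * 2^-1) `^ (- (n%:R / 2)) = 2 `^ (- (n%:R / 2)) * A :> R.
  rewrite -powRM ?mulr_ge0 ?pi_ge0 ?invr_ge0//; by congr (_ `^ _); field.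
rewrite [leRHS](_ : _ = (2 `^ (n%:R / 2) * 2 `^ (- (n%:R / 2))) *
   (A * (expR (- (dotp z z / (4 * 2^-1))) * expR (dotp h h)))); last by ring.
rewrite mulr_powRN// mul1r ler_wpM2l ?powR_ge0// -expRD ler_expR.
have := dotp_le_double z h => H.
have -> : 4 / 4 = 1 :> R by field.
have -> : 4 / 2 = 2 :> R by field.
lra.
Qed.

(** The half exponent freed by [heat_kernel_double] absorbs |z|^2, by u <= exp u with u = |z|^2 / (8
    s). *)
Lemma heat_kernel_moment n s (z : 'rV[R]_n) : 0 < s ->
  dotp z z * heat_kernel s z <= 8 * s * 2 `^ (n%:R / 2) * heat_kernel (2 * s) z.
Proof.
move=> s0; rewrite heat_kernel_double//; set B := 2 `^ _; set H := heat_kernel _ z.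
rewrite [leLHS](_ : _ = dotp z z * expR (- (dotp z z / (8 * s))) * (B * H)); last by ring.
rewrite -[leRHS]mulrA ler_wpM2r ?mulr_ge0 ?powR_ge0 ?heat_kernel_ge0// expRN ler_pdivrMr ?expR_gt0//.
rewrite -ler_pdivrMl ?mulr_gt0// mulrC.
by apply: le_trans (expR_ge1Dx _); rewrite lerDr.
Qed.

Lemma is_derive_heat_kernel n s (z : 'rV[R]_n) i : 0 < s ->
  is_derive z (delta_mx 0 i) (@heat_kernel R n s)
    (- (z 0 i / (2 * s)) * heat_kernel s z).
Proof.
move=> s0; apply: is_derive_from_line.
have e t : dotp (t *: delta_mx 0 i + z) (t *: delta_mx 0 i + z) =
    dotp z z + (2 * z 0 i) * t + t ^+ 2.
  rewrite !(dotpDl, dotpDr, dotpZl, dotpZr) (dotpC _ z) !dotp_delta mxE !eqxx/=; ring.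
rewrite /heat_kernel; under eq_fun do rewrite e.
have d1 : is_derive (0 : R) 1 (fun t : R => dotp z z + (2 * z 0 i) * t + t ^+ 2)
   (0 + (2 * z 0 i) * 1 + (0 * 1 + 0 * 1)).
  apply: is_derive1_add; last exact: is_derive1_mul.
have d2 := is_derive1_scale ((4 * pi * s) `^ (- (n%:R / 2)))
  (is_derive1_expR (is_derive1_opp (is_derive1_mul d1 (is_derive_cst ((4 * s)^-1 : R) (0 : R) (1 : R))))).
apply: (is_derive_eq d2); rewrite /cst/= !mulr0 expr0n/= !addr0.
by field; rewrite gt_eqF.
Qed.

Lemma is_derive2_heat_kernel n s (z : 'rV[R]_n) i : 0 < s ->
  is_derive z (delta_mx 0 i) (fun z : 'rV[R]_n => - (z 0 i / (2 * s)) * heat_kernel s z)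
    ((z 0 i ^+ 2 / (4 * s ^+ 2) - (2 * s)^-1) * heat_kernel s z).
Proof.
move=> s0; apply: is_derive_from_line.
have d1 : is_derive (0 : R) 1 (fun t : R => - (((t *: delta_mx 0 i + z) 0 i : R) / (2 * s))) (- (2 * s)^-1).
  rewrite (_ : (fun _ => _) = (fun t : R => - (2 * s)^-1 * (t + z 0 i))).
    apply: (is_derive_eq (is_derive1_scale _ (is_derive1_add (is_derive_id _ _) (is_derive_cst (z 0 i) _ _)))).
    by rewrite addr0 mulr1.
  by apply/funext => t; rewrite !mxE !eqxx mulr1; ring.
have d2 : is_derive (0 : R) 1 (fun t : R => heat_kernel s (t *: delta_mx 0 i + z))
    (- (z 0 i / (2 * s)) * heat_kernel s z).
  by apply: is_derive_along; rewrite scale0r add0r; exact: is_derive_heat_kernel.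
apply: (is_derive_eq (is_derive1_mul d1 d2)).
rewrite scale0r add0r.
by field; rewrite gt_eqF.
Qed.

Lemma is_derive_heat_kernel_time n s (z : 'rV[R]_n) : 0 < s ->
  is_derive s 1 (fun s => heat_kernel s z)
    ((dotp z z / (4 * s ^+ 2) - n%:R / (2 * s)) * heat_kernel s z).
Proof.
move=> s0.
have d0 : is_derive s 1 (fun s : R => 4 * pi * s) (4 * pi * 1) by exact: is_derive1_scale.
have d1 := is_derive1_powRf (- (n%:R / 2)) (fourpi_gt0 s0) d0.
have d2 : is_derive s 1 (fun s : R => 4 * s) (4 * 1) by exact: is_derive1_scale.
have s4 : 4 * s != 0 by rewrite mulf_neq0// gt_eqF.
have d3 := is_derive1_expR (is_derive1_opp (is_derive1_scale (dotp z z) (is_derive1_inv s4 d2))).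
apply: (is_derive_eq (is_derive1_mul d1 d3)).
rewrite /heat_kernel powRDp ?fourpi_gt0// powR_inv1 ?ltW ?fourpi_gt0//.
move: (lt0r_neq0 (@pi_gt0 R)); move: (pi : R) => p p0.
by field; rewrite p0 gt_eqF.
Qed.

(** The heat equation: the left-hand side sums the derivatives of [is_derive2_heat_kernel], the
    right-hand side is the derivative of [is_derive_heat_kernel_time]. *)
Lemma sum_second_derivative_heat_kernel n s (z : 'rV[R]_n) : 0 < s ->
  \sum_(i < n) (z 0 i ^+ 2 / (4 * s ^+ 2) - (2 * s)^-1) * heat_kernel s z =
  (dotp z z / (4 * s ^+ 2) - n%:R / (2 * s)) * heat_kernel s z.
Proof.
move=> s0; rewrite -mulr_suml sumrB; congr ((_ - _) * _).
  by rewrite /dotp mulr_suml; apply: eq_bigr => i _; rewrite expr2.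
by rewrite sumr_const card_ord [RHS]mulr_natl.
Qed.

Lemma mul_expRN_le1 (x : R) : x * expR (- x) <= 1.
Proof.
by rewrite expRN ler_pdivrMr ?expR_gt0// mul1r; apply: le_trans (expR_ge1Dx _); rewrite lerDr.
Qed.

(** With q = |z|^2 / (4 s) the expression is a constant over [s] times (q - n/2) exp (-q), and q exp
    (-q) <= 1. *)
Lemma heat_kernel_time_derivative_le n s (z : 'rV[R]_n) : 0 < s ->
  `|(dotp z z / (4 * s ^+ 2) - n%:R / (2 * s)) * heat_kernel s z| <=
  (1 + n%:R / 2) / s * (4 * pi * s) `^ (- (n%:R / 2)).
Proof.
move=> s0; set c := _ `^ _; have c0 : 0 <= c by exact: powR_ge0.
have e : (dotp z z / (4 * s ^+ 2) - n%:R / (2 * s)) * heat_kernel s z =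
   c / s * (dotp z z / (4 * s) * expR (- (dotp z z / (4 * s)))) -
   c / s * (n%:R / 2 * expR (- (dotp z z / (4 * s)))).
  by rewrite /heat_kernel -/c; field; rewrite gt_eqF.
have q0 : 0 <= dotp z z / (4 * s) by rewrite divr_ge0 ?dotp_ge0// mulr_ge0// ltW.
have cs0 : 0 <= c / s by rewrite divr_ge0// ltW.
rewrite e (le_trans (ler_normB _ _))// !normrM (ger0_norm c0).
rewrite (ger0_norm (expR_ge0 _)) (_ : `|s^-1| = s^-1); last by rewrite ger0_norm// invr_ge0 ltW.
rewrite -!normrM (ger0_norm q0) (_ : `|n%:R / 2| = n%:R / 2); last by rewrite ger0_norm// divr_ge0.
rewrite [leRHS](_ : _ = c / s * 1 + c / s * (n%:R / 2)); last by ring.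
apply: lerD; apply: ler_wpM2l => //; first exact: mul_expRN_le1.
by rewrite ler_piMr ?divr_ge0// expR_le1 oppr_le0.
Qed.

End heat_kernel_estimates.

Section Rintegral_sum.
Context d (T : measurableType d) (R : realType) (mu : {measure set T -> \bar R}).

Lemma integrable_bigsum D (I : Type) (r : seq I) (F : I -> T -> R) : measurable D ->
  (forall i, mu.-integrable D (EFin \o F i)) ->
  mu.-integrable D (EFin \o (fun x => \sum_(i <- r) F i x)).
Proof.
move=> mD Fi; elim: r => [|i r IHr].
  by under eq_fun do rewrite big_nil; exact: integrable0.
by under eq_fun do rewrite big_cons; exact: integrable_add.
Qed.

Lemma Rintegral_bigsum D (I : Type) (r : seq I) (F : I -> T -> R) : measurable D ->
  (forall i, mu.-integrable D (EFin \o F i)) ->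
  \int[mu]_(x in D) (\sum_(i <- r) F i x) = \sum_(i <- r) \int[mu]_(x in D) F i x.
Proof.
move=> mD Fi; elim: r => [|i r IHr].
  rewrite big_nil; under eq_Rintegral do rewrite big_nil.
  by rewrite /Rintegral integral0.
rewrite big_cons -IHr -RintegralD//; last exact: integrable_bigsum.
by under eq_Rintegral do rewrite big_cons.
Qed.

End Rintegral_sum.

(** * Differentiation and integration by parts for functions dominated by a Gaussian *)

Section gaussian_domination.
Context {R : realType}.
Implicit Types (n : nat) (s t : R).

(* The time 1/4 has no significance: it makes the exponential [expR (- dotp x x)]. *)
Definition gauss_dominated n (a : 'rV[R]_n -> R) :=
  exists M, forall x, `|a x| <= M * heat_kernel 4^-1 x.

Lemma gauss_dominated_ge0 n (a : 'rV[R]_n -> R) : gauss_dominated a ->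
  exists2 M, 0 <= M & forall x, `|a x| <= M * heat_kernel 4^-1 x.
Proof.
move=> [M aM]; exists M => //.
have h : 0 < heat_kernel 4^-1 (0 : 'rV[R]_n) by rewrite heat_kernel_gt0// invr_gt0.
by rewrite -(pmulr_lge0 _ h); exact: le_trans (aM 0).
Qed.

Lemma integral_heat_kernel_reflect n s (x : 'rV[R]_n) : 0 < s ->
  (\int[lebesgue_rV R n]_y (heat_kernel s (x - y))%:E = 1)%E.
Proof.
move=> s0; rewrite -(integral_heat_kernel n s0).
apply: (integral_rV_reflect (f := fun y => (heat_kernel s y)%:E)).
by apply: measurable_fun_EFin; exact: measurable_heat_kernel.
Qed.

Lemma integrable_heat_kernel n s (x : 'rV[R]_n) : 0 < s ->
  (lebesgue_rV R n).-integrable setT (EFin \o (fun y => heat_kernel s (x - y))).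
Proof.
move=> s0; apply: integrable_ge0 => //.
- by apply: measurable_heat_kernel => //; measurability.
- by move=> y _; exact: heat_kernel_ge0.
- by rewrite integral_heat_kernel_reflect// ltry.
Qed.

Lemma integrable_heat_kernel0 n s : 0 < s ->
  (lebesgue_rV R n).-integrable setT (EFin \o heat_kernel s).
Proof.
move=> s0; have := integrable_heat_kernel (0 : 'rV[R]_n) s0.
by under eq_fun do rewrite sub0r heat_kernelN.
Qed.

Lemma integrable_gauss_dominated_mul n (a k : 'rV[R]_n -> R) B :
  measurable_fun setT a -> gauss_dominated a -> measurable_fun setT k ->
  (forall y, `|k y| <= B) ->
  (lebesgue_rV R n).-integrable setT (EFin \o (fun y => a y * k y)).
Proof.
move=> ma /gauss_dominated_ge0[M M0 aM] mk kB.
have i1 : (lebesgue_rV R n).-integrable setT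
    (EFin \o (fun y => (M * B) * heat_kernel 4^-1 y)).
  by apply: integrable_scale => //; apply: integrable_heat_kernel0; rewrite invr_gt0.
apply: (integrable_le _ _ _ i1) => //; first exact: measurable_fun_mul.
move=> y _; rewrite normrM [leRHS]mulrAC; apply: ler_pM => //.
Qed.

Lemma integrable_gauss_dominated n (a : 'rV[R]_n -> R) :
  measurable_fun setT a -> gauss_dominated a ->
  (lebesgue_rV R n).-integrable setT (EFin \o a).
Proof.
move=> ma ad; have := @integrable_gauss_dominated_mul n a (cst 1) 1 ma ad.
under [X in _ -> _ -> _.-integrable _ X]eq_fun do rewrite /= mulr1.
by apply=> // y; rewrite normr1.
Qed.

(** Differentiation under the integral sign along the line through [x]. For |t| < 1,
    [heat_kernel_translate] dominates the translates of [a] and [b] by a multiple of the kernel at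
    time 1/2, against which [K] is assumed integrable. *)
Lemma is_derive_convolution n (K a b : 'rV[R]_n -> R) M (x v : 'rV[R]_n) :
  measurable_fun setT K -> measurable_fun setT a -> measurable_fun setT b ->
  (forall z, is_derive z v a (b z)) ->
  (forall z, `|a z| <= M * heat_kernel 4^-1 z) ->
  (forall z, `|b z| <= M * heat_kernel 4^-1 z) ->
  (lebesgue_rV R n).-integrable setT (EFin \o (fun y => K y * heat_kernel 2^-1 (x - y))) ->
  is_derive x v (fun x => \int[lebesgue_rV R n]_y (K y * a (x - y)))
    (\int[lebesgue_rV R n]_y (K y * b (x - y))).
Proof.
move=> mK ma mb dab aM bM iK.
have M0 : 0 <= M.
  have h : 0 < heat_kernel 4^-1 (0 : 'rV[R]_n) by rewrite heat_kernel_gt0// invr_gt0.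
  by rewrite -(pmulr_lge0 _ h); exact: le_trans (aM 0).
pose C := M * (2 `^ (n%:R / 2) * expR (dotp v v)).
pose G y := C * `|K y * heat_kernel 2^-1 (x - y)|.
pose f t y := K y * a (t *: v + (x - y)).
have C0 : 0 <= C by rewrite !mulr_ge0 ?powR_ge0 ?expR_ge0.
have iG : (lebesgue_rV R n).-integrable setT (EFin \o G).
  by apply: integrable_scale => //; exact: (integrable_norm iK).
have bound (c : 'rV[R]_n -> R) t y : (forall z, `|c z| <= M * heat_kernel 4^-1 z) ->
    (`](-1), 1[%classic : set R) t -> `|K y * c (t *: v + (x - y))| <= G y.
  move=> cM; rewrite /= in_itv/= => /andP[t1 t2].
  rewrite /G normrM normrM mulrCA ler_wpM2l// (ger0_norm (heat_kernel_ge0 _ _)).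
  apply: (le_trans (cM _)); rewrite /C -!mulrA ler_wpM2l// mulrA addrC.
  apply: (le_trans (heat_kernel_translate _ _)).
  rewrite ler_wpM2r ?heat_kernel_ge0// ler_wpM2l ?powR_ge0// ler_expR.
  rewrite dotpZl dotpZr mulrA ler_piMl ?dotp_ge0//; nra.
have mc (c : 'rV[R]_n -> R) t : measurable_fun setT c ->
    measurable_fun setT (fun y => K y * c (t *: v + (x - y))).
  move=> mc; apply: measurable_fun_mul => //.
  by apply: measurableT_comp => //; measurability.
have dd t y : is_derive t 1 (f ^~ y) (K y * b (t *: v + (x - y))).
  by apply: is_derive1_scale; apply: is_derive_along.
have d1f t y : partial1of2 f t y = K y * b (t *: v + (x - y)).
  by rewrite /partial1of2 derive1E; have [_ ->] := dd t y.
have H : h^-1 *: ((\int[lebesgue_rV R n]_y f (h + 0) y) -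
    (\int[lebesgue_rV R n]_y f 0 y)) @[h --> 0^'] -->
    \int[lebesgue_rV R n]_y partial1of2 f 0 y.
  apply: (@cvg_differentiation_under_integral R _ _ (lebesgue_rV R n) f setT measurableT
    0 (- 1) 1 _ _ _ G _ iG).
  - by rewrite /= in_itv/= ltrN10 ltr01.
  - move=> t t1; apply: (integrable_le _ _ _ iG) => //; first exact: mc.
    by move=> y _; exact: bound.
  - by move=> t y _ _; have [] := dd t y.
  - by move=> y; rewrite mulr_ge0.
  - by move=> t y t1 _; rewrite d1f; exact: bound.
have {}H : h^-1 *: ((\int[lebesgue_rV R n]_y (K y * a (h *: v + x - y))) -
    (\int[lebesgue_rV R n]_y (K y * a (x - y)))) @[h --> 0^'] -->
    \int[lebesgue_rV R n]_y (K y * b (x - y)).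
  have -> : \int[lebesgue_rV R n]_y (K y * b (x - y)) =
      \int[lebesgue_rV R n]_y partial1of2 f 0 y.
    by apply: eq_RintegralD => y _; rewrite d1f scale0r add0r.
  apply: (cvg_trans _ H); apply: near_eq_cvg; apply: nearW => h.
  congr (_ *: (_ - _)); apply: eq_RintegralD => y _.
    by rewrite /f addr0 addrA.
  by rewrite /f scale0r add0r.
split; first by apply/cvg_ex; eexists; exact: H.
by apply/cvg_lim => //; exact: H.
Qed.

(** The convolution of [a] with the constant 1 is a constant function by translation invariance, and
    its derivative is the integral of [b]. This replaces an argument with boundary terms. *)
Lemma integral_derivative_eq0 n (a b : 'rV[R]_n -> R) M (v : 'rV[R]_n) :
  measurable_fun setT a -> measurable_fun setT b ->
  (forall z, is_derive z v a (b z)) ->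
  (forall z, `|a z| <= M * heat_kernel 4^-1 z) ->
  (forall z, `|b z| <= M * heat_kernel 4^-1 z) ->
  \int[lebesgue_rV R n]_y b y = 0.
Proof.
move=> ma mb dab aM bM.
have E (c : 'rV[R]_n -> R) x : measurable_fun setT c ->
    \int[lebesgue_rV R n]_y (1 * c (x - y)) = \int[lebesgue_rV R n]_y c y.
  move=> mc; rewrite /Rintegral; under eq_integral do rewrite mul1r.
  congr fine; apply: (integral_rV_reflect (f := fun y => (c y)%:E)).
  exact: measurable_fun_EFin.
have := @is_derive_convolution n (cst 1) a b M 0 v (measurable_cst _) ma mb dab aM bM.
rewrite /= E// => -[].
  have := integrable_heat_kernel (0 : 'rV[R]_n) (_ : 0 < 2^-1).
  have -> : (fun y => 1 * heat_kernel 2^-1 (0 - y)) = (fun y : 'rV[R]_n => heat_kernel 2^-1 (0 - y)).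
    by apply/funext => y; rewrite mul1r.
  by apply; rewrite invr_gt0.
move=> _ <-; rewrite (_ : (fun _ => _) = cst (\int[lebesgue_rV R n]_y a y)).
  exact: derive_cst.
by apply/funext => x; exact: E.
Qed.

Lemma is_derive_reflect n (k : 'rV[R]_n -> R) (x y v : 'rV[R]_n) l :
  is_derive (x - y) v k l -> is_derive y v (fun y => k (x - y)) (- l).
Proof.
move=> dk; apply: is_derive_from_line.
have d1 : is_derive (- 0 : R) 1 (fun t => k (t *: v + (x - y))) l.
  by apply: is_derive_along; rewrite oppr0 scale0r add0r.
have := is_derive1_compose (f := fun t => k (t *: v + (x - y))) (g := fun t => - t) (x := 0) d1
  (is_derive1_opp (is_derive_id (0 : R) (1 : R))).
rewrite mulrN1 (_ : (fun t : R => k (- t *: v + (x - y))) =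
  (fun t : R => k (x - (t *: v + y))))//.
by apply/funext => t; rewrite scaleNr addrCA opprD.
Qed.

(** [integral_derivative_eq0] applied to y -> a y k(x - y). The reflection in the second factor
    reverses the sign of its derivative, so that the identity carries none. *)
Lemma integration_by_parts_rV n (a b k l : 'rV[R]_n -> R) B (x v : 'rV[R]_n) :
  measurable_fun setT a -> measurable_fun setT b ->
  gauss_dominated a -> gauss_dominated b ->
  (forall z, is_derive z v a (b z)) ->
  measurable_fun setT k -> measurable_fun setT l ->
  (forall z, `|k z| <= B) -> (forall z, `|l z| <= B) ->
  (forall z, is_derive z v k (l z)) ->
  \int[lebesgue_rV R n]_y (b y * k (x - y)) =
  \int[lebesgue_rV R n]_y (a y * l (x - y)).
Proof.
move=> ma mb ad bd dab mk ml kB lB dkl.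
have [M M0 aM] := gauss_dominated_ge0 ad; have [N N0 bN] := gauss_dominated_ge0 bd.
have mr (c : 'rV[R]_n -> R) : measurable_fun setT c ->
    measurable_fun setT (fun y : 'rV[R]_n => c (x - y)).
  by move=> mc; apply: measurableT_comp => //; measurability.
have mk' := mr _ mk; have ml' := mr _ ml.
apply/eqP; rewrite -subr_eq0 -RintegralB//; last 2 first.
- by apply: (@integrable_gauss_dominated_mul _ _ _ B).
- by apply: (@integrable_gauss_dominated_mul _ _ _ B).
apply/eqP; apply: (@integral_derivative_eq0 n (fun y => a y * k (x - y)) _ ((M + N) * B) v).
- exact: measurable_fun_mul.
- by apply: measurable_fun_add; [|apply: measurable_fun_opp]; exact: measurable_fun_mul.
- move=> z; have := is_deriveM (dab z) (is_derive_reflect (dkl (x - z))).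
  move=> d; apply: (is_derive_eq d); rewrite /GRing.scale/=; ring.
- move=> z; rewrite normrM mulrAC ler_pM//.
  by apply: (le_trans (aM z)); rewrite ler_wpM2r ?heat_kernel_ge0// lerDl.
- move=> z; apply: (le_trans (ler_normB _ _)); rewrite !normrM.
  rewrite mulrAC mulrDl [leRHS]mulrDl addrC lerD// ler_pM//.
Qed.

End gaussian_domination.

(* A class of functions stable under the operations that the argument performs on [psi].
   Exhibiting one that contains [psi] avoids proving that [psi] itself is smooth. *)
Record test_class (R : realType) n (C : ('rV[R]_n -> R) -> Prop) : Prop := TestClass {
  test_continuous : forall a, C a -> continuous a;
  test_dominated : forall a, C a -> gauss_dominated a;
  test_derivable : forall a i x, C a -> derivable a x (delta_mx 0 i);
  test_pderive : forall a i, C a -> C (pderive i a);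
  test_opp : forall a, C a -> C (fun x => - a x);
  test_add : forall a b, C a -> C b -> C (fun x => a x + b x) }.

Section test_class_theory.
Context {R : realType} (n : nat) (C : ('rV[R]_n -> R) -> Prop) (hC : test_class C).

Lemma test_measurable a : C a -> measurable_fun setT a.
Proof. by move=> Ca; apply: continuous_measurable_rV; exact: test_continuous Ca. Qed.

Lemma test_is_derive a i z : C a -> is_derive z (delta_mx 0 i) a (pderive i a z).
Proof. by move=> Ca; split => //; exact: test_derivable Ca. Qed.

Lemma test_sum (I : Type) (r : seq I) (F : I -> 'rV[R]_n -> R) (a : 'rV[R]_n -> R) : C a ->
  (forall i, C (F i)) -> C (fun x => \sum_(i <- r) F i x).
Proof.
move=> Ca CF; elim: r => [|i r IHr].
  (* The fields of [test_class] do not provide the zero function directly; it is obtained as a +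
     (-a). *)
  have := test_add hC Ca (test_opp hC Ca).
  by under eq_fun do rewrite subrr; under [X in _ -> C X]eq_fun do rewrite big_nil.
by under eq_fun do rewrite big_cons; exact: test_add.
Qed.

Lemma test_laplacian a : C a -> C (laplacian a).
Proof.
by move=> Ca; apply: (test_sum _ Ca) => i; do 2 apply: test_pderive => //.
Qed.

Lemma test_neg_laplacian_pow k a : C a -> C (neg_laplacian_pow k a).
Proof.
move=> Ca; elim: k => [//|k IHk].
by rewrite /neg_laplacian_pow iterS; apply: test_opp => //; exact: test_laplacian.
Qed.

End test_class_theory.

(** * The heat operator and its decay in time *)

Section heat_operator.
Context {R : realType}.
Implicit Types (s t : R).

Lemma powRN_le (r t b : R) : 0 <= b -> 0 < r -> r <= t -> t `^ (- b) <= r `^ (- b).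
Proof.
move=> b0 r0 rt; have t0 := lt_le_trans r0 rt.
rewrite !powRN lef_pV2 ?posrE ?powR_gt0//.
by apply: ge0_ler_powR; rewrite ?nnegrE ?(ltW r0) ?(ltW t0).
Qed.

Definition heat n (s : R) (a : 'rV[R]_n -> R) (x : 'rV[R]_n) : R :=
  \int[lebesgue_rV R n]_y (a y * heat_kernel s (x - y)).

Lemma measurable_heat_integrand n (a : 'rV[R]_n -> R) s x : measurable_fun setT a ->
  measurable_fun setT (fun y => a y * heat_kernel s (x - y)).
Proof.
move=> ma; apply: measurable_fun_mul => //.
by apply: measurable_heat_kernel => //; measurability.
Qed.

Lemma integrable_heat n (a : 'rV[R]_n -> R) s x : 0 < s -> measurable_fun setT a ->
  gauss_dominated a ->
  (lebesgue_rV R n).-integrable setT (EFin \o (fun y => a y * heat_kernel s (x - y))).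
Proof.
move=> s0 ma ad.
apply: (@integrable_gauss_dominated_mul _ _ _ _ ((4 * pi * s) `^ (- (n%:R / 2)))) => //.
  by apply: measurable_heat_kernel => //; measurability.
by move=> y; rewrite ger0_norm ?heat_kernel_ge0//; exact: heat_kernel_le.
Qed.

Lemma heat_convC n (a : 'rV[R]_n -> R) s x : measurable_fun setT a ->
  heat s a x = \int[lebesgue_rV R n]_y (heat_kernel s y * a (x - y)).
Proof.
move=> ma; rewrite /heat /Rintegral; congr fine.
rewrite -[LHS](integral_rV_reflect x).
  by apply: eq_integral => y _; rewrite subKr mulrC.
by apply: measurable_fun_EFin; exact: measurable_heat_integrand.
Qed.

(** The majorant of [a] is itself a heat kernel, so its evolution is explicit: the time 1/4 becomes
    s + 1/4. This is what Gaussian domination is designed for. *)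
Lemma heat_le n (a : 'rV[R]_n -> R) M s x : 0 < s -> measurable_fun setT a ->
  (forall z, `|a z| <= M * heat_kernel 4^-1 z) ->
  `|heat s a x| <= M * heat_kernel (s + 4^-1) x.
Proof.
move=> s0 ma aM; have h4 : 0 < 4^-1 :> R by rewrite invr_gt0.
have iM : (lebesgue_rV R n).-integrable setT
    (EFin \o (fun y => M * (heat_kernel s (x - y) * heat_kernel 4^-1 y))).
  apply: integrable_scale => //; apply: integrable_ge0 => //.
  - apply: measurable_fun_mul; apply: measurable_heat_kernel => //; by measurability.
  - by move=> y _; rewrite mulr_ge0 ?heat_kernel_ge0.
  - by rewrite heat_kernel_conv// ltry.
apply: le_trans (le_abs_Rintegral _ _ _ iM) _ => //.
- exact: measurable_heat_integrand.
- move=> y _; rewrite normrM (ger0_norm (heat_kernel_ge0 _ _)) mulrC.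
  rewrite (mulrCA M (heat_kernel _ _)); apply: ler_wpM2l => //.
  exact: heat_kernel_ge0.
rewrite (Rintegral_EFin (l := M * heat_kernel (s + 4^-1) x))//.
under eq_integral do rewrite EFinM.
rewrite integralZl//; first by rewrite heat_kernel_conv.
apply: integrable_ge0 => //.
- apply: measurable_fun_mul; apply: measurable_heat_kernel => //; by measurability.
- by move=> y _; rewrite mulr_ge0 ?heat_kernel_ge0.
- by rewrite heat_kernel_conv// ltry.
Qed.

(** The time s + 1/4 in [heat_le] stays away from 0, which gives one bound for small and large [s];
    pi >= 2 yields 4 pi (s + 1/4) >= 1 + s. *)
Lemma heat_decay n (a : 'rV[R]_n -> R) : measurable_fun setT a -> gauss_dominated a ->
  exists2 M, 0 <= M & forall s x, 0 < s -> `|heat s a x| <= M * (1 + s) `^ (- (n%:R / 2)).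
Proof.
move=> ma /gauss_dominated_ge0[M M0 aM]; exists M => // s x s0.
apply: (le_trans (heat_le _ s0 ma aM)); rewrite ler_wpM2l//.
have s4 : 0 < s + 4^-1 by rewrite addr_gt0// invr_gt0.
apply: (le_trans (heat_kernel_le _ s4)).
have n2 : 0 <= n%:R / 2 :> R by rewrite divr_ge0.
apply: powRN_le => //; first by rewrite addr_gt0.
have := @pi_ge2 R => p2; nra.
Qed.

(** The time derivative of the heat kernel, equal to its Laplacian in space. *)
Let heat_time n (z : 'rV[R]_n) s : R :=
  (dotp z z / (4 * s ^+ 2) - n%:R / (2 * s)) * heat_kernel s z.

Lemma is_derive_heat_time n (a : 'rV[R]_n -> R) s x : 0 < s -> measurable_fun setT a ->
  gauss_dominated a ->
  is_derive s 1 (fun s => heat s a x)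
    (\int[lebesgue_rV R n]_y (a y * heat_time (x - y) s)).
Proof.
move=> s0 ma ad; have s20 : 0 < s / 2 by rewrite divr_gt0.
(* The bound of [heat_kernel_time_derivative_le] decreases in time, so its value at s/2 serves on
   the whole interval from s/2 to 2 s. *)
pose B := (1 + n%:R / 2) / (s / 2) * (4 * pi * (s / 2)) `^ (- (n%:R / 2)).
pose G y := B * `|a y|.
pose f t y := a y * heat_kernel t (x - y).
have n2 : 0 <= n%:R / 2 :> R by rewrite divr_ge0.
have B0 : 0 <= B.
  by rewrite !mulr_ge0 ?powR_ge0 ?addr_ge0// ?divr_ge0// ?invr_ge0 ?mulr_ge0 ?ltW.
have iG : (lebesgue_rV R n).-integrable setT (EFin \o G).
  apply: integrable_scale => //.
  exact: (integrable_norm (integrable_gauss_dominated ma ad)).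
have tpos t : (`](s / 2), (2 * s)[%classic : set R) t -> 0 < t.
  by rewrite /= in_itv/= => /andP[+ _]; exact: lt_trans.
have dd t y : 0 < t -> is_derive t 1 (f ^~ y) (a y * heat_time (x - y) t).
  by move=> t0; apply: is_derive1_scale; exact: is_derive_heat_kernel_time.
have d1f t y : 0 < t -> partial1of2 f t y = a y * heat_time (x - y) t.
  by move=> t0; rewrite /partial1of2 derive1E; have [_ ->] := dd t y t0.
have H : h^-1 *: ((\int[lebesgue_rV R n]_y f (h + s) y) -
    (\int[lebesgue_rV R n]_y f s y)) @[h --> 0^'] -->
    \int[lebesgue_rV R n]_y partial1of2 f s y.
  apply: (@cvg_differentiation_under_integral R _ _ (lebesgue_rV R n) f setT measurableT
    s (s / 2) (2 * s) _ _ _ G _ iG).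
  - rewrite /= in_itv/=; apply/andP; split; lra.
  - by move=> t /tpos t0; exact: integrable_heat.
  - by move=> t y /tpos t0 _; have [] := dd t y t0.
  - by move=> y; rewrite mulr_ge0.
  - move=> t y ts _; have t0 := tpos _ ts; rewrite d1f// /G normrM mulrC ler_wpM2r//.
    apply: (le_trans (heat_kernel_time_derivative_le _ t0)).
    have st : s / 2 <= t by move: ts; rewrite /= in_itv/= => /andP[/ltW].
    apply: ler_pM; rewrite ?powR_ge0//.
    + by rewrite divr_ge0 ?addr_ge0// ltW.
    + by rewrite ler_wpM2l ?addr_ge0// lef_pV2 ?posrE.
    + apply: powRN_le; rewrite ?fourpi_gt0//.
      by apply: ler_wpM2l => //; rewrite mulr_ge0// pi_ge0.
have e1 : (fun h : R => h^-1 *: ((\int[lebesgue_rV R n]_y f (h + s) y) -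
    (\int[lebesgue_rV R n]_y f s y))) =
    (fun h : R => h^-1 *: ((fun s => heat s a x) (h *: 1 + s) - heat s a x)).
  by apply/funext => h; rewrite /GRing.scale/= mulr1.
have e2 : \int[lebesgue_rV R n]_y partial1of2 f s y =
    \int[lebesgue_rV R n]_y (a y * heat_time (x - y) s).
  by apply: eq_RintegralD => y _; exact: d1f.
rewrite e1 e2 in H.
split; first by apply/cvg_ex; eexists; exact: H.
by apply/cvg_lim => //; exact: H.
Qed.

(** The derivative stays on the kernel, and only the L^1 norm of [a] enters: this gains a factor 1/s
    over the rate s^(-n/2). *)
Lemma heat_time_decay n (a : 'rV[R]_n -> R) : measurable_fun setT a -> gauss_dominated a ->
  exists2 M, 0 <= M & forall s x, 0 < s ->
  `|\int[lebesgue_rV R n]_y (a y * heat_time (x - y) s)| <=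
  M * s `^ (- (n%:R / 2) - 1).
Proof.
move=> ma ad; have ia := integrable_gauss_dominated ma ad.
have n2 : 0 <= n%:R / 2 :> R by rewrite divr_ge0.
pose N := \int[lebesgue_rV R n]_y `|a y|.
have N0 : 0 <= N by apply: Rintegral_ge0.
exists ((1 + n%:R / 2) * N); first by rewrite mulr_ge0// addr_ge0.
move=> s x s0; set B := (1 + n%:R / 2) / s * (4 * pi * s) `^ (- (n%:R / 2)).
have i1 : (lebesgue_rV R n).-integrable setT (EFin \o (fun y => B * `|a y|)).
  by apply: integrable_scale => //; exact: (integrable_norm ia).
apply: le_trans (le_abs_Rintegral _ _ _ i1) _ => //.
- apply: measurable_fun_mul => //; apply: measurable_fun_mul; last first.
    by apply: measurable_heat_kernel => //; measurability.
  by measurability.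
- move=> y _; rewrite normrM mulrC ler_wpM2r//; exact: heat_kernel_time_derivative_le.
rewrite RintegralZl//; last exact: (integrable_norm ia).
rewrite -/N.
have h : s^-1 * (4 * pi * s) `^ (- (n%:R / 2)) <= s `^ (- (n%:R / 2) - 1).
  rewrite powRDp// (powR_inv1 (ltW s0)) mulrC.
  apply: ler_wpM2r; first by rewrite invr_ge0 ltW.
  apply: powRN_le => //.
  have := @pi_ge2 R => p2; nra.
have h1 : 0 <= (1 + n%:R / 2) * N by rewrite mulr_ge0// addr_ge0.
apply: le_trans (ler_wpM2l h1 h); rewrite le_eqVlt; apply/orP; left; apply/eqP.
by rewrite /B; ring.
Qed.

(** By the heat equation the time derivative of the kernel is a sum of second derivatives, and two
    integrations by parts in each coordinate move them onto [a]. *)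
Lemma heat_laplacian n (C : ('rV[R]_n -> R) -> Prop) (hC : test_class C) a s x :
  C a -> 0 < s ->
  \int[lebesgue_rV R n]_y (a y * heat_time (x - y) s) = heat s (laplacian a) x.
Proof.
move=> Ca s0.
pose k1 i (z : 'rV[R]_n) := - (z 0 i / (2 * s)) * heat_kernel s z.
pose k2 i (z : 'rV[R]_n) := (z 0 i ^+ 2 / (4 * s ^+ 2) - (2 * s)^-1) * heat_kernel s z.
pose c := (4 * pi * s) `^ (- (n%:R / 2)).
pose c2 := 8 * s * 2 `^ (n%:R / 2) * (4 * pi * (2 * s)) `^ (- (n%:R / 2)).
have c0 : 0 <= c by exact: powR_ge0.
have c20 : 0 <= c2 by rewrite !mulr_ge0 ?powR_ge0// ltW.
have kb (z : 'rV[R]_n) : `|heat_kernel s z| <= c by rewrite ger0_norm ?heat_kernel_ge0//; exact: heat_kernel_le.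
have dotb (z : 'rV[R]_n) : dotp z z * heat_kernel s z <= c2.
  apply: (le_trans (heat_kernel_moment z s0)).
  apply: ler_wpM2l; first by rewrite !mulr_ge0 ?powR_ge0// ltW.
  by apply: heat_kernel_le; rewrite mulr_gt0.
(* A common bound, at fixed [s], for the kernel and its first and second derivatives: [c] bounds the
   kernel, [c2] bounds |z|^2 times the kernel, and |z_i| <= 1 + z_i^2. *)
pose B := c + (c + c2) / (2 * s) + (c2 / (4 * s ^+ 2) + c / (2 * s)).
have s20 : 0 <= (2 * s)^-1 by rewrite invr_ge0 mulr_ge0// ltW.
have s40 : 0 <= (4 * s ^+ 2)^-1 by rewrite invr_ge0 mulr_ge0// sqr_ge0.
have kB (z : 'rV[R]_n) : `|heat_kernel s z| <= B.
  by apply: (le_trans (kb z)); rewrite /B -addrA lerDl !addr_ge0// mulr_ge0// addr_ge0.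
have k1B i (z : 'rV[R]_n) : `|k1 i z| <= B.
  apply: (@le_trans _ _ ((c + c2) / (2 * s))); last first.
    have h1 : 0 <= c2 / (4 * s ^+ 2) by exact: mulr_ge0.
    have h2 : 0 <= c / (2 * s) by exact: mulr_ge0.
    by rewrite /B; lra.
  rewrite /k1 normrM normrN normrM (ger0_norm s20) (ger0_norm (heat_kernel_ge0 _ _)).
  rewrite (mulrAC `|z 0 i|); apply: ler_wpM2r => //.
  apply: (@le_trans _ _ ((1 + dotp z z) * heat_kernel s z)).
    apply: ler_wpM2r; first exact: heat_kernel_ge0.
    apply: (@le_trans _ _ (1 + z 0 i ^+ 2)); last by rewrite lerD2l sqr_coord_le.
    rewrite -(real_normK (num_real (z 0 i))); have : 0 <= `|z 0 i| by []; nra.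
  by rewrite mulrDl mul1r lerD//; exact: heat_kernel_le.
have k2B i (z : 'rV[R]_n) : `|k2 i z| <= B.
  apply: (@le_trans _ _ (c2 / (4 * s ^+ 2) + c / (2 * s))); last first.
    by rewrite /B lerDr !addr_ge0// mulr_ge0// addr_ge0.
  rewrite /k2 mulrBl; apply: (le_trans (ler_normB _ _)); apply: lerD.
    rewrite (mulrAC (z 0 i ^+ 2)) ger0_norm; last first.
      by apply: mulr_ge0 => //; apply: mulr_ge0; [exact: sqr_ge0|exact: heat_kernel_ge0].
    apply: ler_wpM2r => //; apply: le_trans (dotb z).
    by apply: ler_wpM2r; [exact: heat_kernel_ge0|exact: sqr_coord_le].
  rewrite ger0_norm ?mulr_ge0 ?heat_kernel_ge0// mulrC; apply: ler_wpM2r => //.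
  exact: heat_kernel_le.
have mk0 : measurable_fun setT (@heat_kernel R n s) by exact: measurable_heat_kernel.
have mk1 i : measurable_fun setT (k1 i).
  by apply: measurable_fun_mul => //; measurability.
have mk2 i : measurable_fun setT (k2 i).
  by apply: measurable_fun_mul => //; measurability.
have mx (k : 'rV[R]_n -> R) : measurable_fun setT k ->
    measurable_fun setT (fun y : 'rV[R]_n => k (x - y)).
  by move=> mk; apply: measurableT_comp => //; measurability.
have step i : \int[lebesgue_rV R n]_y (a y * k2 i (x - y)) =
    \int[lebesgue_rV R n]_y (pderive i (pderive i a) y * heat_kernel s (x - y)).
  have Ci := test_pderive hC i Ca; have Cii := test_pderive hC i Ci.
  have [ma mi mii] := And3 (test_measurable hC Ca) (test_measurable hC Ci) (test_measurable hC Cii).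
  have [da di dii] := And3 (test_dominated hC Ca) (test_dominated hC Ci) (test_dominated hC Cii).
  transitivity (\int[lebesgue_rV R n]_y (pderive i a y * k1 i (x - y))).
    apply/esym; apply: (@integration_by_parts_rV _ n a (pderive i a) (k1 i) (k2 i) B x
      (delta_mx 0 i)) => //.
    - by move=> z; exact: (test_is_derive hC).
    - by move=> z; exact: is_derive2_heat_kernel.
  apply/esym; apply: (@integration_by_parts_rV _ n (pderive i a) (pderive i (pderive i a))
    (heat_kernel s) (k1 i) B x (delta_mx 0 i)) => //.
  - by move=> z; exact: (test_is_derive hC).
  - by move=> z; exact: is_derive_heat_kernel.
have [ma da] := (test_measurable hC Ca, test_dominated hC Ca).
transitivity (\int[lebesgue_rV R n]_y (\sum_(i < n) a y * k2 i (x - y))).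
  apply: eq_RintegralD => y _.
  by rewrite -mulr_sumr /k2 sum_second_derivative_heat_kernel.
rewrite Rintegral_bigsum//; last first.
  by move=> i; apply: (@integrable_gauss_dominated_mul _ _ _ _ B) => //; exact: mx.
rewrite /heat /laplacian.
under eq_bigr do rewrite step.
rewrite -Rintegral_bigsum//; last first.
  move=> i; apply: integrable_heat => //.
    by apply: (test_measurable hC); do 2 apply: (test_pderive hC).
  by apply: (test_dominated hC); do 2 apply: (test_pderive hC).
by apply: eq_RintegralD => y _; rewrite mulr_suml.
Qed.

End heat_operator.

Section heat_initial_value.
Context {R : realType}.
Implicit Types (s t : R).

Lemma gauss_dominated_bounded n (a : 'rV[R]_n -> R) : gauss_dominated a ->
  exists2 A, 0 <= A & forall x, `|a x| <= A.
Proof.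
move=> /gauss_dominated_ge0[M M0 aM].
exists (M * (4 * pi * 4^-1) `^ (- (n%:R / 2))); first by rewrite mulr_ge0// powR_ge0.
move=> x; apply: (le_trans (aM x)); apply: ler_wpM2l => //.
by apply: heat_kernel_le; rewrite invr_gt0.
Qed.

Lemma Rintegral_scale_heat_kernel n s (x : 'rV[R]_n) (c : R) : 0 < s ->
  \int[lebesgue_rV R n]_y (c * heat_kernel s (x - y)) = c.
Proof.
move=> s0; rewrite RintegralZl//; last exact: integrable_heat_kernel.
by rewrite (Rintegral_EFin (l := 1)) ?mulr1//; exact: integral_heat_kernel_reflect.
Qed.

(** Continuity at [x] together with boundedness gives |a x - a y| <= e/2 + D |x - y|^2 for all [y],
    the quadratic term taking over outside a ball; the second moment of the kernel is O(s). *)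
Lemma heat_cvg0 n (a : 'rV[R]_n -> R) x : continuous a -> gauss_dominated a ->
  heat s a x @[s --> 0^'+] --> a x.
Proof.
move=> ca ad; have ma := continuous_measurable_rV ca.
have [A A0 aA] := gauss_dominated_bounded ad.
apply/cvgrPdist_le => e e0.
have e20 : 0 < e / 2 by rewrite divr_gt0.
have /cvgrPdist_lt/(_ _ e20)/nbhs_ballP[r /= r0 ar] := ca x.
pose D := 2 * A / r ^+ 2.
have D0 : 0 <= D by rewrite !mulr_ge0// invr_ge0 sqr_ge0.
have aD y : `|a x - a y| <= e / 2 + D * dotp (x - y) (x - y).
  have [rxy|rxy] := ltP (dotp (x - y) (x - y)) (r ^+ 2).
    apply: (@le_trans _ _ (e / 2)); last by rewrite lerDl mulr_ge0// dotp_ge0.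
    (* The neighbourhood is a ball of the sup norm, which contains the Euclidean ball of the same
       radius. *)
    apply/ltW/ar; split => // i j; rewrite (ord1 i) /ball/= /ball_.
    rewrite -(ltr_pXn2r (_ : 0 < 2)%N) ?nnegrE ?(ltW r0)// real_normK ?num_real//.
    by apply: le_lt_trans rxy; have := sqr_coord_le (x - y) j; rewrite !mxE.
  apply: (le_trans (ler_normB _ _)); apply: (@le_trans _ _ (2 * A)).
    by rewrite mulr_natl mulr2n lerD.
  apply: (@le_trans _ _ (D * r ^+ 2)); first by rewrite /D divfK// gt_eqF// exprn_gt0.
  apply: (@le_trans _ _ (D * dotp (x - y) (x - y))); first exact: ler_wpM2l.
  by rewrite lerDr ltW.
pose c := 8 * 2 `^ (n%:R / 2) * D.
have c0 : 0 <= c by rewrite mulr_ge0// mulr_ge0// powR_ge0.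
have main s : 0 < s -> `|a x - heat s a x| <= e / 2 + c * s.
  move=> s0; have s20 : 0 < 2 * s by rewrite mulr_gt0.
  have i1 := integrable_heat_kernel x s0.
  have i2 := integrable_heat_kernel x s20.
  have -> : a x - heat s a x =
      \int[lebesgue_rV R n]_y ((a x - a y) * heat_kernel s (x - y)).
    under eq_Rintegral do rewrite mulrBl.
    rewrite RintegralB//; last 2 first.
      exact: integrable_scale.
      exact: integrable_heat.
    by rewrite Rintegral_scale_heat_kernel.
  have ib : (lebesgue_rV R n).-integrable setT (EFin \o (fun y =>
     e / 2 * heat_kernel s (x - y) + c * s * heat_kernel (2 * s) (x - y))).
    by apply: integrable_add => //; exact: integrable_scale.
  apply: le_trans (le_abs_Rintegral _ _ _ ib) _ => //.
  - apply: measurable_fun_mul; last first.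
      by apply: measurable_heat_kernel => //; measurability.
    by apply: measurable_fun_add => //; exact: measurable_fun_opp.
  - move=> y _; rewrite normrM (ger0_norm (heat_kernel_ge0 _ _)).
    apply: (@le_trans _ _ ((e / 2 + D * dotp (x - y) (x - y)) * heat_kernel s (x - y))).
      by apply: ler_wpM2r => //; exact: heat_kernel_ge0.
    rewrite mulrDl lerD2l -[leLHS]mulrA.
    apply: le_trans (ler_wpM2l D0 (heat_kernel_moment (x - y) s0)) _.
    by rewrite le_eqVlt; apply/orP; left; apply/eqP; rewrite /c; ring.
  - rewrite RintegralD//; [|exact: integrable_scale|exact: integrable_scale].
    by rewrite !Rintegral_scale_heat_kernel.
near=> s; have s0 : 0 < s by near: s; exact: nbhs_right_gt.
apply: (le_trans (main _ s0)).
have sc : s <= e / 2 / (c + 1).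
  by near: s; apply: nbhs_right_le; rewrite divr_gt0// ltr_wpDl.
have c10 : 0 < c + 1 by rewrite ltr_wpDl.
have : c * s <= e / 2.
  apply: (@le_trans _ _ ((c + 1) * s)); first by rewrite mulrDl mul1r lerDl ltW.
  by rewrite mulrC -ler_pdivlMr.
lra.
Unshelve. all: by end_near. Qed.

End heat_initial_value.

(** * Riesz potentials *)

Section half_line_integration_by_parts.
Context {R : realType}.
Notation mu := (@lebesgue_measure R).
Implicit Types (v w : R -> R) (b c s : R).

(** A Beta integral with parameters [b] and c - b. *)
Lemma integral_powR_decay b c : 0 < b -> b < c ->
  mu.-integrable pos (EFin \o (fun s => s `^ (b - 1) * (1 + s) `^ (- c))).
Proof.
move=> b0 bc; apply: integrable_ge0.
- exact: measurable_pos.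
- apply: measurable_funTS; by measurability.
- by move=> s _; rewrite mulr_ge0 ?powR_ge0.
- have e : b + (c - b) = c by ring.
  have := @integral_beta R b (c - b) b0; rewrite subr_gt0 e => -> //.
  exact: ltry.
Qed.

Lemma integrable_powR_decay v M b c : {in pos, continuous v} ->
  (forall s, 0 < s -> `|v s| <= M * (1 + s) `^ (- c)) -> 0 < b -> b < c ->
  mu.-integrable pos (EFin \o (fun s => s `^ (b - 1) * v s)).
Proof.
move=> cv vM b0 bc.
have i1 : mu.-integrable pos (EFin \o (fun s => M * (s `^ (b - 1) * (1 + s) `^ (- c)))).
  by apply: integrable_scale; [exact: measurable_pos|exact: integral_powR_decay].
apply: (integrable_le _ _ _ i1); first exact: measurable_pos.
- apply: measurable_fun_mul; last exact: measurable_fun_pos.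
  by apply: measurable_funTS; measurability.
- move=> s /posP s0; rewrite normrM ger0_norm ?powR_ge0// mulrCA.
  by apply: ler_wpM2l; [exact: powR_ge0|exact: vM].
Qed.

Lemma cvgy_powR_decay v M b c : 0 <= b -> b < c ->
  (forall s, 0 < s -> `|v s| <= M * (1 + s) `^ (- c)) ->
  s `^ b * v s @[s --> +oo] --> (0 : R).
Proof.
move=> b0 bc vM; apply: norm_cvg0.
have h : M * (1 + s) `^ (b - c) @[s --> +oo] --> (0 : R).
  rewrite -[X in _ --> X](mulr0 M); apply: cvgM; first exact: cvg_cst.
  have h1 : (1 + s)^-1 @[s --> +oo] --> (0 : R)^'+.
    have h2 : s^-1 @[s --> +oo] --> (0 : R)^'+.
      move=> P [r /= r0 rP]; suff : \forall s \near pinfty_nbhs R, P s^-1 by [].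
      near=> s; have s0 : 0 < s by near: s; apply: nbhs_pinfty_gt; exact: num_real.
      apply: rP; rewrite /= ?sub0r ?normrN ?ger0_norm ?invr_ge0 ?ltW ?invr_gt0//.
      rewrite invf_plt ?posrE//; near: s; apply: nbhs_pinfty_gt; exact: num_real.
    by apply: (cvg_comp _ _ _ h2); exact: cvg_addrl.
  have cb : 0 < c - b by rewrite subr_gt0.
  have := cvg_comp _ _ h1 (powR_cvg0 cb).
  apply: cvg_trans; apply: near_eq_cvg; near=> s.
  have s10 : 0 < 1 + s by rewrite addr_gt0//; near: s; exact: nbhs_pinfty_gt.
  by rewrite /= -(powR_inv1 (ltW s10)) -powRrM; congr powR; ring.
apply: (@squeeze_cvgr _ _ _ _ (cst 0) _ _ _ _ (cvg_cst _) h).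
near=> s; have s0 : 0 < s by near: s; exact: nbhs_pinfty_gt.
rewrite /= normr_ge0/= normrM ger0_norm ?powR_ge0//.
apply: (@le_trans _ _ (s `^ b * (M * (1 + s) `^ (- c)))).
  by apply: ler_wpM2l; [exact: powR_ge0|exact: vM].
have s10 : 0 < 1 + s by rewrite addr_gt0.
rewrite mulrCA powRDp//.
have M0 : 0 <= M.
  by rewrite -(pmulr_lge0 _ (powR_gt0 (- c) s10)); exact: le_trans (vM _ s0).
apply: ler_wpM2l => //; apply: ler_wpM2r; first exact: powR_ge0.
by apply: ge0_ler_powR; rewrite ?nnegrE ?(ltW s0) ?(ltW s10)// lerDr.
Unshelve. all: by end_near. Qed.

(** The boundary term s^b v(s) vanishes at 0 because b > 0 and at infinity because b < c; the
    condition b + 1 < c' makes s^b w(s) integrable. *)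
Lemma integral_pos_by_parts v w M N b c c' : 0 < b -> b < c -> b + 1 < c' ->
  (forall s, 0 < s -> is_derive s 1 v (w s)) -> {in pos, continuous w} ->
  (forall s, 0 < s -> `|v s| <= M * (1 + s) `^ (- c)) ->
  (forall s, 0 < s -> `|w s| <= N * (1 + s) `^ (- c')) ->
  \int[mu]_(s in pos) (s `^ b * - w s) = b * \int[mu]_(s in pos) (s `^ (b - 1) * v s).
Proof.
move=> b0 bc bc' dv cw vM wN.
have cv : {in pos, continuous v}.
  by move=> s /[!inE]/posP s0; exact: is_derive_continuous (dv _ s0).
have b10 : 0 < b + 1 by rewrite addr_gt0.
have iv := integrable_powR_decay cv vM b0 bc.
have iw := integrable_powR_decay cw wN b10 bc'.
rewrite addrK in iw.
have d s : 0 < s -> is_derive s 1 (fun s => s `^ b * v s)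
    (s `^ b * w s + b * (s `^ (b - 1) * v s)).
  move=> s0; apply: (is_derive_eq (is_derive1_mul (is_derive1_powR b s0) (dv _ s0))).
  ring.
have ibv : mu.-integrable pos (EFin \o (fun s => b * (s `^ (b - 1) * v s))).
  by apply: integrable_scale => //; exact: measurable_pos.
have := @integral_pos_FTC R _ _ 0 0 d.
rewrite subrr RintegralD//; last exact: measurable_pos.
rewrite (RintegralZl _ measurable_pos iv) => H.
have {}H : \int[mu]_(s in pos) (s `^ b * w s) +
    b * \int[mu]_(s in pos) (s `^ (b - 1) * v s) = 0.
  apply: H.
  - move=> s s0; have s0' : 0 < s by move: s0; rewrite inE => /posP.
    apply: cvgD; apply: cvgM.
    + exact: (is_derive_continuous (is_derive1_powR _ s0')).
    + exact: cw.
    + exact: cvg_cst.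
    + apply: cvgM; last exact: cv.
      exact: (is_derive_continuous (is_derive1_powR _ s0')).
  - by apply: integrable_add => //; exact: measurable_pos.
  - apply: norm_cvg0.
    have h : s `^ b * `|M| @[s --> 0^'+] --> (0 : R).
      rewrite -[X in _ --> X](mul0r `|M|); apply: cvgM; last exact: cvg_cst.
      exact: powR_cvg0.
    apply: (@squeeze_cvgr _ _ _ _ (cst 0) _ _ _ _ (cvg_cst _) h).
    near=> s; have s0 : 0 < s by near: s; exact: nbhs_right_gt.
    rewrite /= normr_ge0/= normrM ger0_norm ?powR_ge0//.
    apply: ler_wpM2l; first exact: powR_ge0.
    apply: (le_trans (vM _ s0)); apply: (@le_trans _ _ (`|M| * (1 + s) `^ (- c))).
      by apply: ler_wpM2r; [exact: powR_ge0|exact: ler_norm].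
    rewrite ler_piMr//; have := @powRN_le R 1 (1 + s) c.
    have c0 := lt_trans b0 bc; move=> /(_ (ltW c0) ltr01) H.
    by apply: le_trans (H _) _; [rewrite lerDl ltW|rewrite powR1].
  - by apply: (cvgy_powR_decay (ltW b0) bc vM).
rewrite (_ : \int[mu]_(s in pos) (s `^ b * - w s) = - \int[mu]_(s in pos) (s `^ b * w s)).
  by apply/eqP; rewrite eq_sym -subr_eq0 opprK addrC H.
rewrite -mulN1r -RintegralZl//; last exact: measurable_pos.
by apply: eq_RintegralD => s _; ring.
Unshelve. all: by end_near. Qed.

(** The limit case b = 0 of the integration by parts, where the boundary term at 0 survives: it
    reproduces psi at the end of the descent. *)
Lemma integral_pos_derivative v w M N c c' l : 0 < c -> 1 < c' ->
  (forall s, 0 < s -> is_derive s 1 v (w s)) -> {in pos, continuous w} ->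
  (forall s, 0 < s -> `|v s| <= M * (1 + s) `^ (- c)) ->
  (forall s, 0 < s -> `|w s| <= N * (1 + s) `^ (- c')) ->
  v s @[s --> 0^'+] --> l ->
  \int[mu]_(s in pos) (- w s) = l.
Proof.
move=> c0 c1 dv cw vM wN v00.
have iw : mu.-integrable pos (EFin \o w).
  have := integrable_powR_decay cw wN ltr01 c1.
  rewrite subrr; under [X in _.-integrable _ X -> _]eq_fun do rewrite /= powRr0 mul1r.
  by [].
have d s : 0 < s -> is_derive s 1 (fun s => - v s) (- w s).
  by move=> s0; apply: is_derive1_opp; exact: dv.
rewrite (@integral_pos_FTC R _ _ (- l) 0 d).
- by rewrite sub0r opprK.
- by move=> s s0; apply: cvgN; exact: cw.
- have := integrable_scale (-1) measurable_pos iw.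
  by under [X in _.-integrable _ X -> _]eq_fun do rewrite /= mulN1r.
- exact: cvgN.
- have := cvgy_powR_decay (lexx 0) c0 vM.
  under eq_fun do rewrite powRr0 mul1r.
  by move=> h; rewrite -oppr0; apply: cvgN.
Qed.

End half_line_integration_by_parts.

Section test_heat.
Context {R : realType} (n : nat) (C : ('rV[R]_n -> R) -> Prop) (hC : test_class C).
Notation mu := (@lebesgue_measure R).
Implicit Types (a : 'rV[R]_n -> R) (s b : R).

Lemma is_derive_heat a s x : C a -> 0 < s ->
  is_derive s 1 (fun s => heat s a x) (heat s (laplacian a) x).
Proof.
move=> Ca s0; have := is_derive_heat_time x s0 (test_measurable hC Ca) (test_dominated hC Ca).
by rewrite (heat_laplacian hC).
Qed.

Lemma continuous_heat a x : C a -> {in pos, continuous (fun s => heat s a x)}.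
Proof.
by move=> Ca s /[!inE]/posP s0; exact: is_derive_continuous (is_derive_heat x Ca s0).
Qed.

Lemma heat_laplacian_decay a : C a -> exists2 M, 0 <= M & forall s x, 0 < s ->
  `|heat s (laplacian a) x| <= M * s `^ (- (n%:R / 2) - 1).
Proof.
move=> Ca; have [M M0 h] := heat_time_decay (test_measurable hC Ca) (test_dominated hC Ca).
by exists M => // s x s0; rewrite -(heat_laplacian hC)//; exact: h.
Qed.

Lemma heat_opp a s x : measurable_fun setT a -> gauss_dominated a -> 0 < s ->
  heat s (fun x => - a x) x = - heat s a x.
Proof.
move=> ma ad s0; rewrite /heat -mulN1r -RintegralZl//; last exact: integrable_heat.
by apply: eq_RintegralD => y _; ring.
Qed.

(* Unnormalized: the Riesz potential of order [2 * b] is [riesz b a / Gamma b]. *)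
Definition riesz b a x : R := \int[mu]_(s in pos) (s `^ (b - 1) * heat s a x).

Let heat_neg_laplacian a s x : C a -> 0 < s ->
  heat s (fun x => - laplacian a x) x = - heat s (laplacian a) x.
Proof.
move=> Ca s0; have Cl := test_laplacian hC Ca.
by apply: heat_opp => //; [exact: (test_measurable hC)|exact: (test_dominated hC)].
Qed.

(** The heat equation turns -Delta into -d/ds, and the integration by parts lowers the exponent. The
    rate n/2 of [heat_decay] serves for [a] and for its Laplacian, whence b + 1 < n/2. *)
Lemma riesz_step a b x : C a -> 0 < b -> b + 1 < n%:R / 2 ->
  riesz (b + 1) (fun x => - laplacian a x) x = b * riesz b a x.
Proof.
move=> Ca b0 bn; have Cl := test_laplacian hC Ca.
have [M M0 hM] := heat_decay (test_measurable hC Ca) (test_dominated hC Ca).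
have [N N0 hN] := heat_decay (test_measurable hC Cl) (test_dominated hC Cl).
apply: etrans; last first.
  apply: (@integral_pos_by_parts R (fun s => heat s a x)
    (fun s => heat s (laplacian a) x) M N b (n%:R / 2) (n%:R / 2)) => //.
- by apply: lt_trans bn; rewrite ltrDl.
- by move=> s s0; exact: is_derive_heat.
- exact: continuous_heat.
- by move=> s s0; exact: hM.
- by move=> s s0; exact: hN.
- by apply: eq_RintegralD => s /posP s0; rewrite addrK heat_neg_laplacian.
Qed.

(** At exponent 1 the weight s^0 is constant, so the integral of -d/ds P_s a is the initial value
    given by [heat_cvg0]. *)
Lemma riesz1 a x : C a -> 1 < n%:R / 2 :> R ->
  riesz 1 (fun x => - laplacian a x) x = a x.
Proof.
move=> Ca n1; have Cl := test_laplacian hC Ca.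
have [M M0 hM] := heat_decay (test_measurable hC Ca) (test_dominated hC Ca).
have [N N0 hN] := heat_decay (test_measurable hC Cl) (test_dominated hC Cl).
apply: etrans; last first.
  apply: (@integral_pos_derivative R (fun s => heat s a x)
    (fun s => heat s (laplacian a) x) M N (n%:R / 2) (n%:R / 2) (a x)) => //.
- exact: lt_trans n1.
- by move=> s s0; exact: is_derive_heat.
- exact: continuous_heat.
- by move=> s s0; exact: hM.
- by move=> s s0; exact: hN.
- by apply: heat_cvg0; [exact: (test_continuous hC)|exact: (test_dominated hC)].
- apply: eq_RintegralD => s /posP s0.
  by rewrite subrr powRr0 mul1r heat_neg_laplacian.
Qed.

(** The factors b, b + 1, ..., b + k - 1 produced by [riesz_step] multiply to Gamma(b + k) /
    Gamma(b). After normalization, k powers of -Delta lower the order of the Riesz potential by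
    2k. *)
Lemma riesz_neg_laplacian_pow k a b x : C a -> 0 < b -> b + k%:R < n%:R / 2 ->
  riesz (b + k%:R) (neg_laplacian_pow k a) x * Gamma b =
  riesz b a x * Gamma (b + k%:R).
Proof.
move=> Ca b0; elim: k => [|k IHk] bn; first by rewrite addr0.
have bk : b + k%:R < n%:R / 2 by apply: lt_trans bn; rewrite ltrD2l ltr_nat.
have bk0 : 0 < b + k%:R by rewrite ltr_wpDr.
have -> : b + k.+1%:R = (b + k%:R) + 1 by rewrite -natr1 addrA.
rewrite -natr1 addrA in bn.
rewrite GammaS// (riesz_step x (test_neg_laplacian_pow hC k Ca) bk0 bn).
by rewrite -mulrA IHk//; ring.
Qed.

End test_heat.

Lemma integrable_heatC (R : realType) n (a : 'rV[R]_n -> R) s x : 0 < s -> measurable_fun setT a ->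
  gauss_dominated a ->
  (lebesgue_rV R n).-integrable setT (EFin \o (fun y => heat_kernel s y * a (x - y))).
Proof.
move=> s0 ma /gauss_dominated_bounded[A A0 aA].
have i1 := integrable_scale A measurableT (@integrable_heat_kernel0 R n s s0).
apply: (integrable_le _ _ _ i1) => //.
  apply: measurable_fun_mul; first by apply: measurable_heat_kernel; measurability.
  by apply: measurableT_comp => //; measurability.
move=> y _; rewrite normrM ger0_norm ?heat_kernel_ge0// [leRHS]mulrC.
by apply: ler_wpM2l => //; exact: heat_kernel_ge0.
Qed.

(* Common pattern of the two kernels [q y = (enorm y)^-1] and [q y = half_kernel y]:
   both are mixtures of heat kernels, hence so are the convolutions with them. *)
Section subordination.
Context {R : realType} (m : nat).
Notation n := m.+1.
Notation mu := (@lebesgue_measure R).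
Implicit Types (b : 'rV[R]_n -> R) (y : 'rV[R]_n).

Variables (e kappa : R) (q : 'rV[R]_n -> R).
Hypothesis kappa_gt0 : 0 < kappa.
Hypothesis q_ge0 : forall y, 0 <= q y.
Hypothesis mq : measurable_fun setT q.
Hypothesis integral_q : forall y, y != 0 ->
  (\int[mu]_(s in pos) (s `^ e * heat_kernel s y)%:E = (kappa * q y)%:E)%E.

(** Tonelli. The formula [integral_q] is only given off the origin, which is negligible. *)
Lemma ge0_subordination b : measurable_fun setT b -> (forall y, 0 <= b y) ->
  (kappa%:E * \int[lebesgue_rV R n]_y (q y * b y)%:E =
   \int[mu]_(s in pos) ((s `^ e)%:E *
     \int[lebesgue_rV R n]_y (heat_kernel s y * b y)%:E))%E.
Proof.
move=> mb b0.
have mF : measurable_fun setT (fun p : 'rV[R]_n * measurableTypeR R =>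
    (p.2 `^ e * heat_kernel p.2 p.1 * b p.1)%:E).
  apply: measurable_fun_EFin; apply: measurable_fun_mul; last exact: measurableT_comp.
  apply: measurable_fun_mul; first by measurability.
  by apply: measurable_heat_kernel; measurability.
transitivity (\int[lebesgue_rV R n]_y \int[mu]_(s in pos)
    (s `^ e * heat_kernel s y * b y)%:E)%E.
  rewrite -ge0_integralZl_EFin ?(ltW kappa_gt0)//.
  - apply: ge0_ae_eq_integral => //.
    + apply: emeasurable_funM => //; apply: measurable_fun_EFin.
      exact: measurable_fun_mul.
    + by apply: (@measurable_fun_integral_on _ _ _ (measurableTypeR R) R mu _ measurable_pos
        (fun y s => (s `^ e * heat_kernel s y * b y)%:E)) => // y s _;
        rewrite lee_fin !mulr_ge0 ?powR_ge0 ?heat_kernel_ge0.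
    + by move=> y _; rewrite -EFinM lee_fin !mulr_ge0 ?(ltW kappa_gt0).
    + by move=> y _; apply: integral_ge0 => s _; rewrite lee_fin !mulr_ge0 ?powR_ge0 ?heat_kernel_ge0.
    + apply: filterS (@ae_rV_neq0 R m) => y y0 _.
      under [in RHS]eq_integral do rewrite mulrC EFinM.
      rewrite ge0_integralZl_EFin//.
      * by rewrite integral_q// -!EFinM; congr EFin; ring.
      * exact: measurable_pos.
      * by move=> s _; rewrite lee_fin mulr_ge0 ?powR_ge0 ?heat_kernel_ge0.
      * apply: measurable_funTS; apply: measurable_fun_EFin; apply: measurable_fun_mul.
          by measurability.
        by apply: measurable_heat_kernel; measurability.
  - by move=> y _; rewrite lee_fin mulr_ge0.
  - by apply: measurable_fun_EFin; apply: measurable_fun_mul => //; measurability.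
rewrite (@tonelli_on _ _ _ (measurableTypeR R) R (lebesgue_rV R n) mu setT pos measurableT
  measurable_pos (fun y s => (s `^ e * heat_kernel s y * b y)%:E))//; last first.
  by move=> y s _ _; rewrite lee_fin !mulr_ge0 ?powR_ge0 ?heat_kernel_ge0.
apply: eq_ge0_integral => s _.
under eq_integral do rewrite -mulrA EFinM.
rewrite ge0_integralZl_EFin ?powR_ge0//.
- by move=> y _; rewrite lee_fin mulr_ge0 ?heat_kernel_ge0.
- apply: measurable_fun_EFin; apply: measurable_fun_mul => //.
  exact: measurable_heat_kernel.
Qed.

(** The origin is removed from the domain so that [integral_q] holds at every remaining point. The
    absolute double integral required by Fubini equals that of kappa q |b|, hence is finite. *)
Lemma subordination b : measurable_fun setT b ->
  (forall s, 0 < s -> (lebesgue_rV R n).-integrable setT (EFin \o (fun y => heat_kernel s y * b y))) ->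
  (lebesgue_rV R n).-integrable setT (EFin \o (fun y => q y * b y)) ->
  \int[mu]_(s in pos) (s `^ e * \int[lebesgue_rV R n]_y (heat_kernel s y * b y)) =
  kappa * \int[lebesgue_rV R n]_y (q y * b y).
Proof.
move=> mb ihb iqb; pose D := ~` [set 0 : 'rV[R]_n].
have mD : measurable D by apply: measurableC; exact: measurable_rV0.
have delD (c : 'rV[R]_n -> R) : (lebesgue_rV R n).-integrable setT (EFin \o c) ->
    \int[lebesgue_rV R n]_y c y = \int[lebesgue_rV R n]_(y in D) c y.
  move=> ib; rewrite /Rintegral; congr fine.
  rewrite (negligible_integral (@measurable_rV0 R n) measurableT ib (@lebesgue_rV_set0 R m)).
  by rewrite /D setTD.
pose f y s := s `^ e * (heat_kernel s y * b y).
have mf : measurable_fun setT (fun p : 'rV[R]_n * measurableTypeR R => f p.1 p.2).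
  apply: measurable_fun_mul; first by measurability.
  apply: measurable_fun_mul; first by apply: measurable_heat_kernel; measurability.
  exact: measurableT_comp mb _.
have ihk y : D y -> mu.-integrable pos (EFin \o (fun s => s `^ e * heat_kernel s y)).
  move=> /eqP y0; apply: integrable_ge0; first exact: measurable_pos.
  - apply: measurable_funTS; apply: measurable_fun_mul; first by measurability.
    by apply: measurable_heat_kernel; measurability.
  - by move=> s _; rewrite mulr_ge0 ?powR_ge0 ?heat_kernel_ge0.
  - by rewrite integral_q// ltry.
have int_f c y : D y -> \int[mu]_(s in pos) (s `^ e * (heat_kernel s y * c)) =
    kappa * (q y * c).
  move=> Dy; transitivity (\int[mu]_(s in pos) (c * (s `^ e * heat_kernel s y))).
    by apply: eq_RintegralD => s _; ring.
  rewrite RintegralZl//; last exact: ihk.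
    rewrite (Rintegral_EFin (integral_q _)); first by ring.
    exact/eqP.
  exact: measurable_pos.
have iq : (lebesgue_rV R n).-integrable setT
    (EFin \o (fun y => kappa * (q y * b y))).
  by apply: integrable_scale.
transitivity (\int[mu]_(s in pos) \int[lebesgue_rV R n]_(y in D) f y s).
  apply: eq_RintegralD => s /posP s0; rewrite -RintegralZl//; last exact: ihb.
  by apply: delD; apply: integrable_scale => //; exact: ihb.
rewrite -(@fubini_on _ _ _ (measurableTypeR R) R (lebesgue_rV R n) mu D pos mD measurable_pos f mf); last first.
  rewrite (@eq_ge0_integral _ _ _ _ D _ (fun y => (`|kappa * (q y * b y)|)%:E)).
    have := integrable_norm iq => /(integrableS measurableT mD (@subsetT _ _)).
    by move/(integral_EFin_Rintegral mD) => ->; exact: ltry.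
  move=> y Dy; transitivity (\int[mu]_(s in pos)
      (s `^ e * (heat_kernel s y * `|b y|))%:E)%E.
    apply: eq_ge0_integral => s _; congr EFin.
    by rewrite /f 2!normrM (ger0_norm (powR_ge0 _ _)) (ger0_norm (heat_kernel_ge0 _ _)).
  rewrite integral_EFin_Rintegral.
  - rewrite int_f// !normrM (ger0_norm (ltW kappa_gt0)) ger0_norm//.
  - exact: measurable_pos.
  - have := integrable_scale `|b y| measurable_pos (ihk y Dy).
    rewrite (_ : (fun s => _ * (heat_kernel s y * _)) = fun s =>
      `|b y| * (s `^ e * heat_kernel s y))//.
    by apply/funext => s; ring.
transitivity (\int[lebesgue_rV R n]_y (kappa * (q y * b y))); last first.
  by rewrite RintegralZl.
rewrite delD//; apply: eq_RintegralD => y Dy; exact: int_f.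
Qed.

End subordination.

(** * Convolution with the inverse distance *)

Section newton_potential.
Context {R : realType} (m : nat) (m0 : (0 < m)%N).
Notation n := m.+1.
Notation mu := (@lebesgue_measure R).
Implicit Types (a b : 'rV[R]_n -> R) (x y : 'rV[R]_n).

Let kappa : R := (4 * pi) `^ (- (m%:R / 2)).

Let kappa_gt0 : 0 < kappa.
Proof. by rewrite powR_gt0// mulr_gt0// pi_gt0. Qed.

(** The exponents add up to m/2 - 1 - n/2 = -3/2, so this is [integral_inv_GammaE] at b = 1/2;
    Gamma(1/2) = sqrt pi completes the power of 4 pi. *)
Lemma integral_heat_kernel_time y : y != 0 ->
  (\int[mu]_(s in pos) (s `^ (m%:R / 2 - 1) * heat_kernel s y)%:E =
   (kappa * (enorm y)^-1)%:E)%E.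
Proof.
move=> y0; have d0 : 0 < dotp y y / 4 by rewrite divr_gt0// dotp_gt0.
have h0 : 0 < 2^-1 :> R by rewrite invr_gt0.
pose c := (4 * pi) `^ (- (n%:R / 2)) : R.
transitivity (\int[mu]_(s in pos) (c%:E * (s `^ (- 2^-1 - 1) * expR (- (dotp y y / 4 / s)))%:E))%E.
  apply: eq_ge0_integral => s /posP s0; rewrite -EFinM; congr EFin.
  rewrite /heat_kernel powRM ?(ltW s0) ?mulr_ge0 ?pi_ge0// -/c.
  have -> : - 2^-1 - 1 = (m%:R / 2 - 1) - n%:R / 2 :> R by rewrite -natr1; field.
  rewrite [s `^ (_ - n%:R / 2)]powRDp//.
  have -> : dotp y y / 4 / s = dotp y y / (4 * s) by field; rewrite gt_eqF.
  ring.
rewrite ge0_integralZl_EFin ?powR_ge0//.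
- rewrite integral_inv_GammaE// Gamma_half -EFinM; congr EFin.
  have -> : (dotp y y / 4) `^ (- 2^-1) = 2 / enorm y.
    have -> : dotp y y / 4 = (enorm y / 2) ^+ 2 by rewrite exprMn enorm_sqr; field.
    rewrite powR_sqrV ?invf_div// divr_gt0// enorm_gt0//.
  have -> : c = kappa * (4 * pi) `^ (- 2^-1).
    rewrite /kappa -powRDp ?mulr_gt0 ?pi_gt0//; congr powR.
    by rewrite -natr1; field.
  have -> : 4 * pi = (2 * Num.sqrt pi) ^+ 2 :> R by rewrite exprMn sqr_sqrtr ?pi_ge0//; ring.
  have s0 : 0 < Num.sqrt (pi : R) by rewrite sqrtr_gt0 pi_gt0.
  rewrite powR_sqrV ?mulr_gt0//; field.
  by rewrite !gt_eqF// enorm_gt0.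
- exact: measurable_pos.
- by move=> s _; rewrite lee_fin mulr_ge0 ?powR_ge0 ?expR_ge0.
- by apply: measurable_funTS; measurability.
Qed.

Let m2 : 0 < m%:R / 2 :> R.
Proof. by rewrite divr_gt0// ltr0n. Qed.

Let mn2 : m%:R / 2 < n%:R / 2 :> R.
Proof. by rewrite ltr_pM2r ?invr_gt0// ltr_nat. Qed.

Lemma integrable_shifted_heat_kernel u x : 0 < u ->
  mu.-integrable pos (EFin \o (fun s => s `^ (m%:R / 2 - 1) * heat_kernel (u + s) x)).
Proof.
(* Chosen so that c (1 + s) <= u + s, which compares the kernel at time u + s with a Beta
   integrand. *)
move=> u0; pose c := Num.min 1 u.
have c0 : 0 < c by rewrite lt_min ltr01.
have ig : mu.-integrable pos (EFin \o (fun s => c `^ (- (n%:R / 2)) *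
    (s `^ (m%:R / 2 - 1) * (1 + s) `^ (- (n%:R / 2))))).
  apply: integrable_scale; first exact: measurable_pos.
  exact: integral_powR_decay.
apply: (integrable_le _ _ _ ig).
- exact: measurable_pos.
- apply: measurable_funTS; apply: measurable_fun_mul; first by measurability.
  by apply: measurable_heat_kernel; measurability.
- move=> s /posP s0; rewrite ger0_norm ?mulr_ge0 ?powR_ge0 ?heat_kernel_ge0//.
  rewrite [leRHS]mulrCA; apply: ler_wpM2l; first exact: powR_ge0.
  apply: (le_trans (heat_kernel_le _ _)); first exact: addr_gt0.
  rewrite -powRM ?(ltW c0) ?addr_ge0 ?(ltW s0)//.
  apply: powRN_le; rewrite ?divr_ge0// ?mulr_gt0 ?addr_gt0//.
  have c1 : c <= 1 by rewrite ge_min lexx.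
  have cu : c <= u by rewrite ge_min lexx orbT.
  apply: (@le_trans _ _ (u + s)); first by nra.
  by rewrite ler_peMl ?addr_ge0 ?(ltW s0) ?(ltW u0)//; have := @pi_ge2 R; lra.
Qed.

(** By subordination and the convolution formula, the integral is up to a constant the time integral
    of s^(m/2-1) p_(u+s)(x), which converges. No estimate near the singularity is made. *)
Lemma integral_newton_heat_kernel u x : 0 < u ->
  (\int[lebesgue_rV R n]_y ((enorm y)^-1 * heat_kernel u (x - y))%:E < +oo)%E.
Proof.
move=> u0.
have mh : measurable_fun setT (fun y => heat_kernel u (x - y)).
  by apply: measurable_heat_kernel => //; measurability.
have h0 y : 0 <= heat_kernel u (x - y) by exact: heat_kernel_ge0.
have q0 (y : 'rV[R]_n) : 0 <= (enorm y)^-1 by rewrite invr_ge0 enorm_ge0.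
have mq : measurable_fun setT (fun y : 'rV[R]_n => (enorm y)^-1) by measurability.
have := ge0_subordination kappa_gt0 q0 mq integral_heat_kernel_time mh h0.
have -> : (\int[mu]_(s in pos) ((s `^ (m%:R / 2 - 1))%:E *
     \int[lebesgue_rV R n]_y (heat_kernel s y * heat_kernel u (x - y))%:E) =
   \int[mu]_(s in pos) (s `^ (m%:R / 2 - 1) * heat_kernel (u + s) x)%:E)%E.
  apply: eq_ge0_integral => s /posP s0; rewrite EFinM; congr (_ * _)%E.
  by rewrite -heat_kernel_conv//; apply: eq_integral => y _; rewrite mulrC.
have fin : (\int[mu]_(s in pos) (s `^ (m%:R / 2 - 1) * heat_kernel (u + s) x)%:E < +oo)%E.
  have := integrable_shifted_heat_kernel x u0.
  by move/(integral_EFin_Rintegral measurable_pos) => ->; exact: ltry.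
move=> E; have {}E : (kappa%:E * \int[lebesgue_rV R n]_y
    ((enorm y)^-1 * heat_kernel u (x - y))%:E < +oo)%E by rewrite E.
apply: contraLR E; rewrite -!leNgt !leye_eq => /eqP ->.
by rewrite gt0_muley// lte_fin.
Qed.

Lemma integrable_newton_heat_kernel u x : 0 < u ->
  (lebesgue_rV R n).-integrable setT
    (EFin \o (fun y => (enorm y)^-1 * heat_kernel u (x - y))).
Proof.
move=> u0; apply: integrable_ge0 => //.
- apply: measurable_fun_mul; first by measurability.
  by apply: measurable_heat_kernel => //; measurability.
- by move=> y _; rewrite mulr_ge0 ?heat_kernel_ge0// invr_ge0 enorm_ge0.
- exact: integral_newton_heat_kernel.
Qed.

(** Convolution with |y|^-1, the Riesz kernel of order n - 1 = m; it is Newton's kernel only in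
    dimension 3. *)
Definition newton a x : R := \int[lebesgue_rV R n]_y ((enorm y)^-1 * a (x - y)).

Lemma integrable_newton a x : measurable_fun setT a -> gauss_dominated a ->
  (lebesgue_rV R n).-integrable setT (EFin \o (fun y => (enorm y)^-1 * a (x - y))).
Proof.
move=> ma /gauss_dominated_ge0[M M0 aM]; have h4 : 0 < 4^-1 :> R by rewrite invr_gt0.
have i1 : (lebesgue_rV R n).-integrable setT
    (EFin \o (fun y => M * ((enorm y)^-1 * heat_kernel 4^-1 (x - y)))).
  by apply: integrable_scale => //; exact: integrable_newton_heat_kernel.
apply: (integrable_le _ _ _ i1) => //.
  apply: measurable_fun_mul; first by measurability.
  by apply: measurableT_comp => //; measurability.
move=> y _; rewrite normrM ger0_norm ?invr_ge0 ?enorm_ge0// mulrCA.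
by apply: ler_wpM2l; rewrite ?invr_ge0 ?enorm_ge0.
Qed.

Lemma newton_riesz a x : measurable_fun setT a -> gauss_dominated a ->
  riesz (m%:R / 2) a x = kappa * newton a x.
Proof.
move=> ma ad; transitivity (\int[mu]_(s in pos) (s `^ (m%:R / 2 - 1) *
    \int[lebesgue_rV R n]_y (heat_kernel s y * a (x - y)))).
  by apply: eq_RintegralD => s _; rewrite heat_convC.
apply: subordination => //.
- by move=> y; rewrite invr_ge0 enorm_ge0.
- exact: integral_heat_kernel_time.
- by apply: measurableT_comp => //; measurability.
- by move=> s s0; exact: integrable_heatC.
- exact: integrable_newton.
Qed.

(** The kernel is singular at the origin, so the derivative is put on [a]. *)
Lemma is_derive_newton (C : ('rV[R]_n -> R) -> Prop) (hC : test_class C) a i x : C a ->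
  is_derive x (delta_mx 0 i) (newton a) (newton (pderive i a) x).
Proof.
move=> Ca; have Ci := test_pderive hC i Ca.
have [M M0 aM] := gauss_dominated_ge0 (test_dominated hC Ca).
have [N N0 bN] := gauss_dominated_ge0 (test_dominated hC Ci).
apply: (@is_derive_convolution _ _ (fun y => (enorm y)^-1) a (pderive i a) (M + N)).
- by measurability.
- exact: (test_measurable hC).
- exact: (test_measurable hC).
- by move=> z; exact: (test_is_derive hC).
- move=> z; apply: (le_trans (aM z)); apply: ler_wpM2r; first exact: heat_kernel_ge0.
  by rewrite lerDl.
- move=> z; apply: (le_trans (bN z)); apply: ler_wpM2r; first exact: heat_kernel_ge0.
  by rewrite lerDr.
- by apply: integrable_newton_heat_kernel; rewrite invr_gt0.
Qed.

Lemma laplacian_newton (C : ('rV[R]_n -> R) -> Prop) (hC : test_class C) a (c : R) : C a ->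
  laplacian (fun x => c * newton a x) = (fun x => c * newton (laplacian a) x).
Proof.
move=> Ca; have p (b : 'rV[R]_n -> R) i : C b ->
    pderive i (fun x => c * newton b x) = (fun x => c * newton (pderive i b) x).
  move=> Cb; apply/funext => x; rewrite /pderive.
  have [_] := is_deriveZ c (is_derive_newton hC i x Cb); exact.
apply/funext => x; rewrite /laplacian.
have Cp i : C (pderive i a) by exact: (test_pderive hC).
have Cpp i : C (pderive i (pderive i a)) by exact: (test_pderive hC).
have pp i : pderive i (pderive i (fun x => c * newton a x)) x =
    c * newton (pderive i (pderive i a)) x by rewrite (p a)// (p (pderive i a)).
transitivity (\sum_(i < n) c * newton (pderive i (pderive i a)) x).
  by apply: eq_bigr => i _; exact: pp.
rewrite -mulr_sumr; congr (_ * _); rewrite /newton -Rintegral_bigsum//.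
  by apply: eq_RintegralD => y _; rewrite mulr_sumr.
by move=> i; apply: integrable_newton; [exact: (test_measurable hC)|exact: (test_dominated hC)].
Qed.

Lemma newton_opp a x : measurable_fun setT a -> gauss_dominated a ->
  newton (fun x => - a x) x = - newton a x.
Proof.
move=> ma ad; rewrite /newton -mulN1r -RintegralZl//; last exact: integrable_newton.
by apply: eq_RintegralD => y _; ring.
Qed.

(** All powers of -Delta are carried by [a], which stays in the test class; the regularity of the
    potential is drawn from there. *)
Lemma neg_laplacian_pow_newton (C : ('rV[R]_n -> R) -> Prop) (hC : test_class C) a (c : R) k :
  C a -> neg_laplacian_pow k (fun x => c * newton a x) =
  (fun x => c * newton (neg_laplacian_pow k a) x).
Proof.
move=> Ca; elim: k => [//|k IHk].
rewrite /neg_laplacian_pow !iterS -!/(neg_laplacian_pow _ _) IHk.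
have Ck := test_neg_laplacian_pow hC k Ca; have Cl := test_laplacian hC Ck.
rewrite (laplacian_newton hC)//; apply/funext => x.
rewrite newton_opp ?mulrN//; [exact: (test_measurable hC)|exact: (test_dominated hC)].
Qed.

End newton_potential.

(** * The average over hyperplanes as a convolution with |y|^-1 *)

Section newton_of_average.
Context {R : realType} (m : nat) (m0 : (0 < m)%N).
Notation n := m.+1.
Notation mu := (@lebesgue_measure R).
Implicit Types (v z : 'rV[R]_m) (chi : 'rV[R]_n -> R).

Let m2 : 0 < m%:R / 2 :> R.
Proof. by rewrite divr_gt0// ltr0n. Qed.

Let ae_neq0 : {ae lebesgue_rV R m, forall v, v != 0}.
Proof. by case: m m0 => // k _; exact: ae_rV_neq0. Qed.

(** The integral of exp (-4 |z|^2) over R^m. *)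
Let C : R := (pi / 4) `^ (m%:R / 2).

Let expR_heat_kernel z r : 0 < r ->
  expR (- (4 * r * dotp z z)) = C * r `^ (- (m%:R / 2)) * heat_kernel (16 * r)^-1 z.
Proof.
move=> r0; rewrite /heat_kernel -/C.
have e1 : 4 * pi * (16 * r)^-1 = pi / 4 / r :> R by field; rewrite gt_eqF.
have e2 : dotp z z / (4 * (16 * r)^-1) = 4 * r * dotp z z by field; rewrite gt_eqF.
have p4 : 0 < pi / 4 :> R by rewrite divr_gt0// pi_gt0.
rewrite e1 e2 [X in _ * (X * _)]powRM ?invr_ge0 ?(ltW r0) ?(ltW p4)//.
have -> : r^-1 `^ (- (m%:R / 2)) = r `^ (m%:R / 2).
  by rewrite -(powR_inv1 (ltW r0)) -powRrM mulrNN mul1r.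
rewrite /C; have h1 := mulr_powRN (m%:R / 2) p4; have h2 := mulr_powRN (m%:R / 2) r0.
move: h1 h2; set a := _ `^ _; set b := _ `^ (- _); set c := _ `^ _; set d := _ `^ _ => h1 h2.
transitivity ((a * b) * (c * d) * expR (- (4 * r * dotp z z))); last by ring.
by rewrite h1 h2 !mul1r.
Qed.

(** The integrand after Gamma(m/2) (1 + 4 |z|^2)^(-m/2) has been expanded as a Gamma integral in
    [r]. *)
Let k chi z v r : R :=
  chi (xjoin v (2 * dotp z v)) * (r `^ (m%:R / 2 - 1) * expR (- ((1 + 4 * dotp z z) * r))).

Let k_ge0 chi z v r : (forall y, 0 <= chi y) -> 0 <= k chi z v r.
Proof. by move=> chi0; rewrite !mulr_ge0 ?powR_ge0 ?expR_ge0. Qed.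

(* Under the Gaussian in [z], [2 * dotp z v] is a centred Gaussian variable whose variance
   only depends on [dotp v v]. *)
Let integral_k_z chi v r : measurable_fun setT chi -> (forall y, 0 <= chi y) -> v != 0 -> 0 < r ->
  (\int[lebesgue_rV R m]_z (k chi z v r)%:E =
   \int[mu]_t ((C * r^-1 * expR (- r)) * (chi (xjoin v t) *
      gauss_kernel (dotp v v / (4 * r)) t))%:E)%E.
Proof.
move=> mchi chi0 v0 r0.
have s0 : 0 < (16 * r)^-1 by rewrite invr_gt0 mulr_gt0.
have c0 : 0 <= C * r^-1 * expR (- r) by rewrite !mulr_ge0 ?powR_ge0 ?expR_ge0 ?invr_ge0 ?(ltW r0).
have mh : measurable_fun setT (fun t : R => (chi (xjoin v t))%:E).
  by apply: measurable_fun_EFin; apply: measurableT_comp => //; measurability.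
have mh2 : measurable_fun setT (fun t : R => (chi (xjoin v (t * 2)))%:E).
  by apply: measurable_fun_EFin; apply: measurableT_comp => //; measurability.
transitivity (\int[lebesgue_rV R m]_z ((C * r^-1 * expR (- r))%:E *
    ((chi (xjoin v (dotp z v * 2)))%:E * (heat_kernel (16 * r)^-1 z)%:E)))%E.
  apply: eq_integral => z _; rewrite -!EFinM; congr EFin.
  have -> : k chi z v r = chi (xjoin v (dotp z v * 2)) *
      (r `^ (m%:R / 2 - 1) * (expR (- r) * expR (- (4 * r * dotp z z)))).
    rewrite -expRD /k (mulrC 2 (dotp z v)); congr (_ * (_ * expR _)); ring.
  rewrite expR_heat_kernel//.
  rewrite powRDp// powR_inv1 ?(ltW r0)//.
  have h2 := mulr_powRN (m%:R / 2) r0; move: h2.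
  set a := r `^ _; set b := r `^ _; set h := heat_kernel _ _ => h2.
  transitivity ((a * b) * (C * r^-1 * expR (- r) * (chi (xjoin v (dotp z v * 2)) * h))); last first.
    by rewrite h2 mul1r.
  by ring.
rewrite ge0_integralZl_EFin//.
- rewrite (gauss_integral_linear_form (h := fun t => (chi (xjoin v (t * 2)))%:E))//.
  have E : (\int[mu]_t ((chi (xjoin v (t * 2)))%:E * (gauss_kernel ((16 * r)^-1 * dotp v v) t)%:E) =
      \int[mu]_t ((chi (xjoin v t))%:E * (gauss_kernel ((16 * r)^-1 * dotp v v * 2 ^+ 2) t)%:E))%E.
    have vs0 : 0 < (16 * r)^-1 * dotp v v by rewrite mulr_gt0// dotp_gt0.
    have := @gauss_integral_scale R (fun t => (chi (xjoin v t))%:E) _ 2 0 vs0.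
    move=> /(_ _ mh) E; apply: etrans; last first.
      apply: etrans (E _ _) _ => //; last by apply: eq_integral => t _; rewrite add0r.
      by move=> t; rewrite lee_fin.
    by apply: eq_integral => t _; rewrite add0r.
  rewrite {}E; transitivity (\int[mu]_t ((C * r^-1 * expR (- r))%:E *
      ((chi (xjoin v t))%:E * (gauss_kernel ((16 * r)^-1 * dotp v v * 2 ^+ 2) t)%:E)))%E.
    apply/esym; apply: ge0_integralZl_EFin c0 => //; last first.
      under eq_fun do rewrite -EFinM.
      apply: measurable_fun_EFin; apply: measurable_fun_mul.
        by apply: measurableT_comp => //; measurability.
      by apply: measurable_gauss_kernel; measurability.
    by move=> t _; rewrite -EFinM lee_fin mulr_ge0 ?gauss_kernel_ge0.
  apply: eq_integral => t _; rewrite -!EFinM; congr (_ * (_ * gauss_kernel _ _))%:E.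
  by field; rewrite gt_eqF.
  by move=> t; rewrite lee_fin.
- by move=> z _; rewrite -EFinM lee_fin mulr_ge0 ?heat_kernel_ge0.
- under eq_fun do rewrite -EFinM.
  apply: measurable_fun_EFin; apply: measurable_fun_mul.
    by apply: measurableT_comp => //; measurability.
  by apply: measurable_heat_kernel; measurability.
Qed.

(** With time |v|^2 / (4 r) the Gaussian is sqrt r / (sqrt pi |v|) times exp (-r t^2 / |v|^2), so
    this is a Gamma integral of exponent 1/2 with A = |(v, t)|^2 / |v|^2. The factor |v| cancels and
    a radial kernel is left. *)
Let integral_gauss_kernel_r v t : v != 0 ->
  (\int[mu]_(r in pos) (r^-1 * expR (- r) * gauss_kernel (dotp v v / (4 * r)) t)%:E =
   ((enorm (xjoin v t))^-1)%:E)%E.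
Proof.
move=> v0; have d0 : 0 < dotp v v by rewrite dotp_gt0.
have e0 : 0 < enorm v by rewrite enorm_gt0.
have sp : 0 < Num.sqrt (pi : R) by rewrite sqrtr_gt0 pi_gt0.
have h0 : 0 < 2^-1 :> R by rewrite invr_gt0.
pose A := 1 + t ^+ 2 / dotp v v.
have A0 : 0 < A by rewrite ltr_pwDl// divr_ge0 ?sqr_ge0// ltW.
pose c := (Num.sqrt pi * enorm v)^-1.
transitivity (\int[mu]_(r in pos) (c%:E * (r `^ (2^-1 - 1) * expR (- (A * r)))%:E))%E.
  apply: eq_ge0_integral => r /posP r0; rewrite -EFinM; congr EFin.
  rewrite /gauss_kernel.
  have -> : 4 * pi * (dotp v v / (4 * r)) = (Num.sqrt pi * enorm v) ^+ 2 * r^-1.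
    rewrite exprMn sqr_sqrtr ?pi_ge0// enorm_sqr; move: (pi : R) => p.
    by field; rewrite gt_eqF.
  rewrite powRM ?sqr_ge0 ?invr_ge0 ?(ltW r0)// powR_sqrV ?mulr_gt0// -/c.
  have -> : r^-1 `^ (- 2^-1) = r `^ 2^-1.
    by rewrite -(powR_inv1 (ltW r0)) -powRrM mulrNN mul1r.
  rewrite powRDp// powR_inv1 ?(ltW r0)//.
  have -> : t ^+ 2 / (4 * (dotp v v / (4 * r))) = t ^+ 2 / dotp v v * r.
    by field; rewrite !gt_eqF.
  rewrite /A mulrDl mul1r opprD expRD; ring.
rewrite ge0_integralZl_EFin//.
- rewrite integral_GammaE// Gamma_half -EFinM; congr EFin.
  have -> : A = (enorm (xjoin v t) / enorm v) ^+ 2.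
    rewrite exprMn exprVn !enorm_sqr dotp_xjoin /A -expr2.
    by field; rewrite gt_eqF.
  have E0 : 0 < enorm (xjoin v t).
    by rewrite /enorm sqrtr_gt0 dotp_xjoin ltr_pwDl// -expr2 sqr_ge0.
  rewrite powR_sqrV ?divr_gt0// /c; field.
  by rewrite !gt_eqF.
- exact: measurable_pos.
- by move=> r _; rewrite lee_fin mulr_ge0 ?powR_ge0 ?expR_ge0.
- by apply: measurable_funTS; measurability.
- by rewrite /c invr_ge0 mulr_ge0 ?ltW.
Qed.

(** For nonnegative [chi] the order of the integrals in z, v, r is free: [integral_k_z] performs z
    and introduces t, and [integral_gauss_kernel_r] performs r, leaving |(v, t)|^-1. *)
Lemma ge0_integral_average chi : measurable_fun setT chi -> (forall y, 0 <= chi y) ->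
  ((Gamma (m%:R / 2))%:E * \int[lebesgue_rV R m]_z (((1 + 4 * dotp z z) `^ (- (m%:R / 2)))%:E *
     \int[lebesgue_rV R m]_v (chi (xjoin v (2 * dotp z v)))%:E) =
   C%:E * \int[lebesgue_rV R n]_y ((enorm y)^-1 * chi y)%:E)%E.
Proof.
move=> mchi chi0; have C0 : 0 <= C by exact: powR_ge0.
have G0 := Gamma_gt0 m2.
have mc2 : measurable_fun setT (fun p : 'rV[R]_m * 'rV[R]_m => chi (xjoin p.2 (2 * dotp p.1 p.2))).
  by apply: measurableT_comp => //; measurability.
have mc1 : measurable_fun setT (fun p : 'rV[R]_m * 'rV[R]_m => chi (xjoin p.1 (2 * dotp p.2 p.1))).
  by apply: measurableT_comp => //; measurability.
have mcz z : measurable_fun setT (fun v => (chi (xjoin v (2 * dotp z v)))%:E).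
  by apply: measurable_fun_EFin; apply: measurableT_comp => //; measurability.
have D0 z : 0 < 1 + 4 * dotp z z by rewrite ltr_pwDl// mulr_ge0// dotp_ge0.
have mk3 : measurable_fun setT
    (fun p : ('rV[R]_m * 'rV[R]_m) * measurableTypeR R => (k chi p.1.1 p.1.2 p.2)%:E).
  apply: measurable_fun_EFin; apply: measurable_fun_mul.
    exact: (measurableT_comp mc2 measurable_fst).
  have m11 : measurable_fun setT (fun p : ('rV[R]_m * 'rV[R]_m) * measurableTypeR R => p.1.1).
    exact: measurableT_comp.
  by measurability.
have mk2 : measurable_fun setT (fun p : 'rV[R]_m * 'rV[R]_m =>
    \int[mu]_(r in pos) (k chi p.1 p.2 r)%:E)%E.
  by apply: (@measurable_fun_integral_on _ _ _ (measurableTypeR R) R mu _ measurable_pos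
    (fun p r => (k chi p.1 p.2 r)%:E)) => // p r _; rewrite lee_fin k_ge0.
have mN : measurable_fun setT (fun y : 'rV[R]_n => ((enorm y)^-1 * chi y)%:E).
  by apply: measurable_fun_EFin; measurability.
have N0 (y : 'rV[R]_n) : 0 <= (enorm y)^-1 * chi y by rewrite mulr_ge0// invr_ge0 enorm_ge0.
transitivity (\int[lebesgue_rV R m]_z \int[lebesgue_rV R m]_v
    \int[mu]_(r in pos) (k chi z v r)%:E)%E.
  rewrite -ge0_integralZl_EFin ?(ltW G0)//.
  - apply: eq_integral => z _; rewrite muleA -EFinM -integral_GammaE//.
    rewrite integral_GammaE// -ge0_integralZl_EFin ?mulr_ge0 ?powR_ge0 ?(ltW G0)//.
      apply: eq_integral => v _; rewrite /k.
      under [in RHS]eq_integral do rewrite EFinM.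
      rewrite ge0_integralZl_EFin//.
      + by rewrite integral_GammaE// muleC.
      + exact: measurable_pos.
      + by move=> r _; rewrite lee_fin mulr_ge0 ?powR_ge0 ?expR_ge0.
      + by apply: measurable_funTS; measurability.
    by move=> v _; rewrite lee_fin.
  - by move=> z _; rewrite mule_ge0// ?lee_fin ?powR_ge0// integral_ge0// => v _; rewrite lee_fin.
  - apply: emeasurable_funM; first by measurability.
    apply: (@measurable_fun_integral_on _ _ _ _ R (lebesgue_rV R m) setT measurableT
      (fun z v => (chi (xjoin v (2 * dotp z v)))%:E)) => //.
      exact: measurable_fun_EFin.
    by move=> z v _; rewrite lee_fin.
rewrite (@tonelli_on _ _ _ _ R (lebesgue_rV R m) (lebesgue_rV R m) setT setT measurableT
  measurableT (fun z v => \int[mu]_(r in pos) (k chi z v r)%:E)%E)//; last first.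
  by move=> z v _ _; apply: integral_ge0 => r _; rewrite lee_fin k_ge0.
transitivity (\int[lebesgue_rV R m]_v (C%:E * \int[mu]_t
    ((enorm (xjoin v t))^-1 * chi (xjoin v t))%:E))%E; last first.
  rewrite ge0_integral_rVS//.
  rewrite ge0_integralZl_EFin//.
  - by move=> v _; apply: integral_ge0 => t _; rewrite lee_fin.
  - apply: (@measurable_fun_integral_on _ _ _ (measurableTypeR R) R mu setT measurableT
      (fun v t => ((enorm (xjoin v t))^-1 * chi (xjoin v t))%:E)) => //.
    + by apply: (measurableT_comp mN); measurability.
    + by move=> v t _; rewrite lee_fin.
apply: ge0_ae_eq_integral => //.
- apply: (@measurable_fun_integral_on _ _ _ _ R (lebesgue_rV R m) setT measurableT
    (fun v z => \int[mu]_(r in pos) (k chi z v r)%:E)%E).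
    apply: (@measurable_fun_integral_on _ _ _ (measurableTypeR R) R mu _ measurable_pos
      (fun p r => (k chi p.2 p.1 r)%:E)) => //; last by move=> p r _; rewrite lee_fin k_ge0.
    apply: measurable_fun_EFin; apply: measurable_fun_mul.
      exact: (measurableT_comp mc1 measurable_fst).
    have m12 : measurable_fun setT (fun p : ('rV[R]_m * 'rV[R]_m) * measurableTypeR R => p.1.2).
      exact: measurableT_comp.
    by measurability.
  by move=> v z _; apply: integral_ge0 => r _; rewrite lee_fin k_ge0.
- apply: emeasurable_funM => //.
  apply: (@measurable_fun_integral_on _ _ _ (measurableTypeR R) R mu setT measurableT
    (fun v t => ((enorm (xjoin v t))^-1 * chi (xjoin v t))%:E)) => //.
  + by apply: (measurableT_comp mN); measurability.
  + by move=> v t _; rewrite lee_fin.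
- by move=> v _; apply: integral_ge0 => z _; apply: integral_ge0 => r _; rewrite lee_fin k_ge0.
- by move=> v _; rewrite mule_ge0// integral_ge0// => t _; rewrite lee_fin.
(* At v = 0 the Gaussian variable 2 z.v degenerates; this point is negligible because 0 < m. *)
apply: filterS ae_neq0 => v v0 _.
have d0 : 0 < dotp v v by rewrite dotp_gt0.
rewrite (@tonelli_on _ _ _ (measurableTypeR R) R (lebesgue_rV R m) mu setT pos measurableT
  measurable_pos (fun z r => (k chi z v r)%:E))//; last 2 first.
- apply: measurable_fun_EFin; apply: measurable_fun_mul.
    by apply: measurableT_comp => //; measurability.
  by measurability.
- by move=> z r _ _; rewrite lee_fin k_ge0.
have mq : measurable_fun setT (fun p : measurableTypeR R * measurableTypeR R =>
   (C * p.1^-1 * expR (- p.1) * (chi (xjoin v p.2) *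
      gauss_kernel (dotp v v / (4 * p.1)) p.2))%:E).
  apply: measurable_fun_EFin; apply: measurable_fun_mul; first by measurability.
  apply: measurable_fun_mul; first by apply: measurableT_comp => //; measurability.
  by apply: measurable_gauss_kernel; measurability.
transitivity (\int[mu]_(r in pos) \int[mu]_t ((C * r^-1 * expR (- r)) * (chi (xjoin v t) *
      gauss_kernel (dotp v v / (4 * r)) t))%:E)%E.
  by apply: eq_ge0_integral => r /posP r0; exact: integral_k_z.
rewrite (@tonelli_on _ _ (measurableTypeR R) (measurableTypeR R) R mu mu pos setT measurable_pos
  measurableT (fun r t => ((C * r^-1 * expR (- r)) * (chi (xjoin v t) *
      gauss_kernel (dotp v v / (4 * r)) t))%:E))//; last first.
  move=> r t /posP r0 _; rewrite lee_fin; apply: mulr_ge0.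
    by rewrite mulr_ge0 ?expR_ge0// mulr_ge0// invr_ge0 ltW.
  by rewrite mulr_ge0 ?gauss_kernel_ge0.
rewrite -ge0_integralZl_EFin//.
- apply: eq_integral => t _.
  transitivity (\int[mu]_(r in pos) ((C * chi (xjoin v t))%:E *
      (r^-1 * expR (- r) * gauss_kernel (dotp v v / (4 * r)) t)%:E))%E.
    by apply: eq_ge0_integral => r _; rewrite -EFinM; congr EFin; ring.
  rewrite ge0_integralZl_EFin ?mulr_ge0//.
  + by rewrite integral_gauss_kernel_r// -!EFinM; congr EFin; ring.
  + exact: measurable_pos.
  + move=> r /posP r0; rewrite lee_fin mulr_ge0 ?gauss_kernel_ge0//.
    by rewrite mulr_ge0 ?expR_ge0// invr_ge0 ltW.
  + apply: measurable_funTS; apply: measurable_fun_EFin; apply: measurable_fun_mul.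
      by measurability.
    by apply: measurable_gauss_kernel; measurability.
- by move=> t _; rewrite lee_fin.
- by apply: (measurableT_comp mN); measurability.
Qed.

End newton_of_average.

Section average_newton.
Context {R : realType} (m : nat) (m0 : (0 < m)%N).
Notation n := m.+1.
Implicit Types (v z : 'rV[R]_m) (chi psi : 'rV[R]_n -> R) (x : 'rV[R]_n).

Let weight z : R := (1 + 4 * dotp z z) `^ (- (m%:R / 2)).

Let slice chi z : R := \int[lebesgue_rV R m]_v chi (xjoin v (2 * dotp z v)).

Let integrable_slice chi := forall z,
  (lebesgue_rV R m).-integrable setT (EFin \o (fun v => chi (xjoin v (2 * dotp z v)))).

Let measurable_weight : measurable_fun setT weight.
Proof. by rewrite /weight; measurability. Qed.

(** Integrability in [z] is deduced from the finite value on the right-hand side; it could not come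
    from the weight, since (1 + 4 |z|^2)^(-m/2) is not integrable on R^m. *)
Let average_ge0 chi : measurable_fun setT chi -> (forall y, 0 <= chi y) ->
  integrable_slice chi ->
  (lebesgue_rV R n).-integrable setT (EFin \o (fun y => (enorm y)^-1 * chi y)) ->
  (lebesgue_rV R m).-integrable setT (EFin \o (fun z => weight z * slice chi z)) /\
  Gamma (m%:R / 2) * \int[lebesgue_rV R m]_z (weight z * slice chi z) =
  (pi / 4) `^ (m%:R / 2) * \int[lebesgue_rV R n]_y ((enorm y)^-1 * chi y).
Proof.
move=> mchi chi0 isl iN.
have G0 : 0 < Gamma (m%:R / 2) :> R by apply: Gamma_gt0; rewrite divr_gt0// ltr0n.
have sliceE z : (\int[lebesgue_rV R m]_v (chi (xjoin v (2 * dotp z v)))%:E = (slice chi z)%:E)%E.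
  by rewrite integral_EFin_Rintegral.
have slice0 z : 0 <= slice chi z by apply: Rintegral_ge0.
have w0 z : 0 <= weight z by exact: powR_ge0.
have mslice : measurable_fun setT (slice chi).
  apply/measurable_EFinP; rewrite (_ : _ \o _ = fun z =>
      \int[lebesgue_rV R m]_v (chi (xjoin v (2 * dotp z v)))%:E)%E.
    apply: (@measurable_fun_integral_on _ _ _ _ R (lebesgue_rV R m) setT measurableT
      (fun z v => (chi (xjoin v (2 * dotp z v)))%:E)).
      by apply: measurable_fun_EFin; apply: measurableT_comp => //; measurability.
    by move=> z v _; rewrite lee_fin.
  by apply/funext => z; rewrite sliceE.
have E := ge0_integral_average m0 mchi chi0.
rewrite (integral_EFin_Rintegral measurableT iN) in E.
have e : (\int[lebesgue_rV R m]_z (((1 + 4 * dotp z z) `^ (- (m%:R / 2)))%:E *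
    \int[lebesgue_rV R m]_v (chi (xjoin v (2 * dotp z v)))%:E) =
    \int[lebesgue_rV R m]_z (weight z * slice chi z)%:E)%E.
  by apply: eq_integral => z _; rewrite sliceE -EFinM.
rewrite {}e in E.
have iW : (lebesgue_rV R m).-integrable setT (EFin \o (fun z => weight z * slice chi z)).
  apply: integrable_ge0 => //.
  - exact: measurable_fun_mul.
  - by move=> z _; rewrite mulr_ge0.
  - rewrite ltey; apply/eqP => h; move: E; rewrite h gt0_muley ?lte_fin//.
split => //; apply: EFin_inj; rewrite !EFinM -E; congr (_ * _)%E.
by rewrite integral_EFin_Rintegral.
Qed.

Lemma integral_average_newton psi x : measurable_fun setT psi -> gauss_dominated psi ->
  Gamma (m%:R / 2) * \int[lebesgue_rV R m]_z
    (weight z * \int[lebesgue_rV R m]_v psi (x - xjoin v (2 * dotp z v))) =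
  (pi / 4) `^ (m%:R / 2) * newton psi x.
Proof.
move=> mpsi dpsi; have [M M0 pM] := gauss_dominated_ge0 dpsi.
pose chi y := psi (x - y).
have mchi : measurable_fun setT chi by apply: measurableT_comp => //; measurability.
have iN : (lebesgue_rV R n).-integrable setT (EFin \o (fun y => (enorm y)^-1 * chi y)).
  exact: integrable_newton.
have h4 : 0 < 4^-1 :> R by rewrite invr_gt0.
(* The maximum of [gauss_kernel] at time 1/4: it bounds the last factor of the Gaussian on the
   hyperplane, the other coordinates keeping their decay, so every slice is integrable. *)
pose c := (4 * pi * 4^-1) `^ (- 2^-1) : R.
have isl : integrable_slice chi.
  move=> z; have i1 := integrable_scale (M * c) measurableT (integrable_heat_kernel (xinit x) h4).
  apply: (integrable_le _ _ _ i1) => //.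
    by apply: measurableT_comp => //; measurability.
  move=> v _; apply: (le_trans (pM _)); rewrite -mulrA; apply: ler_wpM2l => //.
  rewrite -[x in x - _]xjoinK -xjoinN -xjoinD heat_kernel_xjoin// mulrC.
  apply: ler_wpM2r; first exact: heat_kernel_ge0.
  rewrite /gauss_kernel -[leRHS]mulr1; apply: ler_wpM2l; first exact: powR_ge0.
  by rewrite expR_le1 oppr_le0 divr_ge0 ?sqr_ge0.
(* Positive and negative parts: the nonnegative case applies to each, with integrability inherited
   from |chi|. *)
pose chip y := Num.max (chi y) 0; pose chin y := Num.max (- chi y) 0.
have chiE y : chi y = chip y - chin y.
  by rewrite /chip /chin /Num.max; do 2 case: ifPn => //; rewrite -?leNgt; lra.
have mp : measurable_fun setT chip by apply: measurable_maxr.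
have mn : measurable_fun setT chin.
  by apply: measurable_maxr => //; exact: measurable_fun_opp.
have p0 y : 0 <= chip y by rewrite le_max lexx orbT.
have n0 y : 0 <= chin y by rewrite le_max lexx orbT.
have plt y : chip y <= `|chi y| by rewrite ge_max ler_norm normr_ge0.
have nlt y : chin y <= `|chi y| by rewrite ge_max -normrN ler_norm normr_ge0.
have islice chi' : measurable_fun setT chi' -> (forall y, 0 <= chi' y) ->
    (forall y, chi' y <= `|chi y|) -> integrable_slice chi'.
  move=> mchi' chi'0 lt z; apply: (integrable_le _ _ _ (integrable_norm (isl z))) => //.
    by apply: measurableT_comp => //; measurability.
  by move=> v _; rewrite ger0_norm.
have inewt chi' : measurable_fun setT chi' -> (forall y, 0 <= chi' y) ->
    (forall y, chi' y <= `|chi y|) ->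
    (lebesgue_rV R n).-integrable setT (EFin \o (fun y => (enorm y)^-1 * chi' y)).
  move=> mchi' chi'0 lt; apply: (integrable_le _ _ _ (integrable_norm iN)) => //.
    by measurability.
  have e0 y : 0 <= (enorm (y : 'rV[R]_n))^-1 by rewrite invr_ge0 enorm_ge0.
  move=> y _; rewrite /= !normrM (ger0_norm (e0 y)) (ger0_norm (chi'0 y)).
  exact: ler_wpM2l.
have [iWp Ep] := average_ge0 mp p0 (islice _ mp p0 plt) (inewt _ mp p0 plt).
have [iWn En] := average_ge0 mn n0 (islice _ mn n0 nlt) (inewt _ mn n0 nlt).
have -> : newton psi x = \int[lebesgue_rV R n]_y ((enorm y)^-1 * chip y) -
    \int[lebesgue_rV R n]_y ((enorm y)^-1 * chin y).
  rewrite -RintegralB//; [|exact: inewt|exact: inewt].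
  by apply: eq_RintegralD => y _; rewrite -mulrBr -chiE.
rewrite mulrBr -Ep -En -mulrBr -RintegralB//; congr (_ * _).
apply: eq_RintegralD => z _; rewrite -mulrBr -RintegralB//; [|exact: islice|exact: islice].
by congr (_ * _); apply: eq_RintegralD => v _; rewrite -chiE.
Qed.

(** With u = z - y the quadratic terms |z|^2 - |y|^2 + |u|^2 reduce to 2 z.u: in the sheared
    coordinates the paraboloid is a hyperplane through [x]. Both sides are reflections of the
    integral of [H]. *)
Let radon_slice psi x z : measurable_fun setT psi ->
  parabolic_radon (B1inv psi) (xjoin z (xlast x - 2 * dotp z (xinit x) + enorm z ^+ 2)) =
  \int[lebesgue_rV R m]_v psi (x - xjoin v (2 * dotp z v)).
Proof.
move=> mpsi.
pose H u := psi (xjoin u (xlast x + 2 * dotp z (u - xinit x))).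
have mH : measurable_fun setT (EFin \o H).
  by apply: measurable_fun_EFin; apply: measurableT_comp => //; measurability.
transitivity (\int[lebesgue_rV R m]_y H (z - y)).
  apply: eq_RintegralD => y _; rewrite /B1inv !xinit_join !xlast_join /H; congr (psi (xjoin _ _)).
  by rewrite !enorm_sqr !dotpDl !dotpDr !dotpNl !dotpNr (dotpC y z); ring.
transitivity (\int[lebesgue_rV R m]_v H (xinit x - v)).
  by rewrite /Rintegral; congr fine; rewrite !(integral_rV_reflect _ mH).
apply: eq_RintegralD => v _; rewrite /H; congr psi.
rewrite -[x in RHS]xjoinK -xjoinN -xjoinD; congr xjoin.
rewrite !dotpDr !dotpNr; ring.
Qed.

(** The constants combine as pi^-m (pi/4)^(m/2) = (4 pi)^(-m/2). *)
Lemma radon_average_newton psi x : measurable_fun setT psi -> gauss_dominated psi ->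
  pi `^ (1 - n%:R) * \int[lebesgue_rV R m]_z
    (parabolic_radon (B1inv psi) (xjoin z (xlast x - 2 * dotp z (xinit x) + enorm z ^+ 2)) /
     (1 + 4 * enorm z ^+ 2) `^ ((n%:R - 1) / 2)) =
  (4 * pi) `^ (- (m%:R / 2)) / Gamma (m%:R / 2) * newton psi x.
Proof.
move=> mpsi dpsi.
have G0 : 0 < Gamma (m%:R / 2) :> R by apply: Gamma_gt0; rewrite divr_gt0// ltr0n.
have -> : n%:R - 1 = m%:R :> R by rewrite -natr1 addrK.
have -> : 1 - n%:R = - m%:R :> R by rewrite -natr1; ring.
rewrite (_ : \int[_]_z _ = \int[lebesgue_rV R m]_z
    (weight z * \int[lebesgue_rV R m]_v psi (x - xjoin v (2 * dotp z v)))); last first.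
  by apply: eq_RintegralD => z _; rewrite radon_slice// mulrC enorm_sqr /weight powRN.
apply: (mulfI (lt0r_neq0 G0)); rewrite mulrCA integral_average_newton// !mulrA; congr (_ * _).
have p0 := @pi_gt0 R.
have -> : (- m%:R : R) = - (m%:R / 2) - m%:R / 2 by field.
rewrite powRDp// !powRM ?(ltW p0)// ?invr_ge0//.
have -> : 4^-1 `^ (m%:R / 2) = 4 `^ (- (m%:R / 2)) :> R.
  by rewrite -(@powR_inv1 R 4)// -powRrM mulN1r.
have := mulr_powRN (m%:R / 2) p0.
set a := pi `^ _; set b := pi `^ _; set d := 4 `^ _ => h.
transitivity ((a * b) * (b * d)); first by ring.
by rewrite h; field; rewrite gt_eqF.
Qed.

End average_newton.

(** * The half Laplacian *)

Section half_order_integral.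
Context {R : realType}.
Notation mu := (@lebesgue_measure R).
Implicit Types (v w phi : R -> R) (s t : R).

Let h12 : 0 < 2^-1 :> R. Proof. by rewrite invr_gt0. Qed.
Let h12_1 : 2^-1 < 1 :> R. Proof. by lra. Qed.

(** Under t = q s the powers of [s] cancel; rescaling [s] by 1 + q then separates the variables and
    leaves the integral of q^(-1/2) / (1 + q), that is B(1/2, 1/2) = pi. *)
Lemma ge0_integral_half_beta phi : measurable_fun setT phi -> (forall s, 0 < s -> 0 <= phi s) ->
  (\int[mu]_(s in pos) \int[mu]_(t in pos)
     (s `^ (2^-1 - 1) * (t `^ (2^-1 - 1) * phi (s + t)))%:E =
   pi%:E * \int[mu]_(s in pos) (phi s)%:E)%E.
Proof.
move=> mphi phi0.
have mf s : measurable_fun setT (fun t : R =>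
    (s `^ (2^-1 - 1) * (t `^ (2^-1 - 1) * phi (s + t)))%:E).
  apply: measurable_fun_EFin; apply: measurable_fun_mul => //.
  apply: measurable_fun_mul; first by measurability.
  by apply: measurableT_comp => //; measurability.
have mg : measurable_fun setT (fun p : measurableTypeR R * measurableTypeR R =>
    (p.2 `^ (2^-1 - 1) * phi ((1 + p.2) * p.1))%:E).
  apply: measurable_fun_EFin; apply: measurable_fun_mul; first by measurability.
  by apply: measurableT_comp => //; measurability.
transitivity (\int[mu]_(s in pos) \int[mu]_(q in pos)
    (q `^ (2^-1 - 1) * phi ((1 + q) * s))%:E)%E.
  apply: eq_ge0_integral => s /posP s0.
  rewrite -(@ge0_integral_pos_scale R _ s s0 (mf s)); last first.
    by move=> t t0; rewrite lee_fin !mulr_ge0 ?powR_ge0// phi0// addr_gt0.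
  rewrite -ge0_integralZl_EFin ?(ltW s0)//.
  - apply: eq_ge0_integral => q /posP q0; rewrite -EFinM; congr EFin.
    rewrite powRM ?(ltW s0) ?(ltW q0)//.
    have -> : s + s * q = (1 + q) * s by ring.
    have e : s * s `^ (2^-1 - 1) * s `^ (2^-1 - 1) = 1.
      rewrite -mulrA -powRDp// -{1}(powRr1 (ltW s0)) -powRDp//.
      by rewrite (_ : 1 + _ = 0) ?powRr0//; field.
    transitivity ((s * s `^ (2^-1 - 1) * s `^ (2^-1 - 1)) * (q `^ (2^-1 - 1) * phi ((1 + q) * s))).
      by ring.
    by rewrite e mul1r.
  - exact: measurable_pos.
  - move=> q /posP q0; rewrite lee_fin !mulr_ge0 ?powR_ge0// phi0// addr_gt0// mulr_gt0//.
  - apply: measurable_funTS; apply: measurableT_comp (mf s) _.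
    by measurability.
rewrite (@tonelli_on _ _ (measurableTypeR R) (measurableTypeR R) R mu mu pos pos measurable_pos
  measurable_pos (fun s q => (q `^ (2^-1 - 1) * phi ((1 + q) * s))%:E))//; last first.
  move=> s q /posP s0 /posP q0; rewrite lee_fin mulr_ge0 ?powR_ge0// phi0// mulr_gt0//.
  by rewrite addr_gt0.
have I0 : (0%:E <= \int[mu]_(s in pos) (phi s)%:E)%E.
  by apply: integral_ge0 => s /posP s0; rewrite lee_fin phi0.
transitivity (\int[mu]_(q in pos) ((q `^ (2^-1 - 1) * (1 + q) `^ (- (2^-1 + 2^-1)))%:E *
    \int[mu]_(s in pos) (phi s)%:E))%E.
  apply: eq_ge0_integral => q /posP q0; have q10 : 0 < 1 + q by rewrite addr_gt0.
  under eq_integral do rewrite EFinM.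
  rewrite ge0_integralZl_EFin ?powR_ge0//.
  - rewrite -(@ge0_integral_pos_scale R (fun s => (phi s)%:E) _ q10); last 2 first.
    + exact: measurable_fun_EFin.
    + by move=> s s0; rewrite lee_fin phi0.
    rewrite EFinM -muleA; congr (_ * _)%E.
    rewrite muleA -EFinM (_ : - (2^-1 + 2^-1) = -1); last by field.
    by rewrite (powR_inv1 (ltW q10)) mulVf ?mul1e// gt_eqF.
  - exact: measurable_pos.
  - by move=> s /posP s0; rewrite lee_fin phi0// mulr_gt0.
  - apply: measurable_funTS; apply: measurable_fun_EFin.
    by apply: measurableT_comp => //; measurability.
rewrite ge0_integralZr//.
- rewrite integral_beta// (_ : 2^-1 + 2^-1 = 1); last by field.
  by rewrite Gamma1 Gamma_half divr1 -expr2 sqr_sqrtr ?pi_ge0.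
- exact: measurable_pos.
- by apply: measurable_funTS; measurability.
- by move=> q _; rewrite lee_fin mulr_ge0 ?powR_ge0.
Qed.

(** Weyl's fractional integral of order 1/2, without the factor 1 / Gamma(1/2). *)
Let half_int phi s := \int[mu]_(t in pos) (t `^ (2^-1 - 1) * phi (s + t)).

Let integrable_half phi N s : measurable_fun setT phi -> 0 <= N ->
  (forall s, 0 < s -> `|phi s| <= N * (1 + s) `^ (- 2)) -> 0 < s ->
  mu.-integrable pos (EFin \o (fun t => t `^ (2^-1 - 1) * phi (s + t))).
Proof.
move=> mphi N0 hphi s0.
have i1 := integrable_scale N measurable_pos (integral_powR_decay h12 (lt_trans h12_1 (ltr1n _ 2))).
apply: (integrable_le _ _ _ i1); first exact: measurable_pos.
- apply: measurable_funTS; apply: measurable_fun_mul; first by measurability.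
  by apply: measurableT_comp => //; measurability.
- move=> t /posP t0; rewrite normrM (ger0_norm (powR_ge0 _ _)) [leRHS]mulrCA.
  apply: ler_wpM2l; first exact: powR_ge0.
  apply: (le_trans (hphi _ (addr_gt0 s0 t0))); apply: ler_wpM2l => //.
  by apply: powRN_le => //; rewrite ?addr_gt0// lerD2l lerDr ltW.
Qed.

Let ge0_half_beta phi N : measurable_fun setT phi -> 0 <= N -> (forall s, 0 < s -> 0 <= phi s) ->
  (forall s, 0 < s -> `|phi s| <= N * (1 + s) `^ (- 2)) ->
  mu.-integrable pos (EFin \o (fun s => s `^ (2^-1 - 1) * half_int phi s)) /\
  \int[mu]_(s in pos) (s `^ (2^-1 - 1) * half_int phi s) = pi * \int[mu]_(s in pos) phi s.
Proof.
move=> mphi N0 phi0 hphi.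
have iphi : mu.-integrable pos (EFin \o phi).
  have i1 := integrable_scale N measurable_pos (integral_powR_decay (@ltr01 R) (ltr1n _ 2)).
  apply: (integrable_le _ _ _ i1); first exact: measurable_pos.
    exact: measurable_funTS.
  by move=> s /posP s0; rewrite subrr powRr0 mul1r; exact: hphi.
have half0 s : 0 < s -> 0 <= half_int phi s.
  move=> s0; apply: Rintegral_ge0 => t /posP t0; rewrite mulr_ge0 ?powR_ge0// phi0//.
  exact: addr_gt0.
have E : (\int[mu]_(s in pos) (s `^ (2^-1 - 1) * half_int phi s)%:E =
    (pi * \int[mu]_(s in pos) phi s)%:E)%E.
  rewrite EFinM -(integral_EFin_Rintegral measurable_pos iphi) -ge0_integral_half_beta//.
  apply: eq_ge0_integral => s /posP s0.
  have ih := integrable_half mphi N0 hphi s0.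
  under [in RHS]eq_integral do rewrite EFinM.
  rewrite ge0_integralZl_EFin ?powR_ge0//.
  - by rewrite (integral_EFin_Rintegral measurable_pos ih) -EFinM.
  - exact: measurable_pos.
  - by move=> t /posP t0; rewrite lee_fin mulr_ge0 ?powR_ge0// phi0// addr_gt0.
  - exact: (measurable_int _ ih).
split; last exact: Rintegral_EFin.
apply: integrable_ge0.
- exact: measurable_pos.
- apply: measurable_fun_mul; first by apply: measurable_funTS; measurability.
  have mfin : measurable_fun setT (fun s : measurableTypeR R => \int[mu]_(t in pos)
      (t `^ (2^-1 - 1) * Num.max (phi (s + t)) 0)%:E)%E.
    apply: (@measurable_fun_integral_on _ _ (measurableTypeR R) (measurableTypeR R) R mu _ measurable_pos
      (fun s t => (t `^ (2^-1 - 1) * Num.max (phi (s + t)) 0)%:E)).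
      apply: measurable_fun_EFin; apply: measurable_fun_mul; first by measurability.
      apply: measurable_maxr => //; apply: measurableT_comp => //; measurability.
    by move=> s t _; rewrite lee_fin mulr_ge0 ?powR_ge0// le_max lexx orbT.
  apply: (@eq_measurable_fun _ _ _ _ _ (fun s => fine (\int[mu]_(t in pos)
      (t `^ (2^-1 - 1) * Num.max (phi (s + t)) 0)%:E)%E)).
    move=> s; rewrite inE => /posP s0; rewrite /half_int /Rintegral; congr fine.
    apply: eq_ge0_integral => t /posP t0; congr (_ * _)%:E.
    by apply/max_idPl; apply: phi0; rewrite addr_gt0.
  by apply: measurable_funTS; apply: measurableT_comp => //; exact: measurable_fine.
- by move=> s /posP s0; rewrite mulr_ge0 ?powR_ge0// half0.
- by rewrite E ltry.
Qed.

(** [w] is the difference of the nonnegative functions w + d and d, where d = N (1 + s)^-2 is its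
    majorant; both obey the decay hypothesis with constant 2 N. *)
Lemma integral_half_beta w N : measurable_fun setT w -> 0 <= N ->
  (forall s, 0 < s -> `|w s| <= N * (1 + s) `^ (- 2)) ->
  mu.-integrable pos (EFin \o (fun s =>
    s `^ (2^-1 - 1) * \int[mu]_(t in pos) (t `^ (2^-1 - 1) * w (s + t)))) /\
  \int[mu]_(s in pos) (s `^ (2^-1 - 1) * \int[mu]_(t in pos) (t `^ (2^-1 - 1) * w (s + t))) =
  pi * \int[mu]_(s in pos) w s.
Proof.
move=> mw N0 wN.
pose d s := N * (1 + s) `^ (- 2); pose u s := w s + d s.
have d0 s : 0 < s -> 0 <= d s by move=> _; rewrite mulr_ge0 ?powR_ge0.
have md : measurable_fun setT d by rewrite /d; measurability.
have mu_ : measurable_fun setT u by exact: measurable_fun_add.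
have u0 s : 0 < s -> 0 <= u s.
  by move=> s0; have := wN _ s0; rewrite /u /d ler_norml => /andP[+ _]; rewrite -lerBlDr sub0r.
have dN s : 0 < s -> `|d s| <= (2 * N) * (1 + s) `^ (- 2).
  move=> s0; rewrite ger0_norm ?d0// /d; apply: ler_wpM2r; first exact: powR_ge0.
  by rewrite ler_peMl// ler1n.
have uN s : 0 < s -> `|u s| <= (2 * N) * (1 + s) `^ (- 2).
  move=> s0; apply: (le_trans (ler_normD _ _)); rewrite -mulrA mulr_natl mulr2n.
  by apply: lerD; [exact: wN|rewrite ger0_norm ?d0].
have N20 : 0 <= 2 * N by rewrite mulr_ge0.
have [id_ Ed] := ge0_half_beta md N20 d0 dN.
have [iu Eu] := ge0_half_beta mu_ N20 u0 uN.
have i1 phi : measurable_fun setT phi -> (forall s, 0 < s -> `|phi s| <= (2 * N) * (1 + s) `^ (- 2)) ->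
    mu.-integrable pos (EFin \o phi).
  move=> mphi hphi; have i1 := integrable_scale (2 * N) measurable_pos
    (integral_powR_decay (@ltr01 R) (ltr1n _ 2)).
  apply: (integrable_le _ _ _ i1); first exact: measurable_pos.
    exact: measurable_funTS.
  by move=> s /posP s0; rewrite subrr powRr0 mul1r; exact: hphi.
have wE s : 0 < s -> s `^ (2^-1 - 1) * half_int w s =
    s `^ (2^-1 - 1) * half_int u s - s `^ (2^-1 - 1) * half_int d s.
  move=> s0; rewrite -mulrBr; congr (_ * _).
  rewrite /half_int -RintegralB//; first last.
  - exact: integrable_half dN s0.
  - exact: integrable_half uN s0.
  - exact: measurable_pos.
  by apply: eq_RintegralD => t _; rewrite -mulrBr /u addrK.
split.
  apply: eq_integrable (integrable_sub measurable_pos iu id_); first exact: measurable_pos.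
  by move=> s; rewrite inE => /posP s0 /=; congr EFin; rewrite -wE.
transitivity (\int[mu]_(s in pos) (s `^ (2^-1 - 1) * half_int u s) -
    \int[mu]_(s in pos) (s `^ (2^-1 - 1) * half_int d s)).
  rewrite -RintegralB//; last exact: measurable_pos.
  by apply: eq_RintegralD => s /posP s0; exact: wE.
rewrite Ed Eu -mulrBr -RintegralB//; first last.
- exact: i1.
- exact: i1.
- exact: measurable_pos.
by congr (_ * _); apply: eq_RintegralD => s _; rewrite /u addrK.
Qed.

End half_order_integral.

Section half_order_difference.
Context {R : realType}.
Notation mu := (@lebesgue_measure R).
Implicit Types (s t : R).

Variables (v w : R -> R) (M N : R).
Hypothesis dv : forall s, 0 < s -> is_derive s 1 v (- w s).
Hypothesis cw : {in pos, continuous w}.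
Hypothesis vM : forall s, 0 < s -> `|v s| <= M * (1 + s) `^ (- 1).
Hypothesis wN : forall s, 0 < s -> `|w s| <= N * (1 + s) `^ (- 2).

Let h12 : 0 < 2^-1 :> R. Proof. by rewrite invr_gt0. Qed.
Let h12_1 : 2^-1 < 1 :> R. Proof. by lra. Qed.

Let cv : {in pos, continuous v}.
Proof. by move=> s /[!inE]/posP s0; exact: is_derive_continuous (dv s0). Qed.

Let M0 : 0 <= M.
Proof.
have := vM (@ltr01 R); have h : 0 < (1 + 1 : R) `^ (- 1) by rewrite powR_gt0.
by move=> /(le_trans (normr_ge0 _)); rewrite pmulr_lge0.
Qed.

Let N0 : 0 <= N.
Proof.
have := wN (@ltr01 R); have h : 0 < (1 + 1 : R) `^ (- 2) by rewrite powR_gt0.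
by move=> /(le_trans (normr_ge0 _)); rewrite pmulr_lge0.
Qed.

(** For t <= 1 the mean value theorem gives N t, for t > 1 the decay of [v] gives 2 M. The factor t
    / (1 + t), comparable to min(1, t), makes t^(-3/2) integrable at 0 and at infinity. *)
Let diff_le : exists2 K, 0 <= K & forall s t, 0 < s -> 0 < t ->
  `|v s - v (s + t)| <= K * (t * (1 + t) `^ (- 1)) * (1 + s) `^ (- 1).
Proof.
(* The outer 2 comes from 1 + t <= 2 when t <= 1 and 1 + t <= 2 t when t > 1. *)
exists (2 * (2 * M + N)); first by rewrite !mulr_ge0 ?addr_ge0 ?mulr_ge0.
move=> s t s0 t0; have st0 := addr_gt0 s0 t0.
have [s10 t10] : 0 < 1 + s /\ 0 < 1 + t by rewrite !addr_gt0.
have tt : 0 <= t * (1 + t) `^ (- 1) by rewrite mulr_ge0 ?powR_ge0// ltW.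
have st : s < s + t by rewrite ltrDl.
have le1 : `|v s - v (s + t)| <= 2 * M * (1 + s) `^ (- 1).
  apply: (le_trans (ler_normB _ _)); rewrite -mulrA mulr_natl mulr2n; apply: lerD; first exact: vM.
  apply: (le_trans (vM st0)); apply: ler_wpM2l => //; apply: powRN_le => //.
  by rewrite lerD2l ltW.
have le2 : `|v s - v (s + t)| <= N * t * (1 + s) `^ (- 1).
  have [||c cst E] := @MVT R v (fun s => - w s) s (s + t) st.
  - by move=> r; rewrite in_itv/= => /andP[sr _]; apply: dv; exact: lt_trans sr.
  - apply: continuous_in_subspaceT => r; rewrite inE/= in_itv/= => /andP[sr _].
    by apply: cv; rewrite inE; apply/posP; exact: lt_le_trans sr.
  have sc : s < c by move: cst; rewrite in_itv/= => /andP[].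
  rewrite distrC E addrC addKr normrM normrN (ger0_norm (ltW t0)) mulrAC.
  apply: ler_wpM2r; first exact: ltW.
  apply: (le_trans (wN (lt_trans s0 sc))); apply: ler_wpM2l => //.
  apply: (@le_trans _ _ ((1 + s) `^ (- 2))).
    by apply: powRN_le => //; rewrite lerD2l ltW.
  rewrite !powRN lef_pV2 ?posrE ?powR_gt0//.
  by apply: ler_powR => //; [rewrite lerDl ltW|rewrite ler1n].
have [t1|t1] := leP t 1.
  apply: (le_trans le2); apply: ler_wpM2r; first exact: powR_ge0.
  rewrite (powR_inv1 (ltW t10)) mulrA ler_pdivlMr//.
  have : 0 <= M * t by rewrite mulr_ge0// ltW.
  have : 0 <= N * t * (1 - t) by rewrite !mulr_ge0 ?(ltW t0)// subr_ge0.
  nra.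
apply: (le_trans le1); apply: ler_wpM2r; first exact: powR_ge0.
rewrite (powR_inv1 (ltW t10)) mulrA ler_pdivlMr//.
have : 0 <= M * (t - 1) by rewrite mulr_ge0// subr_ge0 ltW.
have : 0 <= N * t by rewrite mulr_ge0// ltW.
nra.
Qed.

(** Integration by parts in [t] with boundary term -2 t^(-1/2) (v s - v (s + t)). It vanishes at 0
    since the difference is O(t), and at infinity since the difference is bounded. *)
Let integral_diff s : 0 < s ->
  \int[mu]_(t in pos) (t `^ (- 2^-1 - 1) * (v s - v (s + t))) =
  2 * \int[mu]_(t in pos) (t `^ (2^-1 - 1) * w (s + t)).
Proof.
move=> s0; have [K K0 dK] := diff_le.
have shift_pos t : 0 < t -> 0 < s + t by exact: addr_gt0.
have dsh t : is_derive t 1 (fun t => s + t) 1.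
  apply: (is_derive_eq (is_derive1_add (is_derive_cst s t (1 : R)) (is_derive_id t (1 : R)))).
  by rewrite add0r.
have csh (f : R -> R) : {in pos, continuous f} -> {in pos, continuous (fun t => f (s + t))}.
  move=> cf t /[!inE]/posP t0; have ct := is_derive_continuous (dsh t).
  apply: (@continuous_comp _ _ _ (fun t => s + t) f t ct).
  by apply: cf; rewrite inE; apply/posP; exact: shift_pos.
have dV t : 0 < t -> is_derive t 1 (fun t => v s - v (s + t)) (w (s + t)).
  move=> t0; have d1 := is_derive1_compose (dv (shift_pos t t0)) (dsh t).
  apply: (is_derive_eq (is_derive1_add (is_derive_cst (v s) t (1 : R)) (is_derive1_opp d1))).
  by ring.
have cV : {in pos, continuous (fun t => v s - v (s + t))}.
  by move=> t /[!inE]/posP t0; exact: is_derive_continuous (dV t t0).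
(* The difference quotient is bounded near 0 and decays like 1/t, so the general lemmas on decay
   apply with weight t^(-1/2) instead of t^(-3/2). *)
pose q t := (v s - v (s + t)) / t.
have cq : {in pos, continuous q}.
  move=> t tp; have t0 : 0 < t by move: tp; rewrite inE => /posP.
  apply: cvgM; first exact: cV.
  by apply: cvgV; [rewrite gt_eqF|exact: cvg_id].
have qK t : 0 < t -> `|q t| <= K * (1 + t) `^ (- 1).
  move=> t0; rewrite /q normrM normfV (gtr0_norm t0) ler_pdivrMr//.
  apply: (le_trans (dK _ _ s0 t0)); rewrite mulrA mulrAC -!mulrA; apply: ler_wpM2l => //.
  rewrite [leRHS]mulrC [leLHS]mulrCA -[leRHS]mul1r; apply: ler_wpM2r.
    by rewrite mulr_ge0 ?powR_ge0// ltW.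
  by rewrite powR_inv1 ?addr_ge0 ?(ltW s0)// invf_le1 ?addr_gt0// lerDl ltW.
have qE t : 0 < t -> t `^ (- 2^-1 - 1) * (v s - v (s + t)) = t `^ (2^-1 - 1) * q t.
  move=> t0; rewrite /q (_ : 2^-1 - 1 = (- 2^-1 - 1) + 1); last by field.
  by rewrite (powRDp (- 2^-1 - 1) 1 t0) powRr1 ?(ltW t0)//; field; rewrite gt_eqF.
have iq := integrable_powR_decay cq qK h12 h12_1.
have iV : mu.-integrable pos (EFin \o (fun t => t `^ (- 2^-1 - 1) * (v s - v (s + t)))).
  apply: eq_integrable iq; first exact: measurable_pos.
  by move=> t; rewrite inE => /posP t0 /=; rewrite qE.
have wsN t : 0 < t -> `|w (s + t)| <= N * (1 + t) `^ (- 2).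
  move=> t0; apply: (le_trans (wN (shift_pos t t0))); apply: ler_wpM2l => //.
  by apply: powRN_le => //; rewrite ?addr_gt0// lerD2l lerDr ltW.
have iw := integrable_powR_decay (csh _ cw) wsN h12 (lt_trans h12_1 (ltr1n _ 2)).
have i2w : mu.-integrable pos (EFin \o (fun t => 2 * (t `^ (2^-1 - 1) * w (s + t)))).
  by apply: integrable_scale => //; exact: measurable_pos.
have d t : 0 < t -> is_derive t 1 (fun t => - 2 * (t `^ (2^-1 - 1) * (v s - v (s + t))))
    (t `^ (- 2^-1 - 1) * (v s - v (s + t)) - 2 * (t `^ (2^-1 - 1) * w (s + t))).
  move=> t0.
  have d1 := is_derive1_mul (is_derive1_powR (2^-1 - 1) t0) (dV t t0).
  apply: (is_derive_eq (is_derive1_scale (- 2) d1)).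
  by rewrite (_ : 2^-1 - 1 - 1 = - 2^-1 - 1); [field|field].
apply/eqP; rewrite -subr_eq0 -RintegralZl//; last exact: measurable_pos.
rewrite -RintegralB//; last exact: measurable_pos.
apply/eqP; rewrite (@integral_pos_FTC R _ _ 0 0 d) ?subrr//.
- move=> t tp; have t0 : 0 < t by move: tp; rewrite inE => /posP.
  apply: cvgB; apply: cvgM.
  + exact: (is_derive_continuous (is_derive1_powR _ t0)).
  + exact: cV.
  + exact: cvg_cst.
  + apply: cvgM; first exact: (is_derive_continuous (is_derive1_powR _ t0)).
    exact: (csh _ cw).
- by apply: integrable_sub => //; exact: measurable_pos.
- rewrite -[X in _ --> X](mulr0 (- 2)); apply: cvgM; first exact: cvg_cst.
  apply: norm_cvg0.
  have h : K * t `^ 2^-1 @[t --> 0^'+] --> (0 : R).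
    rewrite -[X in _ --> X](mulr0 K); apply: cvgM; first exact: cvg_cst.
    exact: powR_cvg0.
  apply: (@squeeze_cvgr _ _ _ _ (cst 0) _ _ _ _ (cvg_cst _) h).
  near=> t; have t0 : 0 < t by near: t; exact: nbhs_right_gt.
  rewrite /= normr_ge0/= normrM (ger0_norm (powR_ge0 _ _)).
  have -> : v s - v (s + t) = t * q t by rewrite /q mulrC divfK// gt_eqF.
  rewrite normrM (gtr0_norm t0) mulrA -{2}(powRr1 (ltW t0)) -powRDp// subrK mulrC.
  apply: ler_wpM2r; first exact: powR_ge0.
  apply: (le_trans (qK _ t0)); rewrite -[leRHS]mulr1; apply: ler_wpM2l => //.
  by rewrite powR_inv1 ?addr_ge0 ?(ltW t0)// invf_le1 ?addr_gt0// lerDl ltW.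
- rewrite -[X in _ --> X](mulr0 (- 2)); apply: cvgM; first exact: cvg_cst.
  have := cvgy_powR_decay (ltW h12) h12_1 qK; apply: cvg_trans.
  apply: near_eq_cvg; near=> t; have t0 : 0 < t by near: t; exact: nbhs_pinfty_gt.
  have -> : v s - v (s + t) = t * q t by rewrite /q mulrC divfK// gt_eqF.
  rewrite mulrA; congr (_ * _).
  by rewrite -[X in _ = _ * X](powRr1 (ltW t0)) -powRDp// subrK.
Unshelve. all: by end_near. Qed.

(* With [v s = heat s psi x] this is the identity
   [\int t^(-3/2) (h - P_t h) dt = const * psi]: integrating by parts in [t] turns the
   left-hand side into a double integral of [s^(-1/2) t^(-1/2) w (s + t)]. *)
Lemma integral_half_difference :
  \int[mu]_(t in pos) (t `^ (- 2^-1 - 1) *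
    \int[mu]_(s in pos) (s `^ (2^-1 - 1) * (v s - v (s + t)))) =
  2 * pi * \int[mu]_(s in pos) w s.
Proof.
have [K K0 dK] := diff_le.
(* [v] and [w] are only controlled on the half-line, while Fubini asks for joint measurability
   everywhere: hence the extension by zero. *)
pose v0 := v \_ pos; pose w0 := w \_ pos.
have mv0 : measurable_fun setT v0.
  by apply/(measurable_restrictT _ _).1; [exact: measurable_pos|exact: measurable_fun_pos].
have mw0 : measurable_fun setT w0.
  by apply/(measurable_restrictT _ _).1; [exact: measurable_pos|exact: measurable_fun_pos].
have v0E s : 0 < s -> v0 s = v s.
  by move=> s0; rewrite /v0 patchE ifT// inE; apply/posP.
have w0E s : 0 < s -> w0 s = w s.
  by move=> s0; rewrite /w0 patchE ifT// inE; apply/posP.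
pose f t s := t `^ (- 2^-1 - 1) * (s `^ (2^-1 - 1) * (v0 s - v0 (s + t))).
have mf : measurable_fun setT (fun p : measurableTypeR R * measurableTypeR R => f p.1 p.2).
  apply: measurable_fun_mul; first by measurability.
  apply: measurable_fun_mul; first by measurability.
  apply: measurable_fun_add; first by apply: measurableT_comp => //; measurability.
  by apply: measurable_fun_opp; apply: measurableT_comp => //; measurability.
have ib := integral_powR_decay h12 h12_1.
pose B := \int[mu]_(s in pos) (s `^ (2^-1 - 1) * (1 + s) `^ (- 1)).
have Bs : (\int[mu]_(s in pos) (s `^ (2^-1 - 1) * (1 + s) `^ (- 1))%:E = B%:E)%E.
  exact: (integral_EFin_Rintegral measurable_pos ib).
have halfE t : 0 < t -> t `^ (2^-1 - 1) = t `^ (- 2^-1 - 1) * t.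
  by move=> t0; rewrite -{3}(powRr1 (ltW t0)) -powRDp//; congr powR; field.
have fle t s : 0 < t -> 0 < s -> `|f t s| <=
    K * (t `^ (2^-1 - 1) * (1 + t) `^ (- 1)) * (s `^ (2^-1 - 1) * (1 + s) `^ (- 1)).
  move=> t0 s0; rewrite /f !v0E ?addr_gt0// !normrM !(ger0_norm (powR_ge0 _ _)).
  have c0 : 0 <= t `^ (- 2^-1 - 1) * s `^ (2^-1 - 1) by rewrite mulr_ge0 ?powR_ge0.
  rewrite mulrA; have := ler_wpM2l c0 (dK _ _ s0 t0) => /le_trans; apply.
  by rewrite le_eqVlt; apply/orP; left; apply/eqP; rewrite (halfE t t0); ring.
have fin : (\int[mu]_(t in pos) \int[mu]_(s in pos) `|f t s|%:E < +oo)%E.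
  have mfs t : measurable_fun pos (fun s => (`|f t s|)%:E).
    apply: measurable_funTS; apply: measurable_fun_EFin; apply: measurable_fun_norm.
    rewrite /f; do 2 (apply: measurable_fun_mul; first by measurability).
    apply: measurable_fun_add => //; apply: measurable_fun_opp.
    by apply: measurableT_comp => //; measurability.
  apply: (@le_lt_trans _ _ (\int[mu]_(t in pos)
      ((K * B) * (t `^ (2^-1 - 1) * (1 + t) `^ (- 1)))%:E)%E).
    apply: ge0_le_integral.
    - exact: measurable_pos.
    - by move=> t _; apply: integral_ge0 => s _; rewrite lee_fin.
    - apply: measurable_funTS.
      apply: (@measurable_fun_integral_on _ _ (measurableTypeR R) (measurableTypeR R) R mu _ measurable_pos
        (fun t s => (`|f t s|)%:E)); last by move=> t s _; rewrite lee_fin.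
      by apply: measurable_fun_EFin; exact: measurable_fun_norm.
    - by apply: measurable_funTS; measurability.
    - move=> t /posP t0; pose c := K * (t `^ (2^-1 - 1) * (1 + t) `^ (- 1)).
      have c0 : 0 <= c by rewrite mulr_ge0// mulr_ge0 ?powR_ge0.
      rewrite (_ : ((K * B) * _)%:E = (c%:E * B%:E)%E); last by rewrite -EFinM /c; congr EFin; ring.
      rewrite -Bs -ge0_integralZl_EFin//.
      + apply: ge0_le_integral => //.
        * exact: measurable_pos.
        * exact: mfs.
        * under eq_fun do rewrite -EFinM.
          by apply: measurable_funTS; measurability.
        * by move=> s /posP s0; rewrite -EFinM lee_fin; exact: fle.
      + exact: measurable_pos.
      + by move=> s _; rewrite lee_fin mulr_ge0 ?powR_ge0.
      + by apply: measurable_funTS; measurability.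
  have ikb := integrable_scale (K * B) measurable_pos ib.
  by rewrite (integral_EFin_Rintegral measurable_pos ikb) ltry.
have is_ t : 0 < t -> mu.-integrable pos (EFin \o (fun s => s `^ (2^-1 - 1) * (v0 s - v0 (s + t)))).
  move=> t0; have i1 := integrable_scale (K * (t * (1 + t) `^ (- 1))) measurable_pos ib.
  apply: (integrable_le _ _ _ i1); first exact: measurable_pos.
    apply: measurable_funTS; apply: measurable_fun_mul; first by measurability.
    apply: measurable_fun_add => //; apply: measurable_fun_opp.
    by apply: measurableT_comp => //; measurability.
  move=> s /posP s0; rewrite !v0E ?addr_gt0// normrM (ger0_norm (powR_ge0 _ _)) [leRHS]mulrCA.
  by apply: ler_wpM2l; [exact: powR_ge0|exact: dK].
have it_ s : 0 < s -> mu.-integrable pos (EFin \o (fun t => t `^ (- 2^-1 - 1) * (v0 s - v0 (s + t)))).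
  move=> s0; have i1 := integrable_scale (K * (1 + s) `^ (- 1)) measurable_pos ib.
  apply: (integrable_le _ _ _ i1); first exact: measurable_pos.
    apply: measurable_funTS; apply: measurable_fun_mul; first by measurability.
    apply: measurable_fun_add => //; apply: measurable_fun_opp.
    by apply: measurableT_comp => //; measurability.
  move=> t /posP t0; rewrite !v0E ?addr_gt0// normrM (ger0_norm (powR_ge0 _ _)) halfE//.
  apply: le_trans (ler_wpM2l (powR_ge0 _ _) (dK _ _ s0 t0)) _.
  by rewrite le_eqVlt; apply/orP; left; apply/eqP; ring.
transitivity (\int[mu]_(t in pos) \int[mu]_(s in pos) f t s).
  apply: eq_RintegralD => t /posP t0; rewrite /f RintegralZl//; first last.
  - exact: is_.
  - exact: measurable_pos.
  by congr (_ * _); apply: eq_RintegralD => s /posP s0; rewrite !v0E ?addr_gt0.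
rewrite (@fubini_on _ _ (measurableTypeR R) (measurableTypeR R) R mu mu pos pos measurable_pos
  measurable_pos f mf fin).
have w0N s : 0 < s -> `|w0 s| <= N * (1 + s) `^ (- 2) by move=> s0; rewrite w0E//; exact: wN.
have [ihalf Ehalf] := integral_half_beta mw0 N0 w0N.
transitivity (\int[mu]_(s in pos) (2 * (s `^ (2^-1 - 1) *
    \int[mu]_(t in pos) (t `^ (2^-1 - 1) * w0 (s + t))))).
  apply: eq_RintegralD => s /posP s0.
  transitivity (\int[mu]_(t in pos) (s `^ (2^-1 - 1) * (t `^ (- 2^-1 - 1) * (v0 s - v0 (s + t))))).
    by apply: eq_RintegralD => t _; rewrite /f mulrCA.
  rewrite RintegralZl//; first last.
  - exact: it_.
  - exact: measurable_pos.
  rewrite (_ : \int[mu]_(t in pos) (_ * (v0 s - _)) =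
      \int[mu]_(t in pos) (t `^ (- 2^-1 - 1) * (v s - v (s + t)))); last first.
    by apply: eq_RintegralD => t /posP t0; rewrite !v0E ?addr_gt0.
  rewrite integral_diff// mulrCA; congr (_ * (_ * _)).
  by apply: eq_RintegralD => t /posP t0; rewrite w0E ?addr_gt0.
rewrite RintegralZl//; last exact: measurable_pos.
rewrite Ehalf mulrA; congr (_ * _).
by apply: eq_RintegralD => s /posP s0; rewrite w0E.
Qed.

End half_order_difference.

(** * Mean value estimates from partial derivatives *)

Section coordinatewise_mean_value.
Context {R : realType} (n : nat).
Implicit Types (b : 'rV[R]_n -> R) (x y z : 'rV[R]_n).

Lemma is_derive_translate b z y v (l : R) :
  is_derive (z + y) v b l -> is_derive z v (fun z => b (z + y)) l.
Proof.
move=> d; apply: is_derive_from_line.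
have h : is_derive ((0 : R) *: v + (z + y)) v b l by rewrite scale0r add0r.
have := is_derive_along h.
by under eq_fun do rewrite addrA.
Qed.

Lemma norm_line_le b (db : 'rV[R]_n -> R) (v : 'rV[R]_n) B :
  (forall x, is_derive x v b (db x)) -> (forall x, `|db x| <= B) ->
  forall t x, `|b (x + t *: v) - b x| <= B * `|t|.
Proof.
move=> hd hB.
have pos_case t x : 0 < t -> `|b (x + t *: v) - b x| <= B * `|t|.
  move=> t0; pose f s := b (s *: v + x).
  have df (s : R) : is_derive s 1 f (db (s *: v + x)) by exact: is_derive_along.
  have [|c _ E] := @MVT R f (fun s => db (s *: v + x)) 0 t t0.
    by apply: continuous_subspaceT => s; exact: is_derive_continuous (df s).
  move: E; rewrite /f scale0r add0r subr0 (addrC x) => ->.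
  by rewrite normrM; apply: ler_wpM2r.
move=> t x; have [t0|t0|->] := ltgtP t 0.
- have := pos_case (- t) (x + t *: v); rewrite oppr_gt0 => /(_ t0).
  by rewrite -addrA -scalerDl subrr scale0r addr0 normrN distrC.
- exact: pos_case.
- by rewrite scale0r addr0 subrr !normr0 mulr0.
Qed.

(** From [x] to x + y one coordinate is changed at a time, so only partial derivatives intervene. *)
Lemma lipschitz_coordinates b (db : 'I_n -> 'rV[R]_n -> R) B :
  (forall i x, is_derive x (delta_mx 0 i) b (db i x)) ->
  (forall i x, `|db i x| <= B) ->
  forall x y, `|b (x + y) - b x| <= B * \sum_(i < n) `|y 0 i|.
Proof.
move=> hd hB x y; rewrite {1}(row_sum_delta y).
elim: (index_enum _) => [|i r IHr].
  by rewrite !big_nil addr0 subrr normr0 mulr0.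
rewrite !big_cons mulrDr addrA (addrAC x).
apply: le_trans (ler_distD (b (x + \sum_(j <- r) y 0 j *: delta_mx 0 j)) _ _) _.
apply: lerD => //.
by apply: norm_line_le (hd i) (hB i) _ _.
Qed.

(** Up to sign, the second difference is the increment between x - y and x of z -> b(z + y) - b z.
    The Lipschitz estimate is used for the partial derivatives of [b], and then for this
    function. *)
Lemma second_difference_le b (db : 'I_n -> 'rV[R]_n -> R) (ddb : 'I_n -> 'I_n -> 'rV[R]_n -> R) B :
  (forall i x, is_derive x (delta_mx 0 i) b (db i x)) ->
  (forall i j x, is_derive x (delta_mx 0 j) (db i) (ddb i j x)) ->
  (forall i j x, `|ddb i j x| <= B) ->
  forall x y, `|2 * b x - b (x - y) - b (x + y)| <= B * (\sum_(i < n) `|y 0 i|) ^+ 2.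
Proof.
move=> hd hdd hB x y; pose D z := b (z + y) - b z.
have dD i z : is_derive z (delta_mx 0 i) D (db i (z + y) - db i z).
  by apply: is_deriveB; exact: is_derive_translate.
have -> : 2 * b x - b (x - y) - b (x + y) = - (D ((x - y) + y) - D (x - y)).
  by rewrite /D subrK; ring.
rewrite normrN expr2 mulrA.
apply: (@lipschitz_coordinates D (fun i z => db i (z + y) - db i z)) => // i z.
exact: lipschitz_coordinates (hdd i) (hB i) _ _.
Qed.

Lemma sum_coord_sqr_le y : (\sum_(i < n) `|y 0 i|) ^+ 2 <= n%:R ^+ 2 * dotp y y.
Proof.
have h : \sum_(i < n) `|y 0 i| <= n%:R * enorm y.
  apply: (@le_trans _ _ (\sum_(i < n) enorm y)).
    apply: ler_sum => i _.
    by rewrite -ler_sqr ?nnegrE ?enorm_ge0// real_normK ?num_real// enorm_sqr sqr_coord_le.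
  by rewrite big_const_ord iter_addr addr0 mulr_natl.
rewrite -enorm_sqr -exprMn ler_sqr ?nnegrE ?mulr_ge0 ?enorm_ge0//.
by apply: sumr_ge0.
Qed.

Lemma continuous_lipschitz_coordinates b B :
  (forall x y, `|b (x + y) - b x| <= B * \sum_(i < n) `|y 0 i|) -> continuous b.
Proof.
move=> hB x; suff : b z @[z --> nbhs x] --> b x by [].
apply/(@cvgrPdist_le _ _ _ (nbhs x) (nbhs_filter x)) => e e0.
have c0 : 0 < `|B| * n%:R + 1 by rewrite ltr_wpDl// mulr_ge0.
apply/nbhs_ballP; exists (e / (`|B| * n%:R + 1)) => /=; first by rewrite divr_gt0.
move=> z [_ xz]; rewrite distrC; have := hB x (z - x); rewrite subrKC => /le_trans; apply.
apply: (@le_trans _ _ (`|B| * (n%:R * (e / (`|B| * n%:R + 1))))).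
  apply: (@le_trans _ _ (`|B| * \sum_(i < n) `|(z - x) 0 i|)).
    by apply: ler_wpM2r; [exact: sumr_ge0|exact: ler_norm].
  apply: ler_wpM2l => //; rewrite mulr_natl -[X in _ *+ X](card_ord n) -sumr_const.
  apply: ler_sum => i _; rewrite !mxE distrC; apply: ltW; exact: xz.
by rewrite 2!mulrA ler_pdivrMr// mulrDr mulr1 mulrA [leLHS]mulrC lerDl ltW.
Qed.

End coordinatewise_mean_value.

(** * Descent of the order, and regularity of the potentials *)

Section newton_inversion.
Context {R : realType} (m : nat) (m0 : (0 < m)%N).
Notation n := m.+1.
Notation mu := (@lebesgue_measure R).
Context (C : ('rV[R]_n -> R) -> Prop) (hC : test_class C).
Implicit Types (a psi : 'rV[R]_n -> R) (x y : 'rV[R]_n).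

(** It makes [newton_const * newton a] the normalized Riesz potential of order [m], and is the
    constant found in [radon_average_newton]. *)
Definition newton_const : R := (4 * pi) `^ (- (m%:R / 2)) / Gamma (m%:R / 2).

Let m2 : 0 < m%:R / 2 :> R.
Proof. by rewrite divr_gt0// ltr0n. Qed.

Let mn2 : m%:R / 2 < n%:R / 2 :> R.
Proof. by rewrite ltr_pM2r ?invr_gt0// ltr_nat. Qed.

Lemma newton_constE a x : C a ->
  newton_const * newton a x = riesz (m%:R / 2) a x / Gamma (m%:R / 2).
Proof.
move=> Ca; rewrite (newton_riesz m0 x (test_measurable hC Ca) (test_dominated hC Ca)).
by rewrite /newton_const mulrAC.
Qed.

Lemma newton_bounded a : C a -> exists2 B, 0 <= B & forall x, `|newton_const * newton a x| <= B.
Proof.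
move=> Ca; have [M M0 aM] := heat_decay (test_measurable hC Ca) (test_dominated hC Ca).
have G0 := Gamma_gt0 m2.
pose g s : R := M * (s `^ (m%:R / 2 - 1) * (1 + s) `^ (- (n%:R / 2))).
have ig : mu.-integrable pos (EFin \o g).
  by apply: integrable_scale; [exact: measurable_pos|exact: integral_powR_decay].
exists ((\int[mu]_(s in pos) g s) / Gamma (m%:R / 2)).
  by rewrite divr_ge0 ?(ltW G0)//; apply: Rintegral_ge0 => s _; rewrite !mulr_ge0 ?powR_ge0.
move=> x; rewrite newton_constE// normrM normfV (gtr0_norm G0).
apply: ler_wpM2r; first by rewrite invr_ge0 ltW.
apply: le_abs_Rintegral ig.
- exact: measurable_pos.
- apply: measurable_fun_mul; first by apply: measurable_funTS; measurability.
  by apply: measurable_fun_pos; exact: (continuous_heat hC).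
- move=> s /posP s0; rewrite normrM (ger0_norm (powR_ge0 _ _)) /g mulrCA.
  by apply: ler_wpM2l; [exact: powR_ge0|exact: aM].
Qed.

(** Here m/2 = k: k - 1 steps bring the exponent down to 1, and [riesz1] makes the last one. *)
Lemma newton_inversion_odd psi k : C psi -> m = k.*2 ->
  neg_laplacian_pow k (fun x => newton_const * newton psi x) = psi.
Proof.
move=> Cpsi mk; case: k mk => [|k] mk; first by have := m0; rewrite [X in (_ < X)%N]mk.
have Ca := test_neg_laplacian_pow hC k.+1 Cpsi.
rewrite (neg_laplacian_pow_newton m0 hC)//; apply/funext => x; rewrite newton_constE//.
have m2k : m%:R / 2 = 1 + k%:R :> R.
  by rewrite mk -muln2 natrM -natr1; field.
have n2k : n%:R / 2 = 1 + k%:R + 2^-1 :> R by rewrite -m2k -natr1; field.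
have C1 : C (fun x => - laplacian psi x).
  exact: (test_neg_laplacian_pow hC 1 Cpsi).
(* The innermost -Delta is kept for the final [riesz1], because [riesz_step] would start there from
   exponent 0. *)
have -> : neg_laplacian_pow k.+1 psi = neg_laplacian_pow k (fun x => - laplacian psi x).
  by rewrite /neg_laplacian_pow iterSr.
have := riesz_neg_laplacian_pow hC (k := k) x C1 (@ltr01 R).
have k0 : 0 <= k%:R :> R by [].
rewrite n2k ltrDl invr_gt0 => /(_ (ltr0n _ 2)).
rewrite Gamma1 mulr1 (riesz1 hC)//; last by rewrite n2k; lra.
by rewrite m2k => ->; rewrite mulfK// gt_eqF// Gamma_gt0// ltr_wpDr.
Qed.

(** For even [n] the exponent m/2 is a half-integer and the descent stops at 1/2, with normalization
    1 / Gamma(1/2) = 1 / sqrt pi. *)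
Lemma newton_half_riesz psi k x : C psi -> m%:R / 2 = 2^-1 + k%:R :> R ->
  newton_const * newton (neg_laplacian_pow k psi) x = (Num.sqrt pi)^-1 * riesz 2^-1 psi x.
Proof.
move=> Cpsi mk; have Ca := test_neg_laplacian_pow hC k Cpsi.
have h12 : 0 < 2^-1 :> R by rewrite invr_gt0.
have n2k : n%:R / 2 = 2^-1 + k%:R + 2^-1 :> R by rewrite -mk -natr1; field.
have := riesz_neg_laplacian_pow hC (k := k) x Cpsi h12.
rewrite n2k ltrDl => /(_ h12); rewrite newton_constE// mk Gamma_half => E.
have G0 : 0 < Gamma (2^-1 + k%:R) :> R by rewrite Gamma_gt0// ltr_wpDr.
have s0 : 0 < Num.sqrt (pi : R) by rewrite sqrtr_gt0 pi_gt0.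
apply: (mulIf (lt0r_neq0 G0)); rewrite divfK ?gt_eqF//.
by apply: (mulIf (lt0r_neq0 s0)); rewrite E; field; rewrite gt_eqF.
Qed.

(** The second partial derivatives of the potential are potentials of test functions, hence bounded
    uniformly in space. *)
Lemma newton_second_difference a : C a -> exists2 K, 0 <= K & forall x y,
  `|2 * (newton_const * newton a x) - newton_const * newton a (x - y) -
    newton_const * newton a (x + y)| <= K * dotp y y.
Proof.
move=> Ca.
have Ci i : C (pderive i a) by exact: (test_pderive hC).
have Cij i j : C (pderive j (pderive i a)) by exact: (test_pderive hC).
have hB (p : 'I_n * 'I_n) : exists B, 0 <= B /\
    forall x, `|newton_const * newton (pderive p.2 (pderive p.1 a)) x| <= B.
  by have [B B0 hB] := newton_bounded (Cij p.1 p.2); exists B.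
have [B {}hB] := choice hB.
pose K := \sum_p B p.
have BK p : B p <= K by rewrite /K (bigD1 p)//= lerDl sumr_ge0// => q _; case: (hB q).
have K0 : 0 <= K by apply: sumr_ge0 => q _; case: (hB q).
have dn b i x : C b -> is_derive x (delta_mx 0 i) (fun x => newton_const * newton b x)
    (newton_const * newton (pderive i b) x).
  by move=> Cb; apply: is_deriveZ; exact: (is_derive_newton m0 hC).
exists (K * n%:R ^+ 2) => [|x y]; first by rewrite mulr_ge0// exprn_ge0.
apply: le_trans (second_difference_le (b := fun x => newton_const * newton a x)
  (db := fun i x => newton_const * newton (pderive i a) x)
  (ddb := fun i j x => newton_const * newton (pderive j (pderive i a)) x) (B := K) _ _ _ x y) _.
- by move=> i z; exact: dn.
- by move=> i j z; exact: dn.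
- by move=> i j z; apply: le_trans (BK (i, j)); case: (hB (i, j)).
- by rewrite -mulrA; apply: ler_wpM2l => //; exact: sum_coord_sqr_le.
Qed.

(** The potential has bounded partial derivatives, so it is Lipschitz and thus continuous. *)
Lemma measurable_newton a : C a -> measurable_fun setT (fun x => newton_const * newton a x).
Proof.
move=> Ca; apply: continuous_measurable_rV.
have Ci i : C (pderive i a) by exact: (test_pderive hC).
have hB i : exists B, 0 <= B /\ forall x, `|newton_const * newton (pderive i a) x| <= B.
  by have [B B0 hB] := newton_bounded (Ci i); exists B.
have [B {}hB] := choice hB.
pose K := \sum_i B i.
have BK i : B i <= K by rewrite /K (bigD1 i)//= lerDl sumr_ge0// => q _; case: (hB q).
apply: (continuous_lipschitz_coordinates (B := K)); apply: lipschitz_coordinates.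
  by move=> i x; apply: is_deriveZ; exact: (is_derive_newton m0 hC).
by move=> i x; have [_ h] := hB i; exact: le_trans (h x) (BK i).
Qed.

End newton_inversion.

Lemma measurable_fun_Rintegral_on d1 d2 (T1 : measurableType d1) (T2 : measurableType d2)
    (R : realType) (m2 : {sigma_finite_measure set T2 -> \bar R}) (D2 : set T2)
    (f : T1 -> T2 -> R) : measurable D2 ->
  measurable_fun setT (fun p : T1 * T2 => f p.1 p.2) ->
  measurable_fun setT (fun x => \int[m2]_(y in D2) f x y).
Proof.
move=> mD2 mf; apply: measurableT_comp => //.
under eq_fun do rewrite integralE.
apply: emeasurable_funB.
- apply: (@measurable_fun_integral_on _ _ _ _ R m2 D2 mD2
    (fun x => (fun y => (f x y)%:E)^\+)%E) => //.
  rewrite (_ : (fun p : T1 * T2 => _) = (fun p : T1 * T2 => (f p.1 p.2)%:E)^\+%E); last first.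
    by apply/funext => p; rewrite !funeposE.
  by apply: measurable_funepos; exact: measurable_fun_EFin.
- apply: (@measurable_fun_integral_on _ _ _ _ R m2 D2 mD2
    (fun x => (fun y => (f x y)%:E)^\-)%E) => //.
  rewrite (_ : (fun p : T1 * T2 => _) = (fun p : T1 * T2 => (f p.1 p.2)%:E)^\-%E); last first.
    by apply/funext => p; rewrite !funenegE.
  by apply: measurable_funeneg; exact: measurable_fun_EFin.
Qed.

(** [heat_kernel_conv] under Fubini; the same computation with |a| provides the absolute
    integrability. *)
Lemma heat_semigroup (R : realType) n (a : 'rV[R]_n -> R) s t x : 0 < s -> 0 < t ->
  measurable_fun setT a -> gauss_dominated a ->
  \int[lebesgue_rV R n]_y (heat_kernel t y * heat s a (x - y)) = heat (s + t) a x.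
Proof.
move=> s0 t0 ma da; have st0 := addr_gt0 s0 t0.
pose f y z := a z * (heat_kernel s (x - z - y) * heat_kernel t y).
have mf : measurable_fun setT (fun p : 'rV[R]_n * 'rV[R]_n => f p.1 p.2).
  apply: measurable_fun_mul; first exact: measurableT_comp.
  apply: measurable_fun_mul; apply: measurable_heat_kernel; by measurability.
have ihk z : (lebesgue_rV R n).-integrable setT
    (EFin \o (fun y => heat_kernel s (x - z - y) * heat_kernel t y)).
  apply: integrable_ge0 => //.
  - apply: measurable_fun_mul; apply: measurable_heat_kernel; by measurability.
  - by move=> y _; rewrite mulr_ge0 ?heat_kernel_ge0.
  - by rewrite heat_kernel_conv// ltry.
have inner z : \int[lebesgue_rV R n]_y f y z = a z * heat_kernel (s + t) (x - z).
  by rewrite RintegralZl// (Rintegral_EFin (heat_kernel_conv _ s0 t0)).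
transitivity (\int[lebesgue_rV R n]_y \int[lebesgue_rV R n]_z f y z).
  apply: eq_RintegralD => y _; rewrite /heat -RintegralZl//; last exact: integrable_heat.
  apply: eq_RintegralD => z _; rewrite /f (_ : x - y - z = x - z - y); first by ring.
  by rewrite addrAC.
rewrite -(@fubini_on _ _ _ _ R (lebesgue_rV R n) (lebesgue_rV R n) setT setT measurableT
  measurableT (fun z y => f y z)).
- by apply: eq_RintegralD => z _; exact: inner.
- rewrite /f; apply: measurable_fun_mul; first exact: measurableT_comp.
  apply: measurable_fun_mul; apply: measurable_heat_kernel; by measurability.
- rewrite (@eq_ge0_integral _ _ _ _ setT _ (fun z => (`|a z * heat_kernel (s + t) (x - z)|)%:E)).
    have := integrable_norm (integrable_heat x st0 ma da).
    by move/(integral_EFin_Rintegral measurableT) => ->; exact: ltry.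
  move=> z _; transitivity (\int[lebesgue_rV R n]_y
      (`|a z|%:E * (heat_kernel s (x - z - y) * heat_kernel t y)%:E))%E.
    apply: eq_integral => y _; rewrite -EFinM; congr EFin; rewrite /f normrM; congr (_ * _).
    by rewrite ger0_norm// mulr_ge0 ?heat_kernel_ge0.
  rewrite ge0_integralZl_EFin//.
  + by rewrite heat_kernel_conv// -EFinM normrM (ger0_norm (heat_kernel_ge0 _ _)).
  + by move=> y _; rewrite lee_fin mulr_ge0 ?heat_kernel_ge0.
  + apply: measurable_fun_EFin.
    apply: measurable_fun_mul; apply: measurable_heat_kernel; by measurability.
Qed.

(** * The kernel |y|^(-n-1) as a time integral of heat kernels *)

Section half_laplacian_kernel.
Context {R : realType} (m : nat).
Notation n := m.+1.
Notation mu := (@lebesgue_measure R).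
Implicit Types (x y : 'rV[R]_n).

Definition half_kernel y : R := (enorm y ^+ n.+1)^-1.

Definition half_const : R := Gamma ((n%:R + 1) / 2) / pi `^ ((n%:R + 1) / 2).

Let kappa : R := 2 * Num.sqrt pi * half_const.

Let b0 : 0 < (n%:R + 1) / 2 :> R.
Proof. by rewrite divr_gt0// ltr_wpDl. Qed.

Lemma half_const_gt0 : 0 < half_const.
Proof. by rewrite divr_gt0 ?Gamma_gt0// powR_gt0// pi_gt0. Qed.

Let kappa_gt0 : 0 < kappa.
Proof. by rewrite mulr_gt0 ?half_const_gt0// mulr_gt0// sqrtr_gt0 pi_gt0. Qed.

Lemma half_kernel_ge0 y : 0 <= half_kernel y.
Proof. by rewrite invr_ge0 exprn_ge0// enorm_ge0. Qed.

Lemma measurable_half_kernel : measurable_fun setT half_kernel.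
Proof. by rewrite /half_kernel; measurability. Qed.

(** The exponents add up to -3/2 - n/2 = -b - 1 with b = (n + 1)/2, so [integral_inv_GammaE]
    applies; the powers of 2 and of pi combine into kappa = 2 sqrt pi c_n. *)
Lemma integral_half_kernel y : y != 0 ->
  (\int[mu]_(t in pos) (t `^ (- 2^-1 - 1) * heat_kernel t y)%:E =
   (kappa * half_kernel y)%:E)%E.
Proof.
move=> y0; have e0 : 0 < enorm y by rewrite enorm_gt0.
have d0 : 0 < dotp y y / 4 by rewrite divr_gt0// dotp_gt0.
have p0 := @pi_gt0 R; have fp0 : 0 < 4 * pi :> R by rewrite mulr_gt0.
pose b : R := (n%:R + 1) / 2; pose c := (4 * pi) `^ (- (n%:R / 2)) : R.
transitivity (\int[mu]_(t in pos) (c%:E * (t `^ (- b - 1) * expR (- (dotp y y / 4 / t)))%:E))%E.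
  apply: eq_ge0_integral => t /posP t0; rewrite -EFinM; congr EFin.
  rewrite /heat_kernel powRM ?(ltW t0) ?(ltW fp0)// -/c.
  have -> : - b - 1 = (- 2^-1 - 1) - n%:R / 2 :> R by rewrite /b; field.
  rewrite (powRDp (- 2^-1 - 1) (- (n%:R / 2)) t0).
  have -> : dotp y y / 4 / t = dotp y y / (4 * t) by field; rewrite gt_eqF.
  ring.
rewrite ge0_integralZl_EFin ?powR_ge0//.
- rewrite integral_inv_GammaE// -EFinM; congr EFin.
  have -> : (dotp y y / 4) `^ (- b) = 2 ^+ n.+1 * half_kernel y.
    have -> : dotp y y / 4 = (enorm y / 2) `^ 2%:R.
      by rewrite powR_mulrn ?divr_ge0 ?enorm_ge0// exprMn enorm_sqr; field.
    rewrite -powRrM (_ : 2%:R * - b = - n.+1%:R); last by rewrite /b -natr1; field.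
    rewrite powRN powR_mulrn ?divr_ge0 ?enorm_ge0// exprMn exprVn invfM invrK.
    by rewrite mulrC.
  have P0 : pi `^ b != 0 :> R by rewrite gt_eqF// powR_gt0.
  have N0 : 2 ^+ n != 0 :> R by rewrite expf_neq0.
  have -> : c = Num.sqrt pi / (2 ^+ n * pi `^ b).
    rewrite /c powRM ?(ltW p0)// (_ : - (n%:R / 2) = - b + 2^-1); last by rewrite /b; field.
    rewrite (powRDp (- b) 2^-1 p0) powR12_sqrt ?(ltW p0)// powRN.
    have -> : 4 `^ (- b + 2^-1) = (2 ^+ n)^-1 :> R.
      rewrite (_ : 4 = 2 `^ 2%:R); last by rewrite powR_mulrn//; ring.
      rewrite -powRrM (_ : 2%:R * (- b + 2^-1) = - n%:R); last by rewrite /b; field.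
      by rewrite powRN powR_mulrn.
    by field; rewrite ?N0 ?P0.
  by rewrite /kappa /half_const -/b (exprS 2 n); field; rewrite ?N0 ?P0.
- exact: measurable_pos.
- by move=> t _; rewrite lee_fin mulr_ge0 ?powR_ge0 ?expR_ge0.
- by apply: measurable_funTS; measurability.
Qed.

(** The weight min(1, |y|^2) that tames |y|^(-n-1) both at the origin and at infinity, and that
    dominates bounded second differences. *)
Definition min1_dotp y : R := Num.min 1 (dotp y y).

Lemma min1_dotp_ge0 y : 0 <= min1_dotp y.
Proof. by rewrite le_min ler01 dotp_ge0. Qed.

Lemma measurable_min1_dotp : measurable_fun setT min1_dotp.
Proof. by apply: measurable_minr => //; measurability. Qed.

Let moment_const : R := 8 * 2 `^ (n%:R / 2).

(** The total mass bounds the integral r by 1 and the second moment by [moment_const * t]; adding r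
    t <= t to the second bound produces the factor t / (1 + t). *)
Let integral_min1_heat_kernel_le t : 0 < t ->
  (\int[lebesgue_rV R n]_y (heat_kernel t y * min1_dotp y)%:E <=
   ((1 + moment_const) * (t * (1 + t) `^ (- 1)))%:E)%E.
Proof.
move=> t0; have t20 : 0 < 2 * t by rewrite mulr_gt0.
have c0 : 0 <= moment_const by rewrite mulr_ge0// powR_ge0.
have mhk s : measurable_fun setT (fun y : 'rV[R]_n => heat_kernel s y).
  by apply: measurable_heat_kernel; measurability.
have mm := measurable_min1_dotp.
have m1 : measurable_fun setT (fun y => (heat_kernel t y * min1_dotp y)%:E).
  by apply: measurable_fun_EFin; exact: measurable_fun_mul.
set X := (X in (X <= _)%E).
have X0 : (0 <= X)%E.
  by apply: integral_ge0 => y _; rewrite lee_fin mulr_ge0 ?heat_kernel_ge0// min1_dotp_ge0.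
have le1 : (X <= 1)%E.
  rewrite -(integral_heat_kernel n t0); apply: ge0_le_integral => //.
  - by move=> y _; rewrite lee_fin mulr_ge0 ?heat_kernel_ge0// min1_dotp_ge0.
  - exact: measurable_fun_EFin.
  - move=> y _; rewrite lee_fin -[leRHS]mulr1; apply: ler_wpM2l; first exact: heat_kernel_ge0.
    by rewrite ge_min lexx.
have le2 : (X <= (moment_const * t)%:E)%E.
  rewrite -[leRHS]mule1 -(integral_heat_kernel n t20) -ge0_integralZl_EFin//.
  - apply: ge0_le_integral => //.
    + by move=> y _; rewrite lee_fin mulr_ge0 ?heat_kernel_ge0// min1_dotp_ge0.
    + by under eq_fun do rewrite -EFinM; apply: measurable_fun_EFin; exact: measurable_fun_mul.
    + move=> y _; rewrite -EFinM lee_fin.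
      apply: (@le_trans _ _ (dotp y y * heat_kernel t y)).
        rewrite mulrC; apply: ler_wpM2r; first exact: heat_kernel_ge0.
        by rewrite ge_min lexx orbT.
      by apply: (le_trans (heat_kernel_moment y t0)); rewrite /moment_const (mulrAC 8).
  - by move=> y _; rewrite lee_fin heat_kernel_ge0.
  - exact: measurable_fun_EFin.
  - by rewrite mulr_ge0// ltW.
have fX : X \is a fin_num by rewrite ge0_fin_numE// (le_lt_trans le1)// ltry.
move: X0 le1 le2; rewrite -(fineK fX) !lee_fin; set r := fine X => r0 r1 r2.
have t10 : 0 < 1 + t by rewrite addr_gt0.
rewrite (powR_inv1 (ltW t10)) mulrA ler_pdivlMr// mulrDr mulr1 (mulrDl 1) mul1r addrC.
by apply: lerD => //; rewrite -[leRHS]mul1r; apply: ler_wpM2r => //; exact: ltW.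
Qed.

(** By subordination the integral is at most a constant times that of t^(-3/2) t / (1 + t) =
    t^(-1/2) / (1 + t), a convergent Beta integral. *)
Lemma integrable_half_kernel : (lebesgue_rV R n).-integrable setT
  (EFin \o (fun y => half_kernel y * min1_dotp y)).
Proof.
have mq := measurable_half_kernel; have mm := measurable_min1_dotp.
apply: integrable_ge0 => //.
- exact: measurable_fun_mul.
- by move=> y _; rewrite mulr_ge0 ?half_kernel_ge0 ?min1_dotp_ge0.
have E := ge0_subordination kappa_gt0 half_kernel_ge0 mq integral_half_kernel mm min1_dotp_ge0.
have h12 : 0 < 2^-1 :> R by rewrite invr_gt0.
have h12_1 : 2^-1 < 1 :> R by lra.
have ib := integrable_scale (1 + moment_const) measurable_pos (integral_powR_decay h12 h12_1).
have : (kappa%:E * \int[lebesgue_rV R n]_y (half_kernel y * min1_dotp y)%:E < +oo)%E.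
  rewrite E; apply: le_lt_trans (ltry (\int[mu]_(t in pos)
    ((1 + moment_const) * (t `^ (2^-1 - 1) * (1 + t) `^ (- 1))))).
  rewrite -(integral_EFin_Rintegral measurable_pos ib); apply: ge0_le_integral.
  - exact: measurable_pos.
  - move=> t _; rewrite mule_ge0 ?lee_fin ?powR_ge0// integral_ge0// => y _.
    by rewrite lee_fin mulr_ge0 ?heat_kernel_ge0 ?min1_dotp_ge0.
  - apply: emeasurable_funM; first by apply: measurable_funTS; measurability.
    apply: measurable_funTS.
    apply: (@measurable_fun_integral_on _ _ (measurableTypeR R) _ R (lebesgue_rV R n) setT
      measurableT (fun t y => (heat_kernel t y * min1_dotp y)%:E)).
      apply: measurable_fun_EFin; apply: measurable_fun_mul.
        by apply: measurable_heat_kernel; measurability.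
      exact: measurableT_comp.
    by move=> t y _; rewrite lee_fin mulr_ge0 ?heat_kernel_ge0 ?min1_dotp_ge0.
  - by apply: measurable_funTS; measurability.
  - move=> t /posP t0.
    apply: (@le_trans _ _ ((t `^ (- 2^-1 - 1))%:E *
      ((1 + moment_const) * (t * (1 + t) `^ (- 1)))%:E)%E).
      by apply: lee_wpmul2l; [rewrite lee_fin powR_ge0|exact: integral_min1_heat_kernel_le].
    rewrite -EFinM lee_fin le_eqVlt; apply/orP; left; apply/eqP.
    have -> : t `^ (2^-1 - 1) = t `^ (- 2^-1 - 1) * t.
      by rewrite -{3}(powRr1 (ltW t0)) -powRDp//; congr powR; field.
    ring.
rewrite !ltey; apply: contraNN => /eqP ->.
by rewrite gt0_muley// lte_fin.
Qed.

End half_laplacian_kernel.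

Section half_laplacian.
Context {R : realType} (m : nat) (m0 : (0 < m)%N).
Notation n := m.+1.
Notation mu := (@lebesgue_measure R).
Context (C : ('rV[R]_n -> R) -> Prop) (hC : test_class C).
Implicit Types (x y : 'rV[R]_n) (s t : R).

Variables (psi h : 'rV[R]_n -> R) (H K : R).
Hypothesis Cpsi : C psi.
Hypothesis hE : forall x, h x = (Num.sqrt pi)^-1 * riesz 2^-1 psi x.
Hypothesis mh : measurable_fun setT h.
Hypothesis hH : forall x, `|h x| <= H.
Hypothesis hK : forall x y, `|2 * h x - h (x - y) - h (x + y)| <= K * dotp y y.

Let D x y : R := 2 * h x - h (x - y) - h (x + y).

Let h12 : 0 < 2^-1 :> R. Proof. by rewrite invr_gt0. Qed.

Let n1 : 1 <= n%:R / 2 :> R.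
Proof. by rewrite ler_pdivlMr// mul1r ler_nat. Qed.

Let psi_decay : exists2 M, 0 <= M & forall x s, 0 < s -> `|heat s psi x| <= M * (1 + s) `^ (- 1).
Proof.
have [M M0 hM] := heat_decay (test_measurable hC Cpsi) (test_dominated hC Cpsi).
exists M => // x s s0; apply: (le_trans (hM _ _ s0)); apply: ler_wpM2l => //.
rewrite !powRN lef_pV2 ?posrE ?powR_gt0 ?addr_gt0//.
by apply: ler_powR => //; rewrite lerDl ltW.
Qed.

(** For s <= 1 boundedness is enough; for s > 1 the extra factor 1/s of [heat_laplacian_decay] gives
    the exponent n/2 + 1 >= 2, where [heat_decay] would stop at 1 if n = 2. *)
Let laplacian_decay : exists2 N, 0 <= N & forall x s, 0 < s ->
  `|heat s (laplacian psi) x| <= N * (1 + s) `^ (- 2).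
Proof.
have Cl := test_laplacian hC Cpsi.
have [M M0 hM] := heat_decay (test_measurable hC Cl) (test_dominated hC Cl).
have [N N0 hN] := heat_laplacian_decay hC Cpsi.
exists (4 * (M + N)) => [|x s s0]; first by rewrite mulr_ge0// addr_ge0.
have s10 : 0 < 1 + s by rewrite addr_gt0.
rewrite powRN (powR_mulrn 2 (ltW s10)).
have [s1|s1] := leP s 1.
  apply: (le_trans (hM _ _ s0)); apply: (@le_trans _ _ M).
    rewrite -[leRHS]mulr1; apply: ler_wpM2l => //.
    apply: (@le_trans _ _ (1 `^ (- (n%:R / 2)))); last by rewrite powR1.
    by apply: powRN_le; rewrite ?divr_ge0 ?lerDl ?(ltW s0).
  rewrite ler_pdivlMr ?exprn_gt0//.
  apply: (@le_trans _ _ (M * 2 ^+ 2)).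
    by apply: ler_wpM2l => //; rewrite ler_sqr ?nnegrE ?(ltW s10)//; lra.
  have -> : 2 ^+ 2 = 4 :> R by ring.
  by rewrite mulrC ler_wpM2l// lerDl.
apply: (le_trans (hN _ _ s0)).
have le1 : s `^ (- (n%:R / 2) - 1) <= s ^- 2.
  rewrite (_ : - (n%:R / 2) - 1 = - (n%:R / 2 + 1)); last by ring.
  rewrite powRN -(powR_mulrn 2 (ltW s0)) lef_pV2 ?posrE ?powR_gt0//.
  by apply: ler_powR; [exact: ltW|have := n1; lra].
apply: (le_trans (ler_wpM2l N0 le1)).
rewrite ler_pdivlMr ?exprn_gt0// mulrAC ler_pdivrMr ?exprn_gt0//.
have le2 : (1 + s) ^+ 2 <= 4 * s ^+ 2.
  rewrite (_ : 4 * s ^+ 2 = (2 * s) ^+ 2); last by ring.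
  by rewrite ler_sqr ?nnegrE ?(ltW s10)// ?mulr_ge0 ?(ltW s0)//; lra.
apply: (le_trans (ler_wpM2l N0 le2)).
have : 0 <= M * s ^+ 2 by rewrite mulr_ge0// sqr_ge0.
by rewrite mulrDr mulrDl; lra.
Qed.

Let K' : R := 4 * H + K.

Let H0 : 0 <= H. Proof. exact: le_trans (hH 0). Qed.

Let K'_ge0 : 0 <= K'.
Proof.
rewrite /K' addr_ge0// ?mulr_ge0//.
(* The sign of [K] is read off [hK] at a unit vector. *)
have := hK 0 (delta_mx 0 ord0); rewrite dotp_delta mxE !eqxx mulr1.
by apply: le_trans.
Qed.

(** The bound 4 H on the values serves for |y| >= 1, the quadratic bound for |y| < 1; their sum
    covers both cases. *)
Lemma second_difference_min1_le x y :
  `|2 * h x - h (x - y) - h (x + y)| <= (4 * H + K) * min1_dotp y.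
Proof.
rewrite -/(D x y) -/K'.
have le4 : `|D x y| <= 4 * H.
  apply: (le_trans (ler_normB _ _)); have := hH (x + y).
  have := ler_normB (2 * h x) (h (x - y)); have := hH (x - y).
  by rewrite normrM ger0_norm//; have := hH x; lra.
have leK := hK x y; rewrite -/(D x y) in leK.
rewrite /min1_dotp /K' minEle; case: ifP => y1.
  rewrite mulr1; apply: (le_trans le4); rewrite lerDl.
  have := hK x (delta_mx 0 ord0); rewrite dotp_delta mxE !eqxx mulr1.
  by apply: le_trans.
apply: (le_trans leK); rewrite mulrDl lerDr mulr_ge0 ?dotp_ge0//.
by rewrite mulr_ge0.
Qed.

Let D_le x y : `|D x y| <= K' * min1_dotp y := second_difference_min1_le x y.

Let mD x : measurable_fun setT (D x).
Proof.
rewrite /D; apply: measurable_fun_add; last first.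
  by apply: measurable_fun_opp; apply: measurableT_comp => //; measurability.
apply: measurable_fun_add; first by measurability.
by apply: measurable_fun_opp; apply: measurableT_comp => //; measurability.
Qed.

Let integrable_D x : (lebesgue_rV R n).-integrable setT
  (EFin \o (fun y => half_kernel y * D x y)).
Proof.
have i1 := integrable_scale K' measurableT (@integrable_half_kernel R m).
apply: (integrable_le _ _ _ i1) => //.
  by apply: measurable_fun_mul => //; exact: measurable_half_kernel.
move=> y _; rewrite normrM (ger0_norm (half_kernel_ge0 _)) [leRHS]mulrCA.
by apply: ler_wpM2l; [exact: half_kernel_ge0|exact: D_le].
Qed.

Let integrable_hk t (g : 'rV[R]_n -> R) B : 0 < t -> measurable_fun setT g ->
  (forall y, `|g y| <= B) ->
  (lebesgue_rV R n).-integrable setT (EFin \o (fun y => heat_kernel t y * g y)).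
Proof.
move=> t0 mg gB; have i1 := integrable_scale B measurableT (@integrable_heat_kernel0 R n t t0).
apply: (integrable_le _ _ _ i1) => //.
  by apply: measurable_fun_mul => //; apply: measurable_heat_kernel; measurability.
move=> y _; rewrite normrM (ger0_norm (heat_kernel_ge0 _ _)) [leRHS]mulrC.
by apply: ler_wpM2l; [exact: heat_kernel_ge0|exact: gB].
Qed.

Let integrable_hkh t x : 0 < t -> (lebesgue_rV R n).-integrable setT
  (EFin \o (fun y => heat_kernel t y * h (x - y))).
Proof.
move=> t0; apply: (integrable_hk (B := H)) => //.
by apply: measurableT_comp => //; measurability.
Qed.

Let integrable_heat_time x t : 0 <= t ->
  mu.-integrable pos (EFin \o (fun s => s `^ (2^-1 - 1) * heat (s + t) psi x)).
Proof.
move=> t0; have [M M0 hM] := psi_decay.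
have h1 : 2^-1 < 1 :> R by lra.
have i1 := integrable_scale M measurable_pos (integral_powR_decay h12 h1).
apply: (integrable_le _ _ _ i1); first exact: measurable_pos.
- apply: measurable_fun_mul; first by apply: measurable_funTS; measurability.
  apply: measurable_fun_pos => s /[!inE]/posP s0.
  have st0 : 0 < s + t by rewrite ltr_wpDr.
  apply: (@continuous_comp _ _ _ (fun s => s + t) (fun s => heat s psi x)).
    by apply: cvgD; [exact: cvg_id|exact: cvg_cst].
  by apply: (continuous_heat hC) => //; rewrite inE; apply/posP.
- move=> s /posP s0; rewrite normrM (ger0_norm (powR_ge0 _ _)) [leRHS]mulrCA.
  apply: ler_wpM2l; first exact: powR_ge0.
  have st0 : 0 < s + t by rewrite ltr_wpDr.
  apply: (le_trans (hM x _ st0)); apply: ler_wpM2l => //.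
  by apply: powRN_le => //; rewrite ?addr_gt0// addrA lerDl.
Qed.

(** P_t h is computed under the time integral that defines [h], where the semigroup law turns P_t
    P_s psi into P_(s+t) psi. *)
Let integral_hkh t x : 0 < t ->
  \int[lebesgue_rV R n]_y (heat_kernel t y * h (x - y)) =
  (Num.sqrt pi)^-1 * \int[mu]_(s in pos) (s `^ (2^-1 - 1) * heat (s + t) psi x).
Proof.
move=> t0; have [M M0 hM] := psi_decay.
have mpsi := test_measurable hC Cpsi; have dpsi := test_dominated hC Cpsi.
have h1 : 2^-1 < 1 :> R by lra.
have ib := integral_powR_decay h12 h1.
have iMb := integrable_scale M measurable_pos ib.
pose f y s := heat_kernel t y * (s `^ (2^-1 - 1) * heat s psi (x - y)).
have mheat : measurable_fun setT (fun p : 'rV[R]_n * measurableTypeR R => heat p.2 psi (x - p.1)).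
  have mint := @measurable_fun_Rintegral_on _ _ ('rV[R]_n * measurableTypeR R)%type _ R
    (lebesgue_rV R n) setT (fun p z => psi z * heat_kernel p.2 (x - p.1 - z)) measurableT.
  refine (mint _).
  have m11 : measurable_fun setT (fun p : ('rV[R]_n * measurableTypeR R) * 'rV[R]_n => p.1.1).
    exact: measurableT_comp.
  have m12 : measurable_fun setT (fun p : ('rV[R]_n * measurableTypeR R) * 'rV[R]_n => p.1.2).
    exact: measurableT_comp.
  apply: measurable_fun_mul; first exact: measurableT_comp.
  by apply: measurable_heat_kernel; measurability.
have mf : measurable_fun setT (fun p : 'rV[R]_n * measurableTypeR R => f p.1 p.2).
  apply: measurable_fun_mul; first by apply: measurable_heat_kernel; measurability.
  by apply: measurable_fun_mul => //; measurability.
have ihs y : mu.-integrable pos (EFin \o (fun s => s `^ (2^-1 - 1) * heat s psi y)).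
  by have := integrable_heat_time y (lexx 0); under eq_fun do rewrite /= addr0.
have fin : (\int[lebesgue_rV R n]_y \int[mu]_(s in pos) `|f y s|%:E < +oo)%E.
  pose B := \int[mu]_(s in pos) (M * (s `^ (2^-1 - 1) * (1 + s) `^ (- 1))).
  have iB := integrable_scale B measurableT (@integrable_heat_kernel0 R n t t0).
  apply: le_lt_trans (ltry (\int[lebesgue_rV R n]_y (B * heat_kernel t y))).
  rewrite -(integral_EFin_Rintegral measurableT iB); apply: ge0_le_integral => //.
  - by move=> y _; apply: integral_ge0 => s _; rewrite lee_fin.
  - apply: (@measurable_fun_integral_on _ _ _ (measurableTypeR R) R mu _ measurable_pos
      (fun y s => (`|f y s|)%:E)); last by move=> y s _; rewrite lee_fin.
    by apply: measurable_fun_EFin; exact: measurable_fun_norm.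
  - by apply: measurable_fun_EFin; apply: measurable_fun_mul => //;
      apply: measurable_heat_kernel; measurability.
  - move=> y _; rewrite mulrC EFinM -(integral_EFin_Rintegral measurable_pos iMb).
    rewrite -ge0_integralZl_EFin ?heat_kernel_ge0//.
    + apply: ge0_le_integral.
      * exact: measurable_pos.
      * by move=> s _; rewrite lee_fin.
      * apply: measurable_funTS; apply: measurable_fun_EFin; apply: measurable_fun_norm.
        apply: measurable_fun_mul => //; apply: measurable_fun_mul; first by measurability.
        have mp : measurable_fun setT (fun s : measurableTypeR R => (y, s)).
          by apply: measurable_fun_pair.
        exact: (measurableT_comp mheat mp).
      * by under eq_fun do rewrite -EFinM; apply: measurable_funTS; measurability.
      * move=> s /posP s0; rewrite -EFinM lee_fin /f normrM (normrM (s `^ (2^-1 - 1))).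
        rewrite (ger0_norm (powR_ge0 s _)) (ger0_norm (heat_kernel_ge0 _ _)); apply: ler_wpM2l; first exact: heat_kernel_ge0.
        rewrite mulrCA; apply: ler_wpM2l; first exact: powR_ge0.
        exact: hM.
    + exact: measurable_pos.
    + by move=> s _; rewrite lee_fin mulr_ge0// mulr_ge0 ?powR_ge0.
    + by apply: measurable_funTS; measurability.
have sp : 0 < Num.sqrt (pi : R) by rewrite sqrtr_gt0 pi_gt0.
have fE y : heat_kernel t y * h (x - y) = (Num.sqrt pi)^-1 * \int[mu]_(s in pos) f y s.
  by rewrite hE mulrCA; congr (_ * _); rewrite /riesz -RintegralZl//; exact: measurable_pos.
transitivity (\int[lebesgue_rV R n]_y ((Num.sqrt pi)^-1 * \int[mu]_(s in pos) f y s)).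
  by apply: eq_RintegralD => y _; exact: fE.
rewrite RintegralZl//; last first.
  apply: eq_integrable (integrable_scale (Num.sqrt pi) measurableT (integrable_hkh x t0)) => //.
  by move=> y _ /=; rewrite fE mulVKf// gt_eqF.
congr (_ * _).
rewrite (@fubini_on _ _ _ (measurableTypeR R) R (lebesgue_rV R n) mu setT pos measurableT
  measurable_pos f mf fin).
apply: eq_RintegralD => s /posP s0.
transitivity (\int[lebesgue_rV R n]_y (s `^ (2^-1 - 1) * (heat_kernel t y * heat s psi (x - y)))).
  by apply: eq_RintegralD => y _; rewrite /f mulrCA.
rewrite RintegralZl//; first by rewrite heat_semigroup.
have i1 := integrable_scale M measurableT (@integrable_heat_kernel0 R n t t0).
apply: (integrable_le _ _ _ i1) => //.
  apply: measurable_fun_mul; first by apply: measurable_heat_kernel; measurability.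
  have mp : measurable_fun setT (fun y : 'rV[R]_n => (y, s : measurableTypeR R)).
    by apply: measurable_fun_pair.
  exact: (measurableT_comp mheat mp).
move=> y _; rewrite normrM (ger0_norm (heat_kernel_ge0 _ _)) [leRHS]mulrC.
apply: ler_wpM2l; first exact: heat_kernel_ge0.
apply: (le_trans (hM (x - y) _ s0)); rewrite -[leRHS]mulr1; apply: ler_wpM2l => //.
by rewrite powR_inv1 ?addr_ge0 ?(ltW s0)// invf_le1 ?addr_gt0// lerDl ltW.
Qed.

(** Averaging the second difference against the heat kernel gives 2 (h - P_t h), the inner integral
    of [integral_half_difference]; that lemma and the initial value of the heat flow then return
    psi. *)
Lemma half_kernel_inversion x :
  half_const m * (2^-1 * \int[lebesgue_rV R n]_y
    (half_kernel y * (2 * h x - h (x - y) - h (x + y)))) = psi x.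
Proof.
rewrite -/(D x).
have [M M0 hM] := psi_decay; have [N N0 hN] := laplacian_decay.
have sp : 0 < Num.sqrt (pi : R) by rewrite sqrtr_gt0 pi_gt0.
have Cl := test_laplacian hC Cpsi.
(* The 2 comes from the two equal halves of the second difference, 1 / sqrt pi from the
   normalization of [h]. *)
pose r : R := 2 / Num.sqrt pi.
have r0 : 0 <= r by rewrite divr_ge0// ltW.
pose v s := r * heat s psi x; pose w s := r * - heat s (laplacian psi) x.
have dv s : 0 < s -> is_derive s 1 v (- w s).
  move=> s0; have d1 := is_derive_heat hC x Cpsi s0.
  by apply: (is_derive_eq (is_derive1_scale r d1)); rewrite /w mulrN opprK.
have cw : {in pos, continuous w}.
  move=> s sp'; apply: cvgM; first exact: cvg_cst.
  by apply: cvgN; exact: (continuous_heat hC).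
have vM s : 0 < s -> `|v s| <= (r * M) * (1 + s) `^ (- 1).
  by move=> s0; rewrite normrM (ger0_norm r0) -mulrA; apply: ler_wpM2l => //; exact: hM.
have wN s : 0 < s -> `|w s| <= (r * N) * (1 + s) `^ (- 2).
  by move=> s0; rewrite normrM (ger0_norm r0) normrN -mulrA; apply: ler_wpM2l => //; exact: hN.
have intw : \int[mu]_(s in pos) w s = r * psi x.
  have := @integral_pos_derivative R v (fun s => - w s) (r * M) (r * N) 1 2 (r * psi x).
  under eq_RintegralD do rewrite opprK.
  apply => //.
  - by rewrite ltr1n.
  - by move=> s sp'; apply: cvgN; exact: cw.
  - by move=> s s0; rewrite normrN; exact: wN.
  - apply: cvgM; first exact: cvg_cst.
    by apply: heat_cvg0; [exact: (test_continuous hC)|exact: (test_dominated hC)].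
have E := integral_half_difference dv cw vM wN.
have main : \int[mu]_(t in pos) (t `^ (- 2^-1 - 1) *
    \int[lebesgue_rV R n]_y (heat_kernel t y * D x y)) = 2 * pi * (r * psi x).
  rewrite -intw -E; apply: eq_RintegralD => t /posP t0; congr (_ * _).
  have i1 := integrable_hkh x t0.
  have i2 : (lebesgue_rV R n).-integrable setT (EFin \o (fun y => heat_kernel t y * h (x + y))).
    by apply: (integrable_hk (B := H)) => //; apply: measurableT_comp => //; measurability.
  have e2 : \int[lebesgue_rV R n]_y (heat_kernel t y * h (x + y)) =
      \int[lebesgue_rV R n]_y (heat_kernel t y * h (x - y)).
    rewrite /Rintegral -[in RHS](@integral_rV_opp R n (EFin \o (fun y => heat_kernel t y * h (x - y)))).
      by congr fine; apply: eq_integral => y _; rewrite /= heat_kernelN opprK.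
    apply: measurable_fun_EFin; apply: measurable_fun_mul.
      by apply: measurable_heat_kernel; measurability.
    by apply: measurableT_comp => //; measurability.
  transitivity (2 * h x - 2 * \int[lebesgue_rV R n]_y (heat_kernel t y * h (x - y))).
    transitivity (\int[lebesgue_rV R n]_y ((2 * h x * heat_kernel t y -
      heat_kernel t y * h (x - y)) - heat_kernel t y * h (x + y))).
      by apply: eq_RintegralD => y _; rewrite /D; ring.
    have i0 := integrable_scale (2 * h x) measurableT (@integrable_heat_kernel0 R n t t0).
    rewrite RintegralB//; last exact: integrable_sub.
    rewrite RintegralB// RintegralZl//; last exact: integrable_heat_kernel0.
    by rewrite (Rintegral_EFin (integral_heat_kernel n t0)) e2; ring.
  have ihs := integrable_heat_time x (lexx 0).
  have iht := integrable_heat_time x (ltW t0).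
  rewrite integral_hkh// hE /riesz.
  transitivity (r * (\int[mu]_(s in pos) (s `^ (2^-1 - 1) * heat (s + 0) psi x) -
      \int[mu]_(s in pos) (s `^ (2^-1 - 1) * heat (s + t) psi x))).
    rewrite (_ : \int[mu]_(s in pos) (_ * heat s psi x) =
      \int[mu]_(s in pos) (s `^ (2^-1 - 1) * heat (s + 0) psi x)); last first.
      by apply: eq_RintegralD => s _; rewrite addr0.
    set I0 := Rintegral _ _ _; set It := Rintegral _ _ _.
    by move: I0 It => I0 It; rewrite /r mulrBr !mulrA.
  rewrite -RintegralB//; last exact: measurable_pos.
  rewrite -RintegralZl//; first last.
  - by apply: integrable_sub => //; exact: measurable_pos.
  - exact: measurable_pos.
  by apply: eq_RintegralD => s _; rewrite /v addr0; ring.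
have kappa0 : 0 < 2 * Num.sqrt (pi : R) * half_const m.
  by rewrite mulr_gt0 ?half_const_gt0// mulr_gt0.
have := subordination kappa0 (@half_kernel_ge0 R m)
  (@integral_half_kernel R m) (mD x) _ (integrable_D x).
rewrite main => S.
have {}S : 2 * pi * (r * psi x) = 2 * Num.sqrt pi * half_const m *
  \int[lebesgue_rV R n]_y (half_kernel y * D x y).
  apply: S => t t0; apply: (integrable_hk (B := K')) => // y.
  apply: (le_trans (D_le x y)); rewrite -[leRHS]mulr1; apply: ler_wpM2l; last by rewrite ge_min lexx.
  exact: K'_ge0.
have pE : (pi : R) = Num.sqrt pi ^+ 2 by rewrite sqr_sqrtr// pi_ge0.
(* By [S], 4 sqrt pi psi x equals 2 sqrt pi c_n times the integral, since 2 pi r = 4 sqrt pi. *)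
apply: (mulfI (_ : 4 * Num.sqrt pi != 0 :> R)); first by rewrite gt_eqF// mulr_gt0.
transitivity (2 * Num.sqrt pi * half_const m *
  \int[lebesgue_rV R n]_y (half_kernel y * D x y)); first by field.
by rewrite -S {1}pE /r; field; rewrite gt_eqF.
Qed.

End half_laplacian.

Lemma measurable_patch d (T : measurableType d) (R : realType) (A : set T) (f : T -> R) :
  measurable A -> measurable_fun setT f -> measurable_fun setT (f \_ A).
Proof. by move=> mA mf; apply/(measurable_restrictT f mA); exact: measurable_funTS. Qed.

(** * Uniform convergence of the truncated integrals *)

Section truncation.
Context {R : realType} (m : nat).
Notation n := m.+1.
Implicit Types (x y : 'rV[R]_n) (e : R).

Variables (h : 'rV[R]_n -> R) (H K : R).
Hypothesis mh : measurable_fun setT h.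
Hypothesis hH : forall x, `|h x| <= H.

Definition truncated e x : R :=
  \int[lebesgue_rV R n]_(y in [set y | e < enorm y]) ((h x - h (x - y)) / enorm y ^+ n.+1).

Let D x y : R := 2 * h x - h (x - y) - h (x + y).

Hypothesis D_le : forall x y, `|2 * h x - h (x - y) - h (x + y)| <= K * min1_dotp y.

Let A e := [set y : 'rV[R]_n | e < enorm y].

Let mA e : measurable (A e).
Proof.
have : measurable_fun setT (fun y : 'rV[R]_n => enorm y) by measurability.
move=> /(_ measurableT `]e, +oo[%classic); rewrite setTI.
rewrite (_ : _ @^-1` _ = A e); last by apply/seteqP; split => y; rewrite /A /= in_itv/= andbT.
exact.
Qed.

Let integrable_A e (g : 'rV[R]_n -> R) B : 0 < e -> measurable_fun setT g ->
  (forall y, `|g y| <= B) ->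
  (lebesgue_rV R n).-integrable (A e) (EFin \o (fun y => half_kernel y * g y)).
Proof.
move=> e0 mg gB.
have B0 : 0 <= B := le_trans (normr_ge0 _) (gB 0).
have i1 := integrableS measurableT (mA e) (@subsetT _ _)
  (* Off the ball of radius e one has 1 <= (1 + e^-2) min(1, |y|^2). *)
  (integrable_scale (B * (1 + e ^- 2)) measurableT (@integrable_half_kernel R m)).
apply: (integrable_le _ _ _ i1) => //.
  by apply: measurable_funTS; apply: measurable_fun_mul => //; exact: measurable_half_kernel.
move=> y ey; rewrite normrM (ger0_norm (half_kernel_ge0 _)) [leRHS]mulrCA.
apply: ler_wpM2l; first exact: half_kernel_ge0.
apply: (le_trans (gB y)); rewrite -mulrA ler_peMr//.
have e2 : 0 < e ^+ 2 by rewrite exprn_gt0.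
rewrite /min1_dotp minEle; case: ifP => y1.
  by rewrite mulr1 lerDl invr_ge0 ltW.
have : e ^+ 2 <= dotp y y.
  by rewrite -enorm_sqr; apply/ltW; rewrite ltr_sqr ?nnegrE ?enorm_ge0// ltW.
move=> ed; apply: (@le_trans _ _ (e ^- 2 * dotp y y)).
  by rewrite mulrC ler_pdivlMr// mul1r.
by rewrite mulrDl mul1r lerDr dotp_ge0.
Qed.

Let mD x : measurable_fun setT (D x).
Proof.
rewrite /D; apply: measurable_fun_add; last first.
  by apply: measurable_fun_opp; apply: measurableT_comp => //; measurability.
apply: measurable_fun_add; first by measurability.
by apply: measurable_fun_opp; apply: measurableT_comp => //; measurability.
Qed.

(** The domain and the kernel are invariant under y -> -y, so the integral is its own average with
    the reflected one, and second differences appear. *)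
Let truncated_symmetric e x : 0 < e ->
  truncated e x = 2^-1 * \int[lebesgue_rV R n]_(y in A e) (half_kernel y * D x y).
Proof.
move=> e0.
have m1 (s : bool) : measurable_fun setT (fun y : 'rV[R]_n => h x - h (x + (if s then y else - y))).
  apply: measurable_fun_add => //; apply: measurable_fun_opp.
  by case: s; apply: measurableT_comp => //; measurability.
have b1 (s : bool) (y : 'rV[R]_n) : `|h x - h (x + (if s then y else - y))| <= 2 * H.
  by apply: (le_trans (ler_normB _ _)); rewrite mulr_natl mulr2n lerD.
have ip := integrable_A e0 (m1 true) (b1 true).
have im := integrable_A e0 (m1 false) (b1 false).
have E1 : truncated e x =
    \int[lebesgue_rV R n]_(y in A e) (half_kernel y * (h x - h (x - y))).
  by apply: eq_RintegralD => y _; rewrite mulrC.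
have E2 : \int[lebesgue_rV R n]_(y in A e) (half_kernel y * (h x - h (x + y))) =
    \int[lebesgue_rV R n]_(y in A e) (half_kernel y * (h x - h (x - y))).
  rewrite /Rintegral !(integral_mkcond (A e)).
  rewrite -[in RHS]integral_rV_opp.
    congr fine; apply: eq_integral => y _; rewrite /patch.
    have -> : (- y \in A e) = (y \in A e).
      by apply/idP/idP => /set_mem h0; apply/mem_set; move: h0; rewrite /A/= enormN.
    by case: ifP => // _; rewrite /half_kernel enormN opprK.
  by apply/(measurable_restrictT _ (mA e)); exact: measurable_int im.
transitivity (2^-1 * (truncated e x + truncated e x)); first by field.
congr (_ * _); rewrite {2}E1 -E2 E1 -RintegralD//.
by apply: eq_RintegralD => y _; rewrite /D; ring.
Qed.

(** The singular integral in absolutely convergent form, the second difference being O(|y|^2) at the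
    origin. *)
Definition half_limit x : R :=
  2^-1 * \int[lebesgue_rV R n]_y (half_kernel y * (2 * h x - h (x - y) - h (x + y))).

Let G y : R := half_kernel y * min1_dotp y.

(** The mass of the majorant inside the removed ball. It does not involve [x], which is the source
    of uniformity. *)
Let omega e := \int[lebesgue_rV R n]_y ((G \_ (~` A e)) y).

Let mG : measurable_fun setT G.
Proof.
apply: measurable_fun_mul; first exact: measurable_half_kernel.
exact: measurable_min1_dotp.
Qed.

Let G0 y : 0 <= G y.
Proof. by rewrite mulr_ge0 ?half_kernel_ge0 ?min1_dotp_ge0. Qed.

Let integrable_G : (lebesgue_rV R n).-integrable setT (EFin \o G).
Proof. exact: integrable_half_kernel. Qed.

Let mGA e : measurable_fun setT (G \_ (~` A e)).
Proof. by apply: measurable_patch => //; exact: measurableC. Qed.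

Let GA_le e y : `|(G \_ (~` A e)) y| <= G y.
Proof. by rewrite /patch; case: ifP => _; rewrite ?normr0// ger0_norm. Qed.

Let integrable_GA e : (lebesgue_rV R n).-integrable setT (EFin \o (G \_ (~` A e))).
Proof. by apply: (integrable_le _ _ _ integrable_G) => // y _; exact: GA_le. Qed.

Let K0 : 0 <= K.
Proof.
have := D_le 0 (delta_mx 0 ord0); rewrite /min1_dotp dotp_delta mxE !eqxx minxx mulr1.
by apply: le_trans.
Qed.

Let truncated_dist e x : 0 < e -> `|half_limit x - truncated e x| <= K * omega e.
Proof.
move=> e0; rewrite truncated_symmetric//.
rewrite (_ : half_limit x = 2^-1 * \int[lebesgue_rV R n]_y (half_kernel y * D x y))// -mulrBr.
have iD : (lebesgue_rV R n).-integrable setT (EFin \o (fun y => half_kernel y * D x y)).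
  have i1 := integrable_scale K measurableT integrable_G.
  apply: (integrable_le _ _ _ i1) => //.
    by apply: measurable_fun_mul => //; exact: measurable_half_kernel.
  move=> y _; rewrite normrM (ger0_norm (half_kernel_ge0 _)) /G [leRHS]mulrCA.
  by apply: ler_wpM2l; [exact: half_kernel_ge0|exact: D_le].
rewrite (Rintegral_mkcond _ (A e)) -RintegralB//; last first.
  rewrite -restrict_EFin; apply/(integrable_mkcond _ (mA e)).
  exact: integrableS iD.
rewrite normrM ger0_norm ?invr_ge0//.
have i2 := integrable_scale K measurableT (integrable_GA e).
apply: (@le_trans _ _ (2^-1 * \int[lebesgue_rV R n]_y (K * (G \_ (~` A e)) y))).
  apply: ler_wpM2l; first by rewrite invr_ge0.
  apply: (le_abs_Rintegral _ _ _ i2) => //.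
    apply: measurable_fun_add.
      by apply: measurable_fun_mul => //; exact: measurable_half_kernel.
    apply: measurable_fun_opp; apply: measurable_patch => //.
    by apply: measurable_fun_mul => //; exact: measurable_half_kernel.
  move=> y _; rewrite /patch in_setC; case: ifP => /= _.
    by rewrite subrr normr0 mulr0.
  rewrite subr0 normrM (ger0_norm (half_kernel_ge0 _)) /G [leRHS]mulrCA.
  by apply: ler_wpM2l; [exact: half_kernel_ge0|exact: D_le].
rewrite RintegralZl// -/(omega e).
have o0 : 0 <= omega e.
  by apply: Rintegral_ge0 => y _; rewrite /patch; case: ifP.
have : 0 <= K * omega e by exact: mulr_ge0.
lra.
Qed.

Let omega_cvg : omega e @[e --> 0^'+] --> (0 : R).
Proof.
pose f_ k := EFin \o (G \_ (~` A k.+1%:R^-1)).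
have fcvg y : f_ ^~ y @ \oo --> 0%E.
  (* At the origin [G] is 0, because the inverse of 0 is 0; any other point leaves the shrinking
     balls. *)
  apply: cvg_near_cst; have [Gy0|Gy0] := eqVneq (G y) 0.
    by apply: nearW => k; rewrite /f_ /= /patch; case: ifP => _ //; rewrite Gy0.
  have y0 : 0 < enorm y.
    rewrite enorm_gt0; apply: contra_neq Gy0 => ->.
    by rewrite /G /half_kernel /enorm dotp0 sqrtr0 expr0n/= invr0 mul0r.
  have := near_infty_natSinv_lt (PosNum y0); apply: filterS => k /= ky.
  by rewrite /f_ /= /patch ifF//; apply/negP => /set_mem; apply.
have mf_ k : measurable_fun setT (f_ k) by apply: measurable_fun_EFin.
have mf0 : measurable_fun setT (cst 0%E : 'rV[R]_n -> \bar R) by [].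
have ae1 : {ae lebesgue_rV R n, forall y, setT y -> f_ ^~ y @ \oo --> cst 0%E y}.
  by apply: aeW => y _; exact: fcvg.
have ae2 : {ae lebesgue_rV R n, forall y k, setT y -> (`|f_ k y| <= (EFin \o G) y)%E}.
  by apply: aeW => y k _; rewrite /f_ /= lee_fin; exact: GA_le.
have [_ _] := dominated_convergence measurableT mf_ mf0 ae1 integrable_G ae2.
rewrite integral0 => /fine_cvg /cvgrPdist_lt hcvg.
apply/cvgrPdist_le => d d0; have [k _ /(_ k (leqnn k))] := hcvg d d0.
rewrite /= sub0r normrN => /ltW kd.
near=> e; have ek : e <= k.+1%:R^-1 by near: e; apply: nbhs_right_le; rewrite invr_gt0.
(* Dominated convergence was applied along 1/(k+1); monotonicity of [omega] extends the limit to all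
   small radii. *)
have oe : omega e <= omega k.+1%:R^-1.
  apply: le_Rintegral => // y _; rewrite /patch; case: ifP => ye; case: ifP => yk //.
  by move/negP: yk; case; apply/mem_set => /= h1; move/set_mem: ye; apply; exact: le_lt_trans h1.
have o0 : 0 <= omega e by apply: Rintegral_ge0 => y _; rewrite /patch; case: ifP.
rewrite sub0r normrN ger0_norm//; apply: (le_trans oe); apply: le_trans kd.
exact: ler_norm.
Unshelve. all: by end_near. Qed.

Lemma truncated_uniform : {uniform, truncated e @[e --> 0^'+] --> half_limit}.
Proof.
move=> U /=; rewrite !uniform_nbhsT; case/nbhs_ex => d /= dU.
suff : \forall e \near 0^'+, U (truncated e) by [].
(* K + 1 excludes a division by zero, and d/2 leaves room for the strict inequality at the end. *)
have c0 : 0 < d%:num / 2 / (K + 1) by rewrite !divr_gt0// ltr_wpDl.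
have /cvgrPdist_lt/(_ _ c0) := omega_cvg => hom.
near=> e; have e0 : 0 < e by near: e; exact: nbhs_right_gt.
have oe : `|0 - omega e| < d%:num / 2 / (K + 1) by near: e.
apply: dU => x; apply: le_lt_trans (truncated_dist x e0) _.
apply: (@le_lt_trans _ _ (d%:num / 2)); last by rewrite ltr_pdivrMr// ltr_pMr// ltr1n.
rewrite sub0r normrN in oe; have := le_lt_trans (ler_norm _) oe => {}oe.
have K10 : 0 < K + 1 by rewrite ltr_wpDl.
rewrite ltr_pdivlMr// in oe; rewrite mulrC; apply: le_trans (ltW oe).
rewrite mulrDr mulr1 lerDl.
by apply: Rintegral_ge0 => y _; rewrite /patch; case: ifP.
Unshelve. all: by end_near. Qed.

Lemma truncated_lim x : lim (truncated e x @[e --> 0^'+]) = half_limit x.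
Proof.
apply: cvg_lim => //; apply/cvgrPdist_le => d d0.
have c0 : 0 < d / (K + 1) by rewrite divr_gt0// ltr_wpDl.
have /cvgrPdist_lt/(_ _ c0) := omega_cvg => hom.
near=> e; have e0 : 0 < e by near: e; exact: nbhs_right_gt.
have oe : `|0 - omega e| < d / (K + 1) by near: e.
apply: le_trans (truncated_dist x e0) _.
rewrite sub0r normrN in oe; have := le_lt_trans (ler_norm _) oe => {}oe.
have K10 : 0 < K + 1 by rewrite ltr_wpDl.
rewrite ltr_pdivlMr// in oe; rewrite mulrC; apply: le_trans (ltW oe).
rewrite mulrDr mulr1 lerDl.
by apply: Rintegral_ge0 => y _; rewrite /patch; case: ifP.
Unshelve. all: by end_near. Qed.

End truncation.

(** * The pullback by the parabolic shear *)

Section chain_rule.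
Context {R : realType} (n : nat).
Implicit Types (b : 'rV[R]_n -> R) (x v w : 'rV[R]_n).

Lemma mean_value_line b (db : 'rV[R]_n -> R) v : (forall x, is_derive x v b (db x)) ->
  forall x t, exists2 c, `|c| <= `|t| & b (x + t *: v) - b x = t * db (x + c *: v).
Proof.
move=> hd x t.
have df y (s : R) : is_derive s 1 (fun s : R => b (s *: v + y)) (db (s *: v + y)).
  exact: is_derive_along.
have [t0|t0|->] := ltgtP t 0; last first.
- by exists 0 => //; rewrite scale0r addr0 subrr mul0r.
- have [|c ct E] := @MVT R (fun s => b (s *: v + x)) (fun s => db (s *: v + x)) 0 t t0.
    by apply: continuous_subspaceT => s; exact: is_derive_continuous (df x s).
  move: ct; rewrite in_itv/= => /andP[c0 ct].
  exists c; first by rewrite !gtr0_norm// ltW.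
  by move: E; rewrite scale0r add0r subr0 (addrC x) (addrC x) mulrC.
- have [|c ct E] := @MVT R (fun s => b (s *: v + x)) (fun s => db (s *: v + x)) t 0 t0.
    by apply: continuous_subspaceT => s; exact: is_derive_continuous (df x s).
  move: ct; rewrite in_itv/= => /andP[tc c0].
  exists c; first by rewrite !ltr0_norm// lerN2 ltW.
  apply: oppr_inj; move: E; rewrite scale0r add0r sub0r opprB (addrC x) (addrC x) => ->.
  by rewrite mulrC mulNr.
Qed.

(** A chain rule from partial derivatives only: the increment along [w] is rewritten by the mean
    value theorem, and continuity of [dc] alone gives its limit. The displacement t sigma(t) has
    speed sigma(0) at t = 0. *)
Lemma is_derive_chain2 b (db dc : 'rV[R]_n -> R) v w x (sigma : R -> R) :
  (forall x, is_derive x v b (db x)) -> (forall x, is_derive x w b (dc x)) ->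
  continuous dc -> {for 0, continuous sigma} ->
  is_derive (0 : R) 1 (fun t : R => b (x + t *: v + (t * sigma t) *: w))
    (db x + sigma 0 * dc x).
Proof.
move=> hdb hdc cdc csigma.
(* The intermediate points are merely chosen; all that is used of them is |xi t| <= |t sigma(t)|,
   which tends to 0. *)
have /choice[xi xiP] : forall t : R, exists c, `|c| <= `|t * sigma t| /\
    b (x + t *: v + (t * sigma t) *: w) - b (x + t *: v) =
    t * sigma t * dc (x + t *: v + c *: w).
  by move=> t; have [c c1 c2] := mean_value_line hdc (x + t *: v) (t * sigma t); exists c.
have id0 : (t : R) @[t --> (0 : R)^'] --> (0 : R) by exact: cvg_within.
have sig0 : sigma t @[t --> (0 : R)^'] --> sigma 0 by exact: (cvg_trans (cvg_app _ id0) csigma).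
have xi0 : xi t @[t --> (0 : R)^'] --> (0 : R).
  apply: norm_cvg0.
  have h1 : `|t * sigma t| @[t --> (0 : R)^'] --> (0 : R).
    rewrite [X in _ --> X](_ : 0 = `|0 * sigma 0|); last by rewrite mul0r normr0.
    by apply: cvg_norm; exact: cvgM.
  apply: (@squeeze_cvgr _ _ _ _ (cst 0) _ _ _ _ (cvg_cst _) h1).
  by near=> t; rewrite /= normr_ge0/=; case: (xiP t).
have arg : x + t *: v + xi t *: w @[t --> (0 : R)^'] --> x.
  rewrite [X in _ --> X](_ : x = x + (0 : R) *: v + (0 : R) *: w); last first.
    by rewrite !scale0r !addr0.
  apply: cvgD; last exact: cvgZr_tmp.
  by apply: cvgD; [exact: cvg_cst|exact: cvgZr_tmp].
have c1 : dc (x + t *: v + xi t *: w) @[t --> (0 : R)^'] --> dc x.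
  exact: (cvg_comp _ _ arg (cdc x)).
have d1 : is_derive (0 : R) 1 (fun t : R => b (t *: v + x)) (db x).
  by have := is_derive_along (v := v) (t := 0) (z := x) (f := b) (l := db x); apply; rewrite scale0r add0r.
have c2 : h^-1 *: (b ((h *: 1 + 0) *: v + x) - b (0 *: v + x)) @[h --> (0 : R)^'] --> db x.
  by have [d <-] := d1; exact: d.
have H : h^-1 *: (b (x + (h *: 1 + 0) *: v + ((h *: 1 + 0) * sigma (h *: 1 + 0)) *: w) -
    b (x + 0 *: v + (0 * sigma 0) *: w)) @[h --> (0 : R)^'] --> db x + sigma 0 * dc x.
  have c3 : h^-1 *: (b ((h *: 1 + 0) *: v + x) - b (0 *: v + x)) +
      sigma h * dc (x + h *: v + xi h *: w) @[h --> (0 : R)^'] --> db x + sigma 0 * dc x.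
    by apply: cvgD => //; exact: cvgM.
  apply: cvg_trans c3; apply: near_eq_cvg.
  near=> h; have h0 : h != 0 by near: h; exact: nbhs_dnbhs_neq.
  have [_ E] := xiP h.
  have h1 : h *: (1 : R) + 0 = h by rewrite addr0 /GRing.scale/= mulr1.
  have sE (r : R) : h^-1 *: r = h^-1 * r by [].
  rewrite !h1 !sE mul0r !scale0r !addr0 add0r.
  rewrite (_ : b (x + h *: v + (h * sigma h) *: w) =
    b (x + h *: v) + h * sigma h * dc (x + h *: v + xi h *: w)); last by rewrite -E; ring.
  by rewrite (addrC (h *: v)); field.
split; first by apply/cvg_ex; eexists; exact: H.
by apply/cvg_lim => //; exact: H.
Unshelve. all: by end_near. Qed.

Lemma cvg_coord i x : (fun y : 'rV[R]_n => y 0 i) @ nbhs x --> x 0 i.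
Proof. exact: coord_continuous. Qed.

Lemma continuous_rV (T : topologicalType) (F : T -> 'rV[R]_n) :
  (forall i, continuous (fun t => F t 0 i)) -> continuous F.
Proof.
move=> cF t P [Q nQ QP].
have h : \forall z \near t, forall i j, Q i j (F z i j).
  apply: filter_forall => i; apply: filter_forall => j; rewrite (ord1 i).
  by apply: (cF j t); have := nQ 0 j.
by apply: filterS h => z hz; apply: QP.
Qed.

End chain_rule.

Section parabolic_pullback.
Context {R : realType} (m : nat).
Notation n := m.+1.
Implicit Types (x y : 'rV[R]_n) (a : 'rV[R]_n -> R).

(** The inverse of the change of variables in [B1inv]; the function psi of the proof is f composed
    with it. *)
Definition shear x : 'rV[R]_n := xjoin (xinit x) (xlast x - enorm (xinit x) ^+ 2).

Lemma shear_coord x i :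
  shear x 0 i = if i == ord_max then x 0 ord_max - enorm (xinit x) ^+ 2 else x 0 i.
Proof.
rewrite /shear mxE; case: unliftP => [j ->|->]; last by rewrite eqxx.
by rewrite mxE eq_sym (negbTE (neq_lift _ _)).
Qed.

Lemma continuous_shear : continuous shear.
Proof.
apply: continuous_rV => i.
under eq_fun do rewrite shear_coord.
case: eqP => _; last by move=> x; exact: cvg_coord.
move=> x; pose sq (r : seq 'I_m) (y : 'rV[R]_n) : R := \sum_(j <- r) y 0 (lift ord_max j) ^+ 2.
have csq r : sq r @ nbhs x --> sq r x.
  rewrite /sq; elim: r => [|j r IHr].
    rewrite big_nil (_ : (fun y => _) = cst 0); first exact: cvg_cst.
    by apply/funext => y; rewrite big_nil.
  rewrite big_cons (_ : (fun y => _) = fun y : 'rV[R]_n =>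
    y 0 (lift ord_max j) * y 0 (lift ord_max j) + \sum_(j <- r) y 0 (lift ord_max j) ^+ 2).
    by apply: cvgD IHr; exact: (cvgM (cvg_coord (x := x)) (cvg_coord (x := x))).
  by apply/funext => y; rewrite big_cons.
have sqE (y : 'rV[R]_n) : enorm (xinit y) ^+ 2 = sq (index_enum 'I_m) y.
  by rewrite enorm_sqr; apply: eq_bigr => j _; rewrite !mxE expr2.
rewrite /continuous_at sqE; under eq_fun do rewrite sqE.
exact: (cvgB (cvg_coord (x := x)) (csq _)).
Qed.

(** A move along a horizontal axis becomes the same move plus a vertical one -t (2 x_j + t), in the
    form t sigma(t) of [is_derive_chain2]. *)
Lemma shear_translate x (j : 'I_m) (t : R) :
  shear (t *: delta_mx 0 (lift ord_max j) + x) =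
  shear x + t *: delta_mx 0 (lift ord_max j) +
  (t * - (2 * x 0 (lift ord_max j) + t)) *: delta_mx 0 ord_max.
Proof.
have dj : xinit (t *: delta_mx 0 (lift ord_max j) + x) = t *: delta_mx 0 j + xinit x.
  by apply/rowP => i; rewrite !mxE !eqxx (inj_eq (@lift_inj _ _)).
apply/rowP => i; rewrite shear_coord dj.
rewrite 2![in RHS]mxE [in RHS]shear_coord.
have [->|im] := eqVneq i ord_max; last by rewrite !mxE (negbTE im) !andbF mulr0 addr0 addrC.
rewrite !mxE !eqxx (negbTE (neq_lift _ _)) !enorm_sqr.
rewrite !dotpDl !dotpDr !dotpZl !dotpZr (dotpC (delta_mx 0 j)) !dotp_delta !mxE !eqxx /=.
ring.
Qed.

Lemma shear_translate_last x (t : R) :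
  shear (t *: delta_mx 0 ord_max + x) = t *: delta_mx 0 ord_max + shear x.
Proof.
have d0 : xinit (t *: delta_mx 0 ord_max + x) = xinit x.
  by apply/rowP => i; rewrite !mxE eq_sym (negbTE (neq_lift _ _)) andbF mulr0 add0r.
apply/rowP => i; rewrite shear_coord [in RHS]mxE [in RHS]shear_coord d0 !mxE.
by have [_|im] := eqVneq i ord_max; rewrite ?eqxx ?mulr0 /= ?addrA.
Qed.

Variable f : 'rV[R]_n -> R.
Hypotheses (f_smooth : smooth f) (f_supp : compactly_supported f).

(* The derivatives of a function composed with [shear] are combinations of derivatives
   composed with [shear], with polynomial coefficients. *)
Inductive pullback_class : ('rV[R]_n -> R) -> Prop :=
| pullback_base s : pullback_class (fun x => pderives s f (shear x))
| pullback_mul i a : pullback_class a -> pullback_class (fun x => x 0 i * a x)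
| pullback_opp a : pullback_class a -> pullback_class (fun x => - a x)
| pullback_add a b : pullback_class a -> pullback_class b -> pullback_class (fun x => a x + b x).

Lemma pullback_continuous a : pullback_class a -> continuous a.
Proof.
elim => [s|i {}a _ ca|{}a _ ca|{}a b _ ca _ cb] x.
- apply: continuous_comp; first exact: continuous_shear.
  by have [cs _] := f_smooth s; exact: (cs (shear x)).
- exact: (cvgM (cvg_coord (i := i) (x := x)) (ca x)).
- exact: (cvgN (ca x)).
- exact: (cvgD (ca x) (cb x)).
Qed.

Lemma pderives_eq0 s x : ~ closure [set x | f x != 0] x -> pderives s f x = 0.
Proof.
elim: s x => [|i s IHs] x /= xf.
  by apply/eqP; apply: contra_notT xf => fx; exact: subset_closure.
rewrite /pderive (near_eq_derive (g := cst 0)).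
  by rewrite derive_cst.
have := closed_openC (@closed_closure _ [set x | f x != 0]).
rewrite openE => /(_ _ xf); apply: filterS => y yf; exact: IHs.
Qed.

Lemma coord_le_norm x i : `|x 0 i| <= `|x|.
Proof.
apply: (@le_trans _ _ (mx_norm x)) => //; rewrite mx_normrE.
exact: (le_bigmax _ (fun ij : 'I_1 * 'I_n => `|x ij.1 ij.2|) (0, i)).
Qed.

Lemma pderives_bounded_support : exists2 M, 0 <= M & forall s x, (exists i, M < `|x 0 i|) ->
  pderives s f x = 0.
Proof.
have [M [_ hM]] := compact_bounded f_supp.
have M1 : M < `|M| + 1 by rewrite (le_lt_trans (ler_norm _))// ltrDl.
exists (`|M| + 1) => [|s x [i xi]]; first by rewrite addr_ge0.
apply: pderives_eq0 => xf; have := hM _ M1 x xf.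
by rewrite /= leNgt (lt_le_trans xi (coord_le_norm _ _)).
Qed.

Lemma pullback_bounded_support a : pullback_class a ->
  exists2 M, 0 <= M & forall x, (exists i, M < `|x 0 i|) -> a x = 0.
Proof.
elim => [s|i {}a _ [M M0 hM]|{}a _ [M M0 hM]|{}a b _ [M M0 hM] _ [N N0 hN]].
- have [M M0 hM] := pderives_bounded_support.
  (* If the sheared point is in the cube of half-side M, so is x', and |x_n| <= M + |x'|^2 <= M + m
     M^2. *)
  exists (M + m%:R * M ^+ 2) => [|x [i xi]]; first by rewrite addr_ge0// mulr_ge0// sqr_ge0.
  apply: hM; apply: contrapT => /forallNP h.
  have {}h j : `|shear x 0 j| <= M by rewrite leNgt; apply/negP; exact: h.
  have hu j : `|x 0 (lift ord_max j)| <= M.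
    by have := h (lift ord_max j); rewrite shear_coord eq_sym (negbTE (neq_lift _ _)).
  have mM : 0 <= m%:R * M ^+ 2 by rewrite mulr_ge0// sqr_ge0.
  have : `|x 0 i| <= M + m%:R * M ^+ 2.
    case: (unliftP ord_max i) => [j ->|->]; first by rewrite (le_trans (hu j))// lerDl.
    have := h ord_max; rewrite shear_coord eqxx => hmax.
    have hd : enorm (xinit x) ^+ 2 <= m%:R * M ^+ 2.
      rewrite enorm_sqr /dotp; apply: (@le_trans _ _ (\sum_(j < m) M ^+ 2)).
        apply: ler_sum => j _; rewrite !mxE -expr2 -real_normK ?num_real//.
        by rewrite ler_sqr ?nnegrE.
      by rewrite sumr_const card_ord mulr_natl.
    rewrite -[x 0 ord_max](subrK (enorm (xinit x) ^+ 2)).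
    apply: (le_trans (ler_normD _ _)); apply: lerD => //.
    by rewrite ger0_norm ?sqr_ge0.
  by rewrite leNgt xi.
- by exists M => // x h; rewrite hM// mulr0.
- by exists M => // x h; rewrite hM// oppr0.
- exists (M + N) => [|x [i xi]]; first by rewrite addr_ge0.
  rewrite hM ?hN ?addr0//; exists i; apply: le_lt_trans xi; by rewrite ?lerDl ?lerDr.
Qed.

(** The function is bounded on a cube and zero outside it, and on that cube the Gaussian has a
    positive lower bound. *)
Lemma pullback_dominated a : pullback_class a -> gauss_dominated a.
Proof.
move=> Ca; have ca := pullback_continuous Ca.
have [M M0 hM] := pullback_bounded_support Ca.
pose B := [set x : 'rV[R]_n | forall i, `[- M, M]%classic (x ord0 i)].
have cB : compact B.
  exact: (@rV_compact R n (fun=> `[- M, M]%classic) (fun=> @segment_compact R (- M) M)).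
have /compact_bounded[A [_ hA]] : compact (a @` B).
  by apply: continuous_compact => //; exact: continuous_subspaceT.
have A1 : A < `|A| + 1 by rewrite (le_lt_trans (ler_norm _))// ltrDl.
have h4 : 0 < 4^-1 :> R by rewrite invr_gt0.
(* A lower bound of the kernel at time 1/4 on the cube, where |x|^2 <= n M^2. *)
pose c := (4 * pi * 4^-1) `^ (- (n%:R / 2)) * expR (- (n%:R * M ^+ 2)) : R.
have c0 : 0 < c by rewrite mulr_gt0 ?expR_gt0// powR_gt0// fourpi_gt0.
exists ((`|A| + 1) / c) => x.
have C0 : 0 <= (`|A| + 1) / c by rewrite divr_ge0 ?addr_ge0// ltW.
have [Bx|nBx] := pselect (B x); last first.
  rewrite hM; first by rewrite normr0; apply: mulr_ge0 => //; exact: heat_kernel_ge0.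
  apply: contrapT => /forallNP h; apply: nBx => i.
  by rewrite /= in_itv/= -ler_norml leNgt; apply/negP; exact: h.
have h1 : `|a x| <= `|A| + 1 by apply: (hA _ A1); exists x.
apply: (le_trans h1); rewrite mulrAC ler_pdivlMr//.
apply: ler_wpM2l; first by rewrite addr_ge0.
rewrite /c /heat_kernel; apply: ler_wpM2l; first exact: powR_ge0.
rewrite ler_expR lerN2 (_ : 4 * 4^-1 = 1) ?divr1; last by field.
rewrite /dotp; apply: (@le_trans _ _ (\sum_(i < n) M ^+ 2)).
  apply: ler_sum => i _; rewrite -expr2 -real_normK ?num_real//.
  rewrite ler_sqr ?nnegrE// ler_norml; have := Bx i; rewrite /= in_itv/=.
  exact.
by rewrite sumr_const card_ord mulr_natl.
Qed.

Lemma pderives_is_derive s i x :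
  is_derive x (delta_mx 0 i) (pderives s f) (pderives (i :: s) f x).
Proof. by split => //; have [_] := f_smooth s; exact. Qed.

(** Induction on the class. In the base case, with u a partial derivative of [f], the horizontal
    derivative of u composed with [shear] is that of u minus 2 x_j times its vertical derivative,
    both composed with [shear]. *)
Lemma pullback_is_derive a i : pullback_class a -> exists2 b, pullback_class b &
  forall x, is_derive x (delta_mx 0 i) a (b x).
Proof.
elim => [s|k {}a Ca [b Cb hb]|{}a Ca [b Cb hb]|{}a a' Ca [b Cb hb] Ca' [b' Cb' hb']].
- case: (unliftP ord_max i) => [j ->|->].
    set k := lift ord_max j.
    (* The factor 2 is written as a sum, since the constructors offer multiplication by coordinates
       and not by constants. *)
    exists (fun x => pderives (k :: s) f (shear x) +
      - (x 0 k * pderives (ord_max :: s) f (shear x) +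
         x 0 k * pderives (ord_max :: s) f (shear x))).
      apply: pullback_add; first exact: pullback_base.
      by apply: pullback_opp; apply: pullback_add; apply: pullback_mul; exact: pullback_base.
    move=> x; apply: is_derive_from_line.
    under eq_fun do rewrite shear_translate.
    have [cs _] := f_smooth (ord_max :: s).
    have csig : {for 0, continuous (fun t : R => - (2 * x 0 k + t))}.
      by apply: cvgN; apply: cvgD; [exact: cvg_cst|exact: cvg_id].
    have := is_derive_chain2 (shear x) (pderives_is_derive s k)
      (pderives_is_derive s ord_max) cs csig.
    by move=> d; apply: (is_derive_eq d); rewrite /k; ring.
  exists (fun x => pderives (ord_max :: s) f (shear x)); first exact: pullback_base.
  move=> x; apply: is_derive_from_line.
  under eq_fun do rewrite shear_translate_last.
  by apply: is_derive_along; rewrite scale0r add0r; exact: pderives_is_derive.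
- exists (fun x => x 0 k * b x + (k == i)%:R * a x).
    case: eqP => _.
      rewrite (_ : (fun x => _) = fun x => x 0 k * b x + a x).
        by constructor 4 => //; constructor 2.
      by apply/funext => x; rewrite mul1r.
    rewrite (_ : (fun x => _) = fun x => x 0 k * b x); first by constructor 2.
    by apply/funext => x; rewrite mul0r addr0.
  move=> x; have dk : is_derive x (delta_mx 0 i) (fun x : 'rV[R]_n => x 0 k) (k == i)%:R.
    apply: is_derive_from_line; under eq_fun do rewrite !mxE eqxx/= mulrC.
    have d1 := is_derive1_scale (k == i)%:R (is_derive_id (0 : R) (1 : R)).
    apply: (is_derive_eq (is_derive1_add d1 (is_derive_cst (x 0 k) (0 : R) (1 : R)))).
    by rewrite mulr1 addr0.
  apply: (is_derive_eq (is_deriveM dk (hb x))).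
  by rewrite /GRing.scale/= (mulrC (a x)).
- by exists (fun x => - b x) => [|x]; [constructor 3|exact: is_deriveN].
- by exists (fun x => b x + b' x) => [|x]; [constructor 4|exact: is_deriveD].
Qed.

Lemma pullback_test_class : test_class pullback_class.
Proof.
split.
- exact: pullback_continuous.
- exact: pullback_dominated.
- by move=> a i x Ca; have [b _ hb] := pullback_is_derive i Ca; have [] := hb x.
- move=> a i Ca; have [b Cb hb] := pullback_is_derive i Ca.
  rewrite (_ : pderive i a = b)//; apply/funext => x; rewrite /pderive.
  by have [_] := hb x.
- by move=> a; exact: pullback_opp.
- by move=> a b; exact: pullback_add.
Qed.

Lemma B1inv_shear : B1inv (fun x => f (shear x)) = f.
Proof.
by apply/funext => x; rewrite /B1inv /shear xinit_join xlast_join addrK xjoinK.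
Qed.

End parabolic_pullback.

(* The dimension of the space is n = m + 1, with m >= 1. *)
Theorem theorem3p5 (R : realType) (m : nat) (hm : (1 <= m)%N)
    (f : 'rV[R]_m.+1 -> R) (f_smooth : smooth f)
    (f_supp : compactly_supported f) :
  let n := m.+1 in
  let F := parabolic_radon f in
  let g := fun x : 'rV[R]_n =>
    pi `^ (1 - n%:R) *
    \int[lebesgue_rV R m]_z
      (F (xjoin z (xlast x - 2 * dotp z (xinit x) + enorm z ^+ 2)) /
       (1 + 4 * enorm z ^+ 2) `^ ((n%:R - 1) / 2)) in
  (odd n -> f = B1inv (neg_laplacian_pow (n.-1)./2 g)) /\
  (~~ odd n ->
    let c := Gamma ((n%:R + 1) / 2) / pi `^ ((n%:R + 1) / 2) in
    let h := neg_laplacian_pow (n./2).-1 g in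
    let truncated := fun (eps : R) (x : 'rV[R]_n) =>
      \int[lebesgue_rV R n]_(y in [set y | eps < enorm y])
        ((h x - h (x - y)) / enorm y ^+ n.+1) in
    let I := fun x : 'rV[R]_n => lim (truncated eps x @[eps --> 0^'+]) in
    {uniform, truncated eps @[eps --> 0^'+] --> I} /\
    f = B1inv (fun x => c * I x)).
Proof.
move=> n; subst n => F g; pose psi x := f (shear x).
have hC := pullback_test_class f_smooth f_supp.
have Cpsi : pullback_class f psi by exact: (pullback_base f [::]).
(* From here on [g] is a normalized Riesz potential of psi, and [f] itself enters only through psi
   and its test class. *)
have gE : g = fun x => newton_const m * newton psi x.
  apply/funext => x; rewrite /g /F -(B1inv_shear f).
  exact: (radon_average_newton hm x (test_measurable hC Cpsi) (test_dominated hC Cpsi)).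
split=> [nodd|neven].
  have mk : m = m./2.*2.
    by rewrite /= -[LHS]odd_double_half; move: nodd; rewrite /= => /negbTE ->.
  by rewrite gE (newton_inversion_odd hm hC Cpsi mk) B1inv_shear.
move=> c h tr I; pose k := (m.+1./2).-1.
(* [n] even means m = 2 k + 1, so that k = n/2 - 1 powers of -Delta lower the exponent m/2 exactly
   to 1/2. *)
have mk : m%:R / 2 = 2^-1 + k%:R :> R.
  have -> : m = k.*2.+1.
    rewrite /k -[LHS]odd_double_half /= uphalf_half.
    by move: neven; rewrite /= negbK => ->; rewrite add1n.
  by rewrite -natr1 -muln2 natrM; field.
have Ca := test_neg_laplacian_pow hC k Cpsi.
have hE : h = fun x => newton_const m * newton (neg_laplacian_pow k psi) x.
  by rewrite /h gE (neg_laplacian_pow_newton hm hC).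
have mh : measurable_fun setT h by rewrite hE; exact (measurable_newton hm hC Ca).
have [H _ hH] : exists2 H, 0 <= H & forall x, `|h x| <= H.
  by rewrite hE; exact (newton_bounded hm hC Ca).
have [K _ hK] : exists2 K, 0 <= K & forall x y,
    `|2 * h x - h (x - y) - h (x + y)| <= K * dotp y y.
  by rewrite hE; exact (newton_second_difference hm hC Ca).
have hhalf x : h x = (Num.sqrt pi)^-1 * riesz 2^-1 psi x.
  by rewrite hE (newton_half_riesz hm hC x Cpsi mk).
have Dle := second_difference_min1_le hH hK.
have IE : I = half_limit h.
  by apply/funext => x; exact: (truncated_lim mh hH Dle).
split; first by rewrite IE; exact: (truncated_uniform mh hH Dle).
rewrite -[LHS](B1inv_shear f); congr B1inv; apply/funext => x; rewrite IE.
by rewrite -[LHS](half_kernel_inversion hm hC Cpsi hhalf mh hH hK).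
Qed.
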